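(* Let $\alpha>-1$ and let $k\ge 2$ be an integer. Let $\phi(z)=\overline{g(z)}+f(z)$, where $f(z)=\sum_{n=0}^{N} a_n\dfrac{z^n}{\gamma_n}$ and $g(z)=\sum_{n=1}^{m} a_{-n}\dfrac{z^n}{\gamma_{n}}$ (with complex coefficients). Then the slant little Hankel operator $\mathcal{S}_\phi^{k,\alpha}$ is normal on the weighted Bergman space $\mathcal{A}_\alpha^2(\mathbb{D})$ if and only if $a_{-n}=0$ for all $1\le n\le m$.
   Context: $\mathbb{D}$ is the open unit disc in $\mathbb{C}$, $dA$ the normalized area measure on $\mathbb{D}$, and for $\alpha>-1$, $dA_\alpha(z)=(1+\alpha)(1-|z|^2)^\alpha dA(z)$. $\mathcal{A}_\alpha^2(\mathbb{D})$ is the weighted Bergman space: the closed subspace of analytic functions in $\mathcal{L}^2_\alpha(\mathbb{D})=L^2(\mathbb{D},dA_\alpha)$, with the inner product $\langle f,g\rangle=\int_{\mathbb{D}} f\overline{g}\,dA_\alpha$. It has orthonormal basis $e_p(z)=z^p/\gamma_p$, $p\ge 0$, where $\gamma_p=\sqrt{\Gamma(p+1)\Gamma(\alpha+2)/\Gamma(p+\alpha+2)}$. $P_\alpha$ is the orthogonal projection of $\mathcal{L}^2_\alpha(\mathbb{D})$ onto $\mathcal{A}_\alpha^2(\mathbb{D})$. $J$ is the flip operator $(Jf)(z)=f(\overline{z})$ and $M_\phi$ is multiplication by $\phi$. For bounded measurable $\phi$, the little Hankel operator on $\mathcal{A}_\alpha^2(\mathbb{D})$ is $\mathcal{H}_\phi^\alpha=P_\alpha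 J M_\phi$. For an integer $k\ge 2$, $W_k$ is the bounded linear operator on $\mathcal{A}_\alpha^2(\mathbb{D})$ with $W_k e_p=z^{p/k}/\gamma_{p/k}$ if $k\mid p$ and $W_k e_p=0$ otherwise. The $k$-th order slant little Hankel operator is $\mathcal{S}_\phi^{k,\alpha}=W_k\mathcal{H}_\phi^\alpha$. *)

(* Defs.v *)
From HB Require Import structures.
From mathcomp Require Import all_boot all_order all_algebra.
From mathcomp Require Import all_classical all_reals all_analysis.
From mathcomp.real_closed Require Import complex.

Set Implicit Arguments.
Unset Strict Implicit.
Unset Printing Implicit Defensive.

Import Order.TTheory GRing.Theory Num.Theory.
Import numFieldNormedType.Exports.

Local Open Scope classical_set_scope.
Local Open Scope ring_scope.
Local Open Scope complex_scope.

Definition unit_disc (R : realType) : set R[i] := [set z | `|z| < 1].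

(* Functions on the disc are functions R[i] -> R[i] that vanish off the disc,
   so that Leibniz equality is equality on the disc. *)
Definition on_disc (R : realType) (f : R[i] -> R[i]) : R[i] -> R[i] :=
  fun z => if `|z| < 1 then f z else 0.

(* Integration over the disc goes through the identification of R[i] with
   R * R; the factor pi^-1 normalizes the area measure. *)
Definition toC (R : realType) (p : R * R) : R[i] := p.1 +i* p.2.

Definition planar_disc (R : realType) : set (R * R) :=
  @toC R @^-1` @unit_disc R.

Definition weight (R : realType) (alpha : R) (z : R[i]) : R :=
  (1 + alpha) * (1 - Normc.normc z ^+ 2) `^ alpha / pi.

Definition integral_dA (R : realType) (alpha : R) (u : R[i] -> R) : \bar R :=
  (\int[lebesgue_measure \x lebesgue_measure]_(p in @planar_disc R)
     (u (toC p) * weight alpha (toC p))%:E)%E.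

Definition Cintegral_dA (R : realType) (alpha : R) (u : R[i] -> R[i]) : R[i] :=
  fine (integral_dA alpha (fun z => complex.Re (u z)))
  +i* fine (integral_dA alpha (fun z => complex.Im (u z))).

Definition inner (R : realType) (alpha : R) (f g : R[i] -> R[i]) : R[i] :=
  Cintegral_dA alpha (fun z => f z * conjc (g z)).

Definition norm2 (R : realType) (alpha : R) (f : R[i] -> R[i]) : R :=
  Num.sqrt (fine (integral_dA alpha (fun z => Normc.normc (f z) ^+ 2))).

Definition L2 (R : realType) (alpha : R) (f : R[i] -> R[i]) : Prop :=
  [/\ measurable_fun (@planar_disc R) (fun p => complex.Re (f (toC p))),
      measurable_fun (@planar_disc R) (fun p => complex.Im (f (toC p))) &
      (integral_dA alpha (fun z => Normc.normc (f z) ^+ 2)%R < +oo)%E].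

(* Complex differentiability: the scalar field is R[i] itself. *)
Definition analytic_on_disc (R : realType) (f : R[i] -> R[i]) : Prop :=
  forall z, unit_disc z -> derivable (f : R[i]^o -> R[i]^o) z 1.

Definition bergman (R : realType) (alpha : R) : set (R[i] -> R[i]) :=
  [set f | [/\ (forall z, ~ unit_disc z -> f z = 0),
               analytic_on_disc f & L2 alpha f]].

Definition Gamma (R : realType) (x : R) : R :=
  Rintegral lebesgue_measure `]0, +oo[ (fun t => t `^ (x - 1) * expR (- t)).

Definition gamma_ (R : realType) (alpha : R) (p : nat) : R :=
  Num.sqrt (Gamma (p%:R + 1) * Gamma (alpha + 2) / Gamma (p%:R + alpha + 2)).

Definition basis_e (R : realType) (alpha : R) (p : nat) : R[i] -> R[i] :=
  on_disc (fun z => z ^+ p / (gamma_ alpha p)%:C).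

Definition is_bergman_proj (R : realType) (alpha : R) (h u : R[i] -> R[i]) :
    Prop :=
  bergman alpha u /\
  forall v, bergman alpha v -> inner alpha (fun z => h z - u z) v = 0.

(* The projection theorem gives a unique u for each h in L2; the default value
   only serves for h outside L2. *)
Definition bergman_proj (R : realType) (alpha : R) (h : R[i] -> R[i]) :
    R[i] -> R[i] :=
  xget (fun=> 0) [set u | is_bergman_proj alpha h u].

Definition flip (R : realType) (f : R[i] -> R[i]) : R[i] -> R[i] :=
  fun z => f (conjc z).

Definition mult_by (R : realType) (phi f : R[i] -> R[i]) : R[i] -> R[i] :=
  fun z => phi z * f z.

Definition little_hankel (R : realType) (alpha : R) (phi : R[i] -> R[i])
    (f : R[i] -> R[i]) : R[i] -> R[i] :=
  bergman_proj alpha (flip (mult_by phi f)).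

(* Operators on the Bergman space are maps on all functions; only their values
   on bergman alpha matter. *)
Definition is_bounded_operator (R : realType) (alpha : R)
    (T : (R[i] -> R[i]) -> R[i] -> R[i]) : Prop :=
  [/\ forall f, bergman alpha f -> bergman alpha (T f),
      forall (c : R[i]) f g, bergman alpha f -> bergman alpha g ->
        T (fun z => c * f z + g z) = (fun z => c * T f z + T g z) &
      exists M : R, forall f, bergman alpha f ->
        norm2 alpha (T f) <= M * norm2 alpha f].

(* Boundedness and density of the span of the e_p determine W on the space. *)
Definition is_W (R : realType) (alpha : R) (k : nat)
    (W : (R[i] -> R[i]) -> R[i] -> R[i]) : Prop :=
  is_bounded_operator alpha W /\
  forall p : nat, W (basis_e alpha p) =
    if (k %| p)%N then basis_e alpha (p %/ k)%N else (fun=> 0).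

Definition slant_little_hankel (R : realType) (alpha : R)
    (W : (R[i] -> R[i]) -> R[i] -> R[i]) (phi : R[i] -> R[i])
    (f : R[i] -> R[i]) : R[i] -> R[i] :=
  W (little_hankel alpha phi f).

Definition is_adjoint (R : realType) (alpha : R)
    (T T' : (R[i] -> R[i]) -> R[i] -> R[i]) : Prop :=
  is_bounded_operator alpha T' /\
  forall f g, bergman alpha f -> bergman alpha g ->
    inner alpha (T f) g = inner alpha f (T' g).

Definition normal_operator (R : realType) (alpha : R)
    (T : (R[i] -> R[i]) -> R[i] -> R[i]) : Prop :=
  is_bounded_operator alpha T /\
  exists T', is_adjoint alpha T T' /\
    forall f, bergman alpha f -> T (T' f) = T' (T f).

Definition symbol_f (R : realType) (alpha : R) (a : int -> R[i]) (N : nat) :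
    R[i] -> R[i] :=
  fun z => \sum_(0 <= n < N.+1) a n%:Z * (z ^+ n / (gamma_ alpha n)%:C).

Definition symbol_g (R : realType) (alpha : R) (a : int -> R[i]) (m : nat) :
    R[i] -> R[i] :=
  fun z => \sum_(1 <= n < m.+1) a (- n%:Z) * (z ^+ n / (gamma_ alpha n)%:C).

Definition symbol_phi (R : realType) (alpha : R) (a : int -> R[i])
    (N m : nat) : R[i] -> R[i] :=
  fun z => conjc (symbol_g alpha a m z) + symbol_f alpha a N z.

(* Main.v *)
(** Write T for the slant operator. Against the basis, the little Hankel operator
    sends e_j to a combination of the monomials z^(n-j), where j <= n <= m, with
    coefficients proportional to conj a_{-n}, plus a constant coming from f, because
    P(z^n conj(z)^j) is a multiple of z^(n-j), or 0 when n < j.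

    If T is normal, let M be the largest index with a_{-M} <> 0. Then T e_M = c with a
    constant c <> 0, while <T e_j, e_M> = 0 for every j, because W_k sends z^i to a
    multiple of z^(i/k) or to 0 and no monomial of degree above M occurs. Hence
    T' e_M = 0, so T' c = T' T e_M = T T' e_M = 0 and
    |c|^2 |1|^2 = <T e_M, c> = <e_M, T' c> = 0, a contradiction. Conversely, if all the
    a_{-n} vanish, the mean value property gives T u = f(0) u(0), a multiple of an
    orthogonal projection of rank one.

    Completeness of the monomials rests on the Taylor coefficients of a holomorphic
    function, obtained from Goursat's theorem for rectangles through the chart w |-> exp w,
    and on Bessel's inequality on circles. Area integrals reduce to circle means by
    the rotation invariance of plane Lebesgue measure. *)

From HB Require Import structures.
Require Import Defs.
From mathcomp Require Import all_boot all_order all_algebra.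
From mathcomp Require Import all_classical all_reals all_analysis.
From mathcomp.real_closed Require Import complex.
From mathcomp Require Import measurable_realfun ring lra.

Set Implicit Arguments.
Unset Strict Implicit.
Unset Printing Implicit Defensive.

Import Order.TTheory GRing.Theory Num.Theory.
Import numFieldNormedType.Exports Normc.

Local Open Scope classical_set_scope.
Local Open Scope ring_scope.
Local Open Scope complex_scope.

(** * Goursat's theorem on rectangles *)

Section IntervalIntegral.
Context {R : realType}.
Implicit Types (a b c k e : R) (f g : R -> R).
Local Notation mu := (@lebesgue_measure R).

(** Analytic means complex differentiable at each point, with no continuity of the derivative; hence
    Goursat's bisection rather than Green's formula. In the exponential chart an annulus becomes a
    rectangle whose two horizontal sides carry the same values by periodicity, so closedness of a
    1-form says that circle integrals do not depend on the radius. No power series is summed: a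
    Taylor coefficient is the Fourier integral [taylor_int], and homogeneity shows that it is
    [c * z ^+ k]. That a function with all these integrals zero vanishes is seen from a difference
    quotient that is only known to be continuous, which is where Bessel's inequality comes in.
    Completeness acts twice: it makes the projection unique, so that the choice made by [xget] is
    computed from an explicit candidate, and it turns orthogonality of T' e_M to all monomials into
    T' e_M = 0. A second obstacle is the weight, unbounded near the circle when alpha < 0: its total
    mass must be shown finite before even constants are integrable. *)

Definition itv_int a b f : R := Rintegral mu `[a, b] f.

(** Two-sided continuity at each point of the closed interval, endpoints included; it restricts to
    subintervals without a subspace topology. *)
Definition cont_on a b f : Prop := forall x, a <= x <= b -> {for x, continuous f}.

Lemma cont_on_integrable a b f : cont_on a b f ->
  mu.-integrable `[a, b] (EFin \o f).
Proof.
move=> cf; apply: continuous_compact_integrable; first exact: segment_compact.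
by apply: continuous_in_subspaceT => x /set_mem /=; rewrite in_itv/= => /cf.
Qed.

Lemma cont_onS a b c d f : a <= c -> d <= b -> cont_on a b f -> cont_on c d f.
Proof.
by move=> ac db cf x /andP[cx xd]; apply: cf; rewrite (le_trans ac)//= (le_trans xd).
Qed.

Lemma itv_int_split a b c f : a <= c <= b -> cont_on a b f ->
  itv_int a b f = itv_int a c f + itv_int c b f.
Proof.
move=> /andP[ac cb] cf.
have := @Rintegral_itvB R f (BLeft a) (BRight b) c (cont_on_integrable cf).
rewrite !bnd_simp => /(_ ac cb).
rewrite Rintegral_itv_obnd_cbnd; last first.
  apply: integrableS (cont_on_integrable (cont_onS ac (lexx b) cf)) => //.
  by apply: subset_itvr; rewrite bnd_simp.
by rewrite /itv_int => <-; rewrite addrC subrK.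
Qed.

Lemma itv_intB a b f g : cont_on a b f -> cont_on a b g ->
  itv_int a b (fun x => f x - g x) = itv_int a b f - itv_int a b g.
Proof. by move=> cf cg; apply: RintegralB => //; exact: cont_on_integrable. Qed.

Lemma itv_int_cst a b k : a <= b -> itv_int a b (fun=> k) = k * (b - a).
Proof.
move=> ab; rewrite /itv_int Rintegral_cst//.
have := lebesgue_measure_itv `[a, b]; rewrite /= lte_fin => ->.
by move: ab; rewrite le_eqVlt => /predU1P[->|->]//=; rewrite ltxx subrr.
Qed.

Lemma cont_onB a b f g : cont_on a b f -> cont_on a b g ->
  cont_on a b (fun x => f x - g x).
Proof. by move=> cf cg x xab; apply: cvgB; [exact: cf|exact: cg]. Qed.

Lemma cont_on_cst a b k : cont_on a b (fun=> k).
Proof. by move=> x _; exact: cst_continuous. Qed.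

Lemma le_itv_int a b f g : cont_on a b f -> cont_on a b g ->
  (forall x, a <= x <= b -> f x <= g x) -> itv_int a b f <= itv_int a b g.
Proof.
move=> cf cg fg.
apply: le_Rintegral => //; exact: cont_on_integrable.
Qed.

Lemma itv_int_near a b f k e : a <= b -> cont_on a b f ->
  (forall x, a <= x <= b -> `|f x - k| <= e) ->
  `|itv_int a b f - k * (b - a)| <= e * (b - a).
Proof.
move=> ab cf fk; rewrite ler_norml.
have h1 : itv_int a b f <= itv_int a b (fun=> k + e).
  apply: le_itv_int => //; first exact: cont_on_cst.
  by move=> x /fk; rewrite ler_norml => /andP[_]; lra.
have h2 : itv_int a b (fun=> k - e) <= itv_int a b f.
  apply: le_itv_int => //; first exact: cont_on_cst.
  by move=> x /fk; rewrite ler_norml => /andP[+ _]; lra.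
rewrite !itv_int_cst// in h1 h2; apply/andP; split; lra.
Qed.

End IntervalIntegral.

(** * Circulation of a closed 1-form around a rectangle *)

Section Circulation.
Context {R : realType}.
Implicit Types P Q : R -> R -> R.

(* The partial derivatives dP/dy and dQ/dx share the value c: the 1-form
   P dx + Q dy is closed at (x, y). *)
Definition closed_form_at P Q (x y : R) : Prop :=
  exists p q c : R, forall e : R, 0 < e -> exists2 d, 0 < d &
    forall h l, `|h| < d -> `|l| < d ->
    `|P (x + h) (y + l) - P x y - (p * h + c * l)| <= e * (`|h| + `|l|) /\
    `|Q (x + h) (y + l) - Q x y - (c * h + q * l)| <= e * (`|h| + `|l|).

(** The counterclockwise line integral of P dx + Q dy along the boundary of [[a, b] x [c, d]]. *)
Definition circulation P Q (a b c d : R) : R :=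
  (itv_int a b (P ^~ c) - itv_int a b (P ^~ d)) +
  (itv_int c d (Q b) - itv_int c d (Q a)).

Lemma lipschitz_at_continuous (f : R -> R) (x k : R) :
  (forall e, 0 < e -> exists2 d, 0 < d & forall h, `|h| < d ->
    `|f (x + h) - f x - k * h| <= e * `|h|) -> {for x, continuous f}.
Proof.
move=> H; apply/cvgrPdist_lt => /= e e0.
have [d d0 Hd] := H 1 ltr01.
have K0 : 0 < `|k| + 1 by rewrite ltr_pwDr.
near=> t.
have td : `|t - x| < d by rewrite distrC; near: t; exact: (nbhsx_ballx x d d0).
have te : `|t - x| < e / (`|k| + 1).
  rewrite distrC; near: t; exact: (nbhsx_ballx x _ (divr_gt0 e0 K0)).
have := Hd _ td; rewrite [x + _]addrC subrK => {}Hd.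
rewrite distrC.
have -> : f t - f x = (f t - f x - k * (t - x)) + k * (t - x) by rewrite subrK.
rewrite (le_lt_trans (ler_normD _ _))// normrM.
rewrite (le_lt_trans (lerD Hd (lexx _)))// -mulrDl addrC.
by rewrite -ltr_pdivlMl// mulrC.
Unshelve. all: by end_near. Qed.

Lemma closed_form_continuous1 P Q x y : closed_form_at P Q x y ->
  {for x, continuous (P ^~ y)}.
Proof.
move=> [p [q [c H]]]; apply: (@lipschitz_at_continuous _ _ p) => e e0.
have [d d0 Hd] := H _ e0; exists d => // h hd.
have [] := Hd h 0 hd; first by rewrite normr0.
by rewrite normr0 !(addr0, mulr0).
Qed.

Lemma closed_form_continuous2 P Q x y : closed_form_at P Q x y ->
  {for y, continuous (Q x)}.
Proof.
move=> [p [q [c H]]]; apply: (@lipschitz_at_continuous _ _ q) => e e0.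
have [d d0 Hd] := H _ e0; exists d => // h hd.
have [] := Hd 0 h _ hd; first by rewrite normr0.
by rewrite normr0 !(addr0, mulr0, add0r).
Qed.

Definition closed_form_on P Q (a b c d : R) : Prop :=
  forall x y, a <= x <= b -> c <= y <= d -> closed_form_at P Q x y.

Section OnRectangle.
Variables (P Q : R -> R -> R) (a b c d : R).
Hypothesis PQ : closed_form_on P Q a b c d.

Lemma closed_form_cont1 y x1 x2 : c <= y <= d -> a <= x1 -> x2 <= b ->
  cont_on x1 x2 (P ^~ y).
Proof.
move=> ycd ax xb x /andP[x1x xx2]; apply: (@closed_form_continuous1 P Q).
by apply: PQ => //; rewrite (le_trans ax)// (le_trans xx2).
Qed.

Lemma closed_form_cont2 x y1 y2 : a <= x <= b -> c <= y1 -> y2 <= d ->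
  cont_on y1 y2 (Q x).
Proof.
move=> xab cy yd y /andP[y1y yy2]; apply: (@closed_form_continuous2 P Q).
by apply: PQ => //; rewrite (le_trans cy)// (le_trans yy2).
Qed.

(** Each inner edge is traversed twice in opposite directions and cancels; the outer edges add up by
    [itv_int_split]. *)
Lemma circulation_split x0 x1 x2 y0 y1 y2 :
  a <= x0 -> x0 <= x1 -> x1 <= x2 -> x2 <= b ->
  c <= y0 -> y0 <= y1 -> y1 <= y2 -> y2 <= d ->
  circulation P Q x0 x2 y0 y2 =
  circulation P Q x0 x1 y0 y1 + circulation P Q x1 x2 y0 y1 +
  (circulation P Q x0 x1 y1 y2 + circulation P Q x1 x2 y1 y2).
Proof.
move=> ? ? ? ? ? ? ? ?; rewrite /circulation.
have S1 y : c <= y <= d -> itv_int x0 x2 (P ^~ y) =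
    itv_int x0 x1 (P ^~ y) + itv_int x1 x2 (P ^~ y).
  by move=> ?; apply: itv_int_split; [lra|apply: closed_form_cont1; lra].
have S2 x : a <= x <= b -> itv_int y0 y2 (Q x) =
    itv_int y0 y1 (Q x) + itv_int y1 y2 (Q x).
  by move=> ?; apply: itv_int_split; [lra|apply: closed_form_cont2; lra].
rewrite (S1 y0) ?(S1 y2) ?(S2 x0) ?(S2 x2); lra.
Qed.

End OnRectangle.

(* Near a point of differentiability the linear parts of P and Q cancel, so
   the circulation is small compared with the area. *)
Lemma circulation_small P Q a b c d x y : closed_form_on P Q a b c d ->
  a <= x <= b -> c <= y <= d -> forall e, 0 < e -> exists2 r, 0 < r &
  forall x1 x2 y1 y2, a <= x1 <= x -> x <= x2 <= b -> c <= y1 <= y ->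
    y <= y2 <= d -> x2 - x1 < r -> y2 - y1 < r ->
  `|circulation P Q x1 x2 y1 y2| <= e * ((x2 - x1) + (y2 - y1)) ^+ 2.
Proof.
move=> PQ xab ycd e e0; have [p [q [k H]]] := PQ _ _ xab ycd.
have e20 : 0 < e / 2 by rewrite divr_gt0.
have [r r0 Hr] := H _ e20; exists r => // x1 x2 y1 y2 hx1 hx2 hy1 hy2 rx ry.
pose D := (x2 - x1) + (y2 - y1).
have bnd s t : x1 <= s <= x2 -> y1 <= t <= y2 ->
  `|P s t - P x y - (p * (s - x) + k * (t - y))| <= e / 2 * D /\
  `|Q s t - Q x y - (k * (s - x) + q * (t - y))| <= e / 2 * D.
  move=> hs ht.
  have nD : `|s - x| + `|t - y| <= D.
    apply: lerD; rewrite ler_norml; apply/andP; split; lra.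
  have sx : `|s - x| < r by rewrite ltr_norml; apply/andP; split; lra.
  have ty : `|t - y| < r by rewrite ltr_norml; apply/andP; split; lra.
  have [] := Hr (s - x) (t - y) sx ty.
  rewrite ![_ + (_ - _)]addrC !subrK => h1 h2.
  by split; [apply: (le_trans h1)|apply: (le_trans h2)]; rewrite ler_wpM2l// ltW.
have [x11 x12] : x1 <= x1 <= x2 /\ x1 <= x2 <= x2 by lra.
have [y11 y12] : y1 <= y1 <= y2 /\ y1 <= y2 <= y2 by lra.
have [ax1 x2b] : a <= x1 /\ x2 <= b by case/andP: hx1; case/andP: hx2.
have [cy1 y2d] : c <= y1 /\ y2 <= d by case/andP: hy1; case/andP: hy2.
have cP t : y1 <= t <= y2 -> cont_on x1 x2 (P ^~ t).
  move=> /andP[y1t ty2]; apply: (closed_form_cont1 PQ) => //.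
  by rewrite (le_trans cy1) ?(le_trans ty2).
have cQ s : x1 <= s <= x2 -> cont_on y1 y2 (Q s).
  move=> /andP[x1s sx2]; apply: (closed_form_cont2 PQ) => //.
  by rewrite (le_trans ax1) ?(le_trans sx2).
have IP : `|itv_int x1 x2 (fun s => P s y1 - P s y2)
    - (k * (y1 - y2)) * (x2 - x1)| <= e * D * (x2 - x1).
  apply: itv_int_near; first lra.
    by apply: cont_onB; exact: cP.
  move=> s hs; have [] := bnd s y1 hs y11; have [] := bnd s y2 hs y12.
  rewrite !ler_norml => /andP[? ?] _ /andP[? ?] _; apply/andP; split; lra.
have IQ : `|itv_int y1 y2 (fun t => Q x2 t - Q x1 t)
    - (k * (x2 - x1)) * (y2 - y1)| <= e * D * (y2 - y1).
  apply: itv_int_near; first lra.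
    by apply: cont_onB; exact: cQ.
  move=> t ht; have [] := bnd x1 t x11 ht; have [] := bnd x2 t x12 ht.
  rewrite !ler_norml => _ /andP[? ?] _ /andP[? ?]; apply/andP; split; lra.
rewrite /circulation -(itv_intB (cP _ y11) (cP _ y12)) -(itv_intB (cQ _ x12) (cQ _ x11)).
move: IP IQ; set A := itv_int _ _ _; set B := itv_int _ _ _ => IP IQ.
have -> : A + B = (A - k * (y1 - y2) * (x2 - x1)) +
  (B - k * (x2 - x1) * (y2 - y1)) by ring.
apply: (le_trans (ler_normD _ _)); apply: (le_trans (lerD IP IQ)).
by rewrite -mulrDr -mulrA -expr2.
Qed.

End Circulation.

(** * Goursat's bisection *)

Section Goursat.
Context {R : realType}.
Implicit Types P Q : R -> R -> R.

(** A circulation of modulus [eta > 0] leaves, at each halving of the sides, a quarter rectangle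
    with at least a quarter of it. The nested rectangles shrink to a point, where
    [circulation_small] bounds the circulation by a smaller multiple of the squared size. *)
Lemma closed_form_circulation0 P Q a b c d : a <= b -> c <= d ->
  closed_form_on P Q a b c d -> circulation P Q a b c d = 0.
Proof.
move=> ab cd PQ; apply/eqP; rewrite -normr_eq0 eq_le normr_ge0 andbT leNgt.
apply/negP; move etaE : `|_| => eta eta0.
pose w n : R := (b - a) / 2 ^+ n; pose h n : R := (d - c) / 2 ^+ n.
have w0 n : 0 <= w n by rewrite divr_ge0 ?exprn_ge0// subr_ge0.
have h0 n : 0 <= h n by rewrite divr_ge0 ?exprn_ge0// subr_ge0.
have wS n : w n = w n.+1 + w n.+1.
  by rewrite /w exprS; field; rewrite expf_neq0.
have hS n : h n = h n.+1 + h n.+1.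
  by rewrite /h exprS; field; rewrite expf_neq0.
have wE n : w n = (b - a) / 2 ^+ n by [].
have hE n : h n = (d - c) / 2 ^+ n by [].
clearbody w h.
(* [p] is the lower left corner of a rectangle of generation [n] that keeps at least [eta / 4 ^+ n]
   of the circulation. *)
pose inv n (p : R * R) := [/\ a <= p.1 /\ p.1 + w n <= b,
  c <= p.2 /\ p.2 + h n <= d &
  eta / 4 ^+ n <= `|circulation P Q p.1 (p.1 + w n) p.2 (p.2 + h n)|].
pose next n (p q : R * R) := inv n.+1 q /\
  (p.1 <= q.1 <= p.1 + w n.+1 /\ p.2 <= q.2 <= p.2 + h n.+1).
(* The implication stands under the existential so that [choice] yields a total successor
   function. *)
have step n p : exists q, inv n p -> next n p q.
  have [|ninv] := pselect (inv n p); last by exists p.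
  move=> [[ap pb] [cp pd] big].
  have wn := wS n; have hn := hS n; have ? := w0 n.+1; have ? := h0 n.+1.
  have [//|] := pselect (exists q, inv n p -> next n p q).
  move=> nex; exfalso.
  (* If no quarter could serve, each of the four would carry less than [eta / 4 ^+ n.+1], and
     together less than [eta / 4 ^+ n]. *)
  have small i j : (i = 0 \/ i = w n.+1) -> (j = 0 \/ j = h n.+1) ->
      `|circulation P Q (p.1 + i) (p.1 + i + w n.+1) (p.2 + j) (p.2 + j + h n.+1)|
      < eta / 4 ^+ n.+1.
    move=> hi hj; rewrite ltNge; apply/negP => le1; apply: nex.
    have {}hi : 0 <= i <= w n.+1 by case: hi => ->; apply/andP; split; lra.
    have {}hj : 0 <= j <= h n.+1 by case: hj => ->; apply/andP; split; lra.
    exists (p.1 + i, p.2 + j) => _; split; last by split => /=; lra.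
    by split => //=; split; lra.
  have p1w : p.1 <= p.1 + w n.+1 by rewrite lerDl.
  have p1ww : p.1 + w n.+1 <= p.1 + w n by rewrite lerD2l wn lerDl.
  have p2h : p.2 <= p.2 + h n.+1 by rewrite lerDl.
  have p2hh : p.2 + h n.+1 <= p.2 + h n by rewrite lerD2l hn lerDl.
  have E := circulation_split PQ ap p1w p1ww pb cp p2h p2hh pd.
  have := small 0 0 (or_introl erefl) (or_introl erefl).
  have := small (w n.+1) 0 (or_intror erefl) (or_introl erefl).
  have := small 0 (h n.+1) (or_introl erefl) (or_intror erefl).
  have := small (w n.+1) (h n.+1) (or_intror erefl) (or_intror erefl).
  rewrite !addr0 -!addrA -wS -hS => s4 s3 s2 s1.
  move: big; rewrite E.
  have e4 : eta / 4 ^+ n = 4 * (eta / 4 ^+ n.+1) by rewrite exprS; field; rewrite expf_neq0.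
  rewrite e4 leNgt => /negP; apply.
  apply: (le_lt_trans (ler_normD _ _)).
  apply: (le_lt_trans (lerD (ler_normD _ _) (ler_normD _ _))).
  lra.
have [nx nxP] := choice (fun np : nat * (R * R) => step np.1 np.2).
pose p := fix p n := if n is m.+1 then nx (m, p m) else (a, c).
have pinv n : inv n (p n).
  elim: n => [|n IH]; last by have [] := nxP (n, p n) IH.
  rewrite /inv /= wE hE !expr0 !divr1.
  have -> : a + (b - a) = b by ring.
  have -> : c + (d - c) = d by ring.
  by split => //; rewrite etaE.
have pnext n : next n (p n) (p n.+1) by exact: (nxP (n, p n) (pinv n)).
have mono n m : (p n).1 <= (p (m + n)%N).1 <= (p n).1 + w n /\
    (p n).2 <= (p (m + n)%N).2 <= (p n).2 + h n /\
    ((p (m + n)%N).1 + w (m + n)%N <= (p n).1 + w n /\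
    (p (m + n)%N).2 + h (m + n)%N <= (p n).2 + h n).
  elim: m => [|m IH]; first by rewrite add0n; have ? := w0 n; have ? := h0 n; lra.
  rewrite addSn; have [_ N] := pnext (m + n)%N.
  have := wS (m + n)%N; have := hS (m + n)%N; have := w0 (m + n).+1.
  have := h0 (m + n).+1; move: IH N.
  by move: (w (m + n)%N) (w (m + n).+1) (h (m + n)%N) (h (m + n).+1) => *; lra.
(* Nested intervals, for either coordinate: every upper end bounds all lower ends, so the supremum
   of the lower ends lies in each interval. *)
have xP (f : R * R -> R) v : (forall n m, f (p n) <= f (p (m + n)%N) <= f (p n) + v n)
   -> exists x, forall n, f (p n) <= x <= f (p n) + v n.
  move=> H; pose A := [set f (p n) | n in [set: nat]].
  have ub n : ubound A (f (p n) + v n).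
    move=> _ [m _ <-].
    have [nm|mn] := leqP n m; first by have := H n (m - n)%N; rewrite subnK// => /andP[].
    have := H m (n - m)%N; have := H n 0%N; rewrite add0n subnK ?(ltnW mn)//.
    lra.
  have A0 : A !=set0 by exists (f (p 0%N)); exists 0%N.
  exists (sup A) => n; apply/andP; split.
    by apply: ub_le_sup; [exists (f (p 0%N) + v 0%N)|exists n].
  by apply: ge_sup.
have [x xb] := xP fst w (fun n m => (mono n m).1).
have [y yb] := xP snd h (fun n m => (mono n m).2.1).
have xab : a <= x <= b by have := xb 0%N; rewrite wE expr0 divr1 /=; lra.
have ycd : c <= y <= d by have := yb 0%N; rewrite hE expr0 divr1 /=; lra.
(* The summand 1 keeps [D] positive for a degenerate rectangle. *)
pose D := (b - a) + (d - c) + 1.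
have D0 : 0 < D by rewrite /D; lra.
(* With this tolerance the bound at generation [n] is at most [eta / 2 / 4 ^+ n], half of what [inv]
   guarantees. *)
have e0 : 0 < eta / (2 * D ^+ 2) by rewrite divr_gt0// mulr_gt0// exprn_gt0.
have [r r0 Hr] := circulation_small PQ xab ycd e0.
have [n nD] : exists n, D / 2 ^+ n < r.
  exists (Num.truncn (D / r)).+1.
  rewrite ltr_pdivrMr ?exprn_gt0// mulrC -ltr_pdivrMr//.
  apply: (lt_le_trans (truncnS_gt _)).
  rewrite -natrX ler_nat; exact/ltnW/ltn_expl.
have [[ap pb] [cp pd] big] := pinv n.
have wD : w n < r /\ h n < r /\ w n + h n <= D / 2 ^+ n.
  have i0 : 0 < (2 ^+ n : R)^-1 by rewrite invr_gt0 exprn_gt0.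
  rewrite wE hE -mulrDl; split; [|split].
  - by apply: le_lt_trans nD; rewrite ler_pM2r// /D; lra.
  - by apply: le_lt_trans nD; rewrite ler_pM2r// /D; lra.
  - by rewrite ler_pM2r// /D; lra.
have /andP[p1x xp1] := xb n; have /andP[p2y yp2] := yb n; move: wD => [wr [hr whD]].
have := Hr _ _ _ _ (introT andP (conj ap p1x)) (introT andP (conj xp1 pb))
  (introT andP (conj cp p2y)) (introT andP (conj yp2 pd)).
have -> : (p n).1 + w n - (p n).1 = w n by ring.
have -> : (p n).2 + h n - (p n).2 = h n by ring.
move=> /(_ wr hr) le1; have := le_trans big le1; apply/negP; rewrite -ltNge.
have : eta / (2 * D ^+ 2) * (w n + h n) ^+ 2 <=
   eta / (2 * D ^+ 2) * (D / 2 ^+ n) ^+ 2.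
  by rewrite ler_pM2l// ler_sqr ?nnegrE ?addr_ge0// divr_ge0// ?exprn_ge0// ltW.
move=> /le_lt_trans; apply.
have -> : eta / (2 * D ^+ 2) * (D / 2 ^+ n) ^+ 2 = eta / 2 / 4 ^+ n.
  have -> : (4 : R) ^+ n = (2 ^+ n) ^+ 2.
    by rewrite -exprM mulnC exprM; congr (_ ^+ _); ring.
  have tn0 : (2 : R) ^+ n != 0 by rewrite expf_neq0.
  by have D1 := lt0r_neq0 D0; field; rewrite ?tn0 ?D1.
by rewrite ltr_pM2r ?invr_gt0 ?exprn_gt0//; lra.
Qed.

End Goursat.

(** * Circle means of holomorphic functions *)

Section ComplexNorm.
Context {R : realType}.
Local Notation C := R[i].
Local Notation normc := Normc.normc.
Implicit Types (z w : C) (a b : R).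

Lemma normC_E z : `|z| = (normc z)%:C.
Proof. by rewrite normc_def; case: z. Qed.

Lemma lt_normC z a : (`|z| < a%:C) = (normc z < a).
Proof. by rewrite normC_E ltcR. Qed.

Lemma le_normC z a : (`|z| <= a%:C) = (normc z <= a).
Proof. by rewrite normC_E lecR. Qed.

Lemma normc_ge0 z : 0 <= normc z.
Proof. by case: z => x y; exact: sqrtr_ge0. Qed.

Lemma normcB z w : normc (z - w) = normc (w - z).
Proof. by rewrite -normcN opprB. Qed.

Lemma sqr_normc_ReIm z : normc z ^+ 2 = complex.Re z ^+ 2 + complex.Im z ^+ 2.
Proof. by case: z => x y /=; rewrite sqr_sqrtr// addr_ge0// sqr_ge0. Qed.

Lemma le_sqr_normr a b : 0 <= b -> a ^+ 2 <= b ^+ 2 -> `|a| <= b.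
Proof.
by move=> b0 ab; rewrite -(ger0_norm b0) -ler_sqr ?nnegrE// !real_normK// num_real.
Qed.

Lemma Re_le_normc z : `|complex.Re z| <= normc z.
Proof.
by apply: le_sqr_normr; rewrite ?normc_ge0// sqr_normc_ReIm lerDl sqr_ge0.
Qed.

Lemma Im_le_normc z : `|complex.Im z| <= normc z.
Proof.
by apply: le_sqr_normr; rewrite ?normc_ge0// sqr_normc_ReIm lerDr sqr_ge0.
Qed.

Lemma normc_le_ReIm z : normc z <= `|complex.Re z| + `|complex.Im z|.
Proof.
rewrite -ler_sqr ?nnegrE ?normc_ge0 ?addr_ge0// sqr_normc_ReIm.
rewrite sqrrD !real_normK ?num_real// lerD2r lerDl.
by rewrite mulrn_wge0// mulr_ge0.
Qed.

Lemma normc_real a : normc a%:C = `|a|.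
Proof. by rewrite /= expr0n/= addr0 sqrtr_sqr. Qed.

Lemma normc_conj z : normc (conjc z) = normc z.
Proof. by case: z => x y /=; rewrite sqrrN. Qed.

Lemma normcX z n : normc (z ^+ n) = normc z ^+ n.
Proof.
elim: n => [|n IH]; first by rewrite !expr0 normc1.
by rewrite !exprS normcM IH.
Qed.

Lemma normc_gt0 z : (0 < normc z) = (z != 0).
Proof.
rewrite lt_neqAle normc_ge0 andbT eq_sym; congr (~~ _).
by apply/eqP/eqP => [/eq0_normc|->]//; rewrite normc0.
Qed.

Lemma le_normc_sub z w : normc z - normc w <= normc (z - w).
Proof. by rewrite lerBlDr -{1}(subrK w z) le_normcD. Qed.

Lemma creD z w : complex.Re (z + w) = complex.Re z + complex.Re w.
Proof. by case: z; case: w. Qed.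
Lemma cimD z w : complex.Im (z + w) = complex.Im z + complex.Im w.
Proof. by case: z; case: w. Qed.
Lemma creN z : complex.Re (- z) = - complex.Re z.
Proof. by case: z. Qed.
Lemma cimN z : complex.Im (- z) = - complex.Im z.
Proof. by case: z. Qed.
Lemma creM z w : complex.Re (z * w) =
  complex.Re z * complex.Re w - complex.Im z * complex.Im w.
Proof. by case: z; case: w. Qed.
Lemma cimM z w : complex.Im (z * w) =
  complex.Re z * complex.Im w + complex.Im z * complex.Re w.
Proof. by case: z => ? ?; case: w. Qed.

Lemma ReIm_eq z w : complex.Re z = complex.Re w -> complex.Im z = complex.Im w ->
  z = w.
Proof. by case: z => ? ?; case: w => ? ? /= -> ->. Qed.

Lemma posC (e : C) : 0 < e -> exists2 a, 0 < a & e = a%:C.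
Proof.
case: e => a b; rewrite ltcE/= => /andP[/eqP ->] a0; by exists a.
Qed.

(** Complex differentiability phrased with the real-valued modulus, so that estimates take place in
    [R] and not in the partial order of [R[i]]. *)
Definition cdiff (F : C -> C) z : Prop := exists L : C, forall e : R, 0 < e ->
  exists2 d : R, 0 < d & forall w, normc w < d ->
    normc (F (z + w) - F z - L * w) <= e * normc w.

Lemma derivable_cdiff (F : C -> C) z :
  derivable (F : C^o -> C^o) z 1 -> cdiff F z.
Proof.
move=> /cvg_ex[L /cvgrPdist_le HL]; exists L => e e0.
have e0' : 0 < e%:C :> C by rewrite ltcR.
have /nbhs_ballP[d' /posC[d d0 ->] Hd] := HL _ e0'.
exists d => // w wd; have [->|w0] := eqVneq w 0.
  by rewrite !addr0 mulr0 subrr subr0 normc0 mulr0.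
have := Hd w; rewrite /ball/= sub0r normrN lt_normC => /(_ wd w0).
rewrite le_normC [_ *: 1]mulr1 [w + z]addrC => le1.
have nw : 0 < normc w by rewrite normc_gt0.
have -> : F (z + w) - F z - L * w = - w * (L - w^-1 * (F (z + w) - F z)).
  by rewrite mulrBr !mulNr mulrA divff// mul1r opprK addrC mulrC.
by rewrite normcM normcN mulrC ler_wpM2r// ltW.
Qed.

Lemma cdiff_continuous F z : cdiff F z -> forall e : R, 0 < e ->
  exists2 d : R, 0 < d & forall w, normc w < d -> normc (F (z + w) - F z) < e.
Proof.
move=> [L HL] e e0; have [d d0 Hd] := HL 1 ltr01.
have K0 : 0 < 1 + normc L by rewrite ltr_pwDl// normc_ge0.
exists (Num.min d (e / (1 + normc L))); first by rewrite lt_min d0 divr_gt0.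
move=> w; rewrite lt_min => /andP[wd we].
rewrite -(subrK (L * w) (F (z + w) - F z)).
apply: (le_lt_trans (le_normcD _ _)); apply: (le_lt_trans (lerD (Hd _ wd) (lexx _))).
by rewrite normcM -mulrDl mulrC -ltr_pdivlMr.
Qed.

Lemma cdiffM F G z : cdiff F z -> cdiff G z -> cdiff (fun w => F w * G w) z.
Proof.
move=> dF dG; have [L HL] := dF; have [M HM] := dG.
exists (L * G z + F z * M) => e e0.
(* [K] collects the factors of [e1 * normc w] in the three error terms of the product rule. *)
pose K := normc L + normc (F z) + normc (G z) + 1.
have K0 : 0 < K by rewrite ltr_pwDr// !addr_ge0// normc_ge0.
pose e1 := Num.min 1 (e / (4 * K)).
have e10 : 0 < e1 by rewrite lt_min ltr01 divr_gt0// mulr_gt0.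
have e11 : e1 <= 1 by rewrite ge_min lexx.
have e1K : e1 * K <= e / 4.
  have : e1 <= e / (4 * K) by rewrite ge_min lexx orbT.
  by rewrite invfM mulrA ler_pdivlMr.
have [d1 d10 H1] := HL _ e10; have [d2 d20 H2] := HM _ e10.
have [d3 d30 H3] := cdiff_continuous dG e10.
exists (Num.min d1 (Num.min d2 d3)); first by rewrite !lt_min d10 d20 d30.
move=> w; rewrite !lt_min => /andP[wd1 /andP[wd2 wd3]].
move: (H1 w wd1) (H2 w wd2) (H3 w wd3).
set A := F _ - _ - _; set B := G _ - _ - _; set D := G _ - _ => hA hB hD.
have -> : F (z + w) * G (z + w) - F z * G z - (L * G z + F z * M) * w =
  A * (D + G z) + L * w * D + F z * B.
  by rewrite /A /B /D; ring.
have w0 := normc_ge0 w.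
apply: (le_trans (le_normcD _ _)); apply: (le_trans (lerD (le_normcD _ _) (lexx _))).
rewrite !normcM.
have h1 : normc A * normc (D + G z) <= e1 * normc w * (1 + normc (G z)).
  apply: ler_pM; rewrite ?normc_ge0//.
  by apply: (le_trans (le_normcD _ _)); rewrite lerD2r (le_trans (ltW hD)).
have h2 : normc L * normc w * normc D <= normc L * normc w * e1.
  by rewrite ler_wpM2l ?mulr_ge0 ?normc_ge0// ltW.
have h3 : normc (F z) * normc B <= normc (F z) * (e1 * normc w).
  by rewrite ler_wpM2l ?normc_ge0.
apply: (le_trans (lerD (lerD h1 h2) h3)).
have -> : e1 * normc w * (1 + normc (G z)) + normc L * normc w * e1 +
  normc (F z) * (e1 * normc w) = e1 * K * normc w by rewrite /K; ring.
rewrite ler_wpM2r//; apply: (le_trans e1K); rewrite ler_pdivrMr// ler_peMr ?ltW//.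
by rewrite ltr1n.
Qed.

Lemma cdiff_cst k z : cdiff (fun=> k) z.
Proof.
exists 0 => e e0; exists 1 => // w _.
by rewrite /= mul0r subrr subr0 normc0 mulr_ge0 ?normc_ge0// ltW.
Qed.

Lemma cdiff_id z : cdiff id z.
Proof.
exists 1 => e e0; exists 1 => // w _.
by rewrite mul1r [z + w]addrC addrK subrr normc0 mulr_ge0 ?normc_ge0// ltW.
Qed.

Lemma cdiffX n z : cdiff (fun w => w ^+ n) z.
Proof.
elim: n => [|n IH]; first exact: cdiff_cst.
under [fun w : C => _]eq_fun => w do rewrite exprS.
by apply: cdiffM => //; exact: cdiff_id.
Qed.

Lemma cdiffV z : z != 0 -> cdiff (fun w => w^-1) z.
Proof.
move=> z0; have nz : 0 < normc z by rewrite normc_gt0.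
exists (- z^-1 ^+ 2) => e e0.
(* The first bound keeps [z + w] at distance at least [normc z / 2] from 0; the second makes the
   remaining quotient at most [e]. *)
exists (Num.min (normc z / 2) (e * normc z ^+ 3 / 2)).
  by rewrite lt_min !divr_gt0// mulr_gt0// exprn_gt0.
move=> w; rewrite lt_min => /andP[w1 w2].
have nzw : normc z / 2 <= normc (z + w).
  have := le_normc_sub z (- w); rewrite opprK normcN; apply: le_trans; lra.
have zw0 : z + w != 0 by rewrite -normc_gt0; apply: lt_le_trans nzw; rewrite divr_gt0.
have -> : (z + w)^-1 - z^-1 - - z^-1 ^+ 2 * w = w ^+ 2 * (z ^+ 2 * (z + w))^-1.
  by field; rewrite z0 zw0.
rewrite normcM normcV normcX expr2 -mulrA mulrC ler_wpM2r ?normc_ge0//.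
rewrite ler_pdivrMr; last by rewrite normc_gt0 mulf_neq0// expf_neq0.
rewrite normcM normcX; apply: (le_trans (ltW w2)).
rewrite -mulrA ler_pM2l// exprSr -mulrA ler_wpM2l// exprn_ge0// ltW//.
Qed.

Lemma cdiff_comp_scale F k z : cdiff F (k * z) -> cdiff (fun w => F (k * w)) z.
Proof.
move=> [L HL]; exists (L * k) => e e0.
have K0 : 0 < 1 + normc k by rewrite ltr_pwDl// normc_ge0.
have [d d0 Hd] := HL _ (divr_gt0 e0 K0).
exists (d / (1 + normc k)); first by rewrite divr_gt0.
move=> w wd; have := Hd (k * w); rewrite -mulrDr mulrA normcM.
have -> : normc k * normc w < d.
  move: wd; rewrite ltr_pdivlMr//; apply: le_lt_trans.
  by rewrite mulrC ler_wpM2l ?normc_ge0// lerDr.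
move=> /(_ isT) /le_trans; apply.
rewrite mulrA ler_wpM2r ?normc_ge0// mulrAC ler_pdivrMr// ler_wpM2l ?ltW//.
by rewrite ltrDr.
Qed.

Lemma cdiff_near F G z r : 0 < r -> (forall w, normc (w - z) < r -> F w = G w) ->
  cdiff F z -> cdiff G z.
Proof.
move=> r0 FG [L HL]; exists L => e e0; have [d d0 Hd] := HL _ e0.
exists (Num.min d r); first by rewrite lt_min d0.
move=> w; rewrite lt_min => /andP[wd wr].
rewrite -!FG; first exact: Hd.
- by rewrite subrr normc0.
- by rewrite addrAC subrr add0r.
Qed.

End ComplexNorm.

(** * Independence of circle integrals from the radius *)

Section CircleMean.
Context {R : realType}.
Local Notation C := R[i].
Local Notation normc := Normc.normc.
Implicit Types (z w : C) (a b t : R).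

Definition cis t : C := cos t +i* sin t.

Lemma normc_cis t : normc (cis t) = 1.
Proof. by rewrite /= cos2Dsin2 sqrtr1. Qed.

Lemma cis0 : cis 0 = 1.
Proof. by rewrite /cis cos0 sin0. Qed.

Lemma cisD a b : cis (a + b) = cis a * cis b.
Proof.
by apply: ReIm_eq; rewrite ?(creM, cimM)/= ?(cosD, sinD); ring.
Qed.

Lemma cis2pi : cis (2 * pi) = 1.
Proof. by rewrite /cis mulr_natl cos2pi sin2pi. Qed.

Lemma derive_small (f : R -> R) (l : R) : is_derive (0 : R) 1 f l ->
  forall e, 0 < e -> exists2 d, 0 < d & forall h, `|h| < d ->
    `|f h - f 0 - l * h| <= e * `|h|.
Proof.
move=> [/cvg_ex[l' cl'] fl] e e0.
have {}fl : l' = l by rewrite -fl; apply/esym/cvg_lim.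
move: cl'; rewrite {}fl => /cvgrPdist_le /(_ e e0) /nbhs_ballP[d d0 Hd].
exists d => // h hd; have [->|h0] := eqVneq h 0.
  by rewrite subrr mulr0 subrr normr0 mulr0.
have := Hd h; rewrite /ball/= sub0r normrN => /(_ hd h0).
rewrite [_ *: 1]mulr1 addr0 => le1.
have -> : f h - f 0 - l * h = - h * (l - h^-1 * (f h - f 0)).
  by rewrite mulrBr !mulNr mulrA divff// mul1r opprK addrC mulrC.
by rewrite normrM normrN mulrC ler_wpM2r.
Qed.

(** First-order expansion of the complex exponential at 0, assembled from the derivatives of [expR],
    [cos] and [sin] there. *)
Lemma exp_cis_small (e : R) : 0 < e -> exists2 d, 0 < d & forall h l, `|h| < d -> `|l| < d ->
  normc ((expR h)%:C * cis l - 1 - (h +i* l)) <= e * (`|h| + `|l|).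
Proof.
(* The 5 is 2 + 2 + 1: the factors of [e1 * |l|] in the bounds [F1], [F2] and [F3] below. *)
move=> e0; pose e1 := Num.min 1 (e / 5).
have e10 : 0 < e1 by rewrite lt_min ltr01 divr_gt0.
have e11 : e1 <= 1 by rewrite ge_min lexx.
have e1e : e1 <= e / 5 by rewrite ge_min lexx orbT.
have [d1 d10 H1] := derive_small (is_derive_expR 0) e10.
have [d2 d20 H2] := derive_small (is_derive_cos 0) e10.
have [d3 d30 H3] := derive_small (is_derive_sin 0) e10.
exists (Num.min (e1 / 2) (Num.min d1 (Num.min d2 d3))).
  by rewrite !lt_min d10 d20 d30 divr_gt0.
move=> h l; rewrite !lt_min => /andP[h1 /andP[h2 _]] /andP[l1 /and3P[_ l3 l4]].
have := H1 h h2; have := H2 l l3; have := H3 l l4.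
rewrite expR0 cos0 sin0 mul1r oppr0 mul0r mul1r !subr0 ?addr0 => hs hc he.
have l0 := normr_ge0 l; have h0 := normr_ge0 h.
have E1 : `|expR h - 1| <= e1.
  have -> : expR h - 1 = (expR h - 1 - h) + h by ring.
  apply: (le_trans (ler_normD _ _)).
  have : e1 * `|h| <= e1 * 2^-1 by rewrite ler_wpM2l// ltW; lra.
  lra.
have E2 : `|expR h| <= 2.
  have -> : expR h = (expR h - 1) + 1 by ring.
  by apply: (le_trans (ler_normD _ _)); rewrite normr1; lra.
apply: (le_trans (normc_le_ReIm _)).
have -> : complex.Re ((expR h)%:C * cis l - 1 - (h +i* l)) =
    (expR h - 1 - h) + expR h * (cos l - 1).
  by rewrite !(creD, creN, creM)/=; ring.
have -> : complex.Im ((expR h)%:C * cis l - 1 - (h +i* l)) =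
    expR h * (sin l - l) + (expR h - 1) * l.
  by rewrite !(cimD, cimN, cimM)/=; ring.
have F1 : `|expR h * (cos l - 1)| <= 2 * (e1 * `|l|).
  by rewrite normrM ler_pM.
have F2 : `|expR h * (sin l - l)| <= 2 * (e1 * `|l|).
  by rewrite normrM ler_pM.
have F3 : `|(expR h - 1) * l| <= e1 * `|l|.
  by rewrite normrM ler_wpM2r.
apply: (le_trans (lerD (ler_normD _ _) (ler_normD _ _))).
apply: (@le_trans _ _ (5 * (e1 * (`|h| + `|l|)))); last first.
  by rewrite mulrA ler_wpM2r ?addr_ge0//; lra.
have P0 : 0 <= e1 * `|h| by rewrite mulr_ge0// ltW.
lra.
Qed.

(* In the coordinates s + i t of the chart w |-> exp w a circle around 0 becomes a
   vertical segment. *)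
Lemma cdiff_log_coordinates (F : C -> C) (s t : R) :
  cdiff F ((expR s)%:C * cis t) -> exists L : C, forall e : R, 0 < e ->
  exists2 d, 0 < d & forall h l, `|h| < d -> `|l| < d ->
  normc (F ((expR (s + h))%:C * cis (t + l)) - F ((expR s)%:C * cis t)
    - L * (h +i* l)) <= e * (`|h| + `|l|).
Proof.
set z := _ * cis t => -[L HL]; exists (L * z) => e e0.
pose K := normc z + normc L * normc z + 1.
have nz := normc_ge0 z; have nL := normc_ge0 L.
have nLz : 0 <= normc L * normc z by rewrite mulr_ge0.
have K0 : 0 < K by rewrite /K; lra.
have e10 : 0 < e / (4 * K) by rewrite divr_gt0// mulr_gt0.
have [d1 d10 H1] := HL _ e10.
have e20 : 0 < Num.min 1 (e / (4 * K)) by rewrite lt_min ltr01.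
have [d2 d20 H2] := exp_cis_small e20.
exists (Num.min d2 (d1 / (4 * K))); first by rewrite lt_min d20 divr_gt0// mulr_gt0.
move=> h l; rewrite !lt_min => /andP[h1 h2] /andP[l1 l2].
pose m := `|h| + `|l|; have m0 : 0 <= m by rewrite addr_ge0.
have := H2 h l h1 l1; set eta := _ - 1 - _ => He.
have he1 : normc eta <= m.
  by apply: (le_trans He); rewrite -[leRHS]mul1r ler_wpM2r// ge_min lexx.
have he2 : normc eta <= e / (4 * K) * m.
  by apply: (le_trans He); rewrite ler_wpM2r// ge_min lexx orbT.
have hl : normc (h +i* l) <= m by exact: (normc_le_ReIm (h +i* l)).
pose w := z * ((h +i* l) + eta).
have zw : (expR (s + h))%:C * cis (t + l) = z + w.
  by rewrite /w /eta /z expRD cisD rmorphM; ring.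
have nw : normc w <= 2 * K * m.
  rewrite normcM; apply: (@le_trans _ _ (K * (2 * m))).
    apply: ler_pM => //; rewrite ?normc_ge0//; first by rewrite /K; lra.
    by apply: (le_trans (le_normcD _ _)); lra.
  by rewrite mulrCA mulrA.
have wd : normc w < d1.
  apply: (le_lt_trans nw); move: h2 l2; rewrite !ltr_pdivlMr ?mulr_gt0// /m; lra.
rewrite zw.
have -> : F (z + w) - F z - L * z * (h +i* l) =
  (F (z + w) - F z - L * w) + L * z * eta by rewrite /w; ring.
apply: (le_trans (le_normcD _ _)); rewrite [normc (_ * eta)]normcM [normc (L * z)]normcM.
have A1 : normc (F (z + w) - F z - L * w) <= e / (4 * K) * (2 * K * m).
  by apply: (le_trans (H1 w wd)); rewrite ler_wpM2l// ltW.
have A2 : normc L * normc z * normc eta <= K * (e / (4 * K) * m).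
  by apply: ler_pM => //; rewrite ?normc_ge0// /K; lra.
apply: (le_trans (lerD A1 A2)).
have -> : e / (4 * K) * (2 * K * m) + K * (e / (4 * K) * m) = (3 / 4 * e) * m.
  by field; rewrite gt_eqF.
by rewrite ler_wpM2r//; lra.
Qed.

(** The integral is not normalized: a constant [k] has circle integral [2 * pi * k]. *)
Definition circ_int (F : R -> C) : C :=
  itv_int 0 (2 * pi) (fun t => complex.Re (F t)) +i*
  itv_int 0 (2 * pi) (fun t => complex.Im (F t)).

Lemma Im_imul z : complex.Im ((0 +i* 1 : C) * z) = complex.Re z.
Proof. by case: z => a b /=; rewrite mul0r mul1r add0r. Qed.

Lemma cdiffZ (k : C) (F : C -> C) z : cdiff F z -> cdiff (fun w => k * F w) z.
Proof. by move=> dF; apply: cdiffM => //; exact: cdiff_cst. Qed.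

(** The form is the real part of G dw with w = s + i t and G the composite of [F] with the
    exponential. If G has derivative p + i q, the Cauchy-Riemann equations give both mixed partials
    the value - q. *)
Lemma cdiff_closed_form (F : C -> C) (s t : R) : cdiff F ((expR s)%:C * cis t) ->
  closed_form_at (fun s t => complex.Re (F ((expR s)%:C * cis t)))
    (fun s t => - complex.Im (F ((expR s)%:C * cis t))) s t.
Proof.
move=> /cdiff_log_coordinates[[p q] H].
exists p, (- p), (- q) => e e0; have [d d0 Hd] := H _ e0; exists d => // h l hd ld.
have := Hd h l hd ld; set A := F _; set B := F _ => le1; split.
- apply: le_trans le1; apply: le_trans (Re_le_normc _).
  by rewrite !(creD, creN, creM)/= mulNr.
- apply: le_trans le1; apply: le_trans (Im_le_normc _).
  rewrite -normrN !(cimD, cimN, cimM)/= le_eqVlt; apply/orP; left; apply/eqP.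
  by congr (`|_|); ring.
Qed.

Lemma itv_intN (a b : R) (f : R -> R) : cont_on a b f ->
  itv_int a b (fun x => - f x) = - itv_int a b f.
Proof.
move=> cf; rewrite -[RHS]add0r.
have -> : (fun x => - f x) = (fun x => 0 - f x) by apply/funext => x; rewrite sub0r.
rewrite itv_intB//; last exact: cont_on_cst.
by congr (_ - _); rewrite /itv_int Rintegral_cst//= mul0r.
Qed.

(** Goursat on [[ln r1, ln r2] x [0, 2 * pi]]: the horizontal sides cancel by periodicity, and the
    vertical sides are the two circle integrals up to sign. *)
Lemma circ_int_Im_const (F : C -> C) (rho r1 r2 : R) :
  (forall z, 0 < normc z < rho -> cdiff F z) -> 0 < r1 -> r1 <= r2 -> r2 < rho ->
  itv_int 0 (2 * pi) (fun t => complex.Im (F (r1%:C * cis t))) =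
  itv_int 0 (2 * pi) (fun t => complex.Im (F (r2%:C * cis t))).
Proof.
move=> dF r10 r12 r2rho.
have r20 : 0 < r2 by exact: lt_le_trans r12.
pose P s t := complex.Re (F ((expR s)%:C * cis t)).
pose Q s t := - complex.Im (F ((expR s)%:C * cis t)).
have cd : forall x, x <= ln r2 -> forall y, closed_form_at P Q x y.
  move=> x xr2 y; apply: cdiff_closed_form; apply: dF.
  rewrite normcM normc_cis mulr1 normc_real ger0_norm ?expR_ge0// expR_gt0/=.
  by apply: le_lt_trans r2rho; rewrite -[leRHS](lnK r20) ler_expR.
have pi0 : 0 <= 2 * pi :> R by rewrite mulr_ge0// pi_ge0.
have cl : closed_form_on P Q (ln r1) (ln r2) 0 (2 * pi).
  by move=> x y /andP[_ xr] _; exact: cd.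
have ln12 : ln r1 <= ln r2 by rewrite ler_ln.
have := closed_form_circulation0 ln12 pi0 cl.
rewrite /circulation.
have -> : itv_int (ln r1) (ln r2) (P^~ 0) = itv_int (ln r1) (ln r2) (P^~ (2 * pi)).
  by congr itv_int; apply/funext => s; rewrite /P cis0 cis2pi.
rewrite subrr add0r => /eqP; rewrite subr_eq0 => /eqP.
have E r : 0 < r -> r <= r2 -> itv_int 0 (2 * pi) (Q (ln r)) =
    - itv_int 0 (2 * pi) (fun t => complex.Im (F (r%:C * cis t))).
  move=> r0 rr2; rewrite -[RHS]itv_intN.
    by rewrite /Q lnK.
  have -> : (fun t => complex.Im (F (r%:C * cis t))) = (fun t => 0 - Q (ln r) t).
    by apply/funext => t; rewrite /Q lnK// sub0r opprK.
  apply: cont_onB; first exact: cont_on_cst.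
  by move=> t _; apply: (@closed_form_continuous2 _ P); apply: cd; rewrite ler_ln.
by rewrite !E// => /eqP; rewrite eqr_opp => /eqP.
Qed.

(** The real part of [F] is the imaginary part of i F. The centre is excluded from the domain so
    that [F] may have a pole there, as for the integrand of a Taylor coefficient. *)
Lemma circ_int_const (F : C -> C) (rho r1 r2 : R) :
  (forall z, 0 < normc z < rho -> cdiff F z) -> 0 < r1 < rho -> 0 < r2 < rho ->
  circ_int (fun t => F (r1%:C * cis t)) = circ_int (fun t => F (r2%:C * cis t)).
Proof.
wlog r12 : r1 r2 / r1 <= r2.
  move=> W dF h1 h2; have [r12|/ltW r21] := leP r1 r2; first exact: W.
  by apply/esym; exact: W.
move=> dF /andP[r10 _] /andP[_ r2rho]; apply: ReIm_eq => /=.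
  have E (r : R) : (fun t => complex.Re (F (r%:C * cis t))) =
      (fun t => complex.Im ((0 +i* 1 : C) * F (r%:C * cis t))).
    by apply/funext => t; rewrite -Im_imul.
  rewrite !E; apply: (@circ_int_Im_const (fun z => (0 +i* 1 : C) * F z) rho) => //.
  by move=> z hz; apply: cdiffZ; exact: dF.
exact: (@circ_int_Im_const _ rho).
Qed.

End CircleMean.

(** * Calculus of circle integrals and the mean value property *)

Section CircleIntegral.
Context {R : realType}.
Local Notation C := R[i].
Local Notation normc := Normc.normc.
Implicit Types (z w k : C) (a b t : R) (f g : R -> C) (F : C -> C).

Definition ccont f : Prop :=
  continuous (fun t => complex.Re (f t)) /\ continuous (fun t => complex.Im (f t)).

Lemma ccont_cst k : ccont (fun=> k).
Proof. by split=> t; exact: cst_continuous. Qed.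

Lemma ccontD f g : ccont f -> ccont g -> ccont (fun t => f t + g t).
Proof.
move=> [fr fi] [gr gi]; split=> t.
- under eq_fun do rewrite creD; apply: cvgD; [exact: fr|exact: gr].
- under eq_fun do rewrite cimD; apply: cvgD; [exact: fi|exact: gi].
Qed.

Lemma ccontM f g : ccont f -> ccont g -> ccont (fun t => f t * g t).
Proof.
move=> [fr fi] [gr gi]; split=> t.
- under eq_fun do rewrite creM.
  by apply: cvgB; apply: cvgM; [exact: fr|exact: gr|exact: fi|exact: gi].
- under eq_fun do rewrite cimM.
  by apply: cvgD; apply: cvgM; [exact: fr|exact: gi|exact: fi|exact: gr].
Qed.

Lemma ccont_conj f : ccont f -> ccont (fun t => conjc (f t)).
Proof.
move=> [fr fi]; split=> t.
- have -> : (fun t => complex.Re (conjc (f t))) = (fun t => complex.Re (f t)).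
    by apply/funext => x; case: (f x).
  exact: fr.
- have -> : (fun t => complex.Im (conjc (f t))) = (fun t => - complex.Im (f t)).
    by apply/funext => x; case: (f x).
  by apply: cvgN; exact: fi.
Qed.

Lemma ccontN f : ccont f -> ccont (fun t => - f t).
Proof.
move=> cf; under [fun t => - f t]eq_fun do rewrite -mulN1r.
by apply: ccontM => //; exact: ccont_cst.
Qed.

Lemma ccontX f n : ccont f -> ccont (fun t => f t ^+ n).
Proof.
move=> cf; elim: n => [|n IH]; first exact: ccont_cst.
by under [fun t => _]eq_fun do rewrite exprS; exact: ccontM.
Qed.

Lemma ccont_cis : ccont (@cis R).
Proof. by split=> t; [exact: continuous_cos|exact: continuous_sin]. Qed.

Lemma ccont_sum (I : Type) (s : seq I) (f : I -> R -> C) :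
  (forall i, ccont (f i)) -> ccont (fun t => \sum_(i <- s) f i t).
Proof.
move=> cf; elim: s => [|i s IH].
  by under [fun t => _]eq_fun do rewrite big_nil; exact: ccont_cst.
by under [fun t => _]eq_fun do rewrite big_cons; exact: ccontD.
Qed.

Definition ccont_at F z : Prop := forall e : R, 0 < e ->
  exists2 d : R, 0 < d & forall w, normc (w - z) < d -> normc (F w - F z) < e.

Lemma cdiff_ccont_at F z : cdiff F z -> ccont_at F z.
Proof.
move=> /cdiff_continuous H e /H[d d0 Hd]; exists d => // w /Hd.
by rewrite [z + _]addrC subrK.
Qed.

Lemma ccont_comp F f : ccont f -> (forall t, ccont_at F (f t)) ->
  ccont (fun t => F (f t)).
Proof.
move=> [fr fi] cF.
have H t e : 0 < e -> \forall s \near t, normc (F (f s) - F (f t)) < e.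
  move=> /(cF t)[d d0 Hd].
  have d20 : 0 < d / 2 by rewrite divr_gt0.
  have /cvgrPdist_lt/(_ _ d20) nr := fr t.
  have /cvgrPdist_lt/(_ _ d20) ni := fi t.
  near=> s; apply: Hd; apply: (le_lt_trans (normc_le_ReIm _)).
  rewrite (splitr d) !(creD, cimD, creN, cimN) ltrD//.
    by rewrite distrC; near: s.
  by rewrite distrC; near: s.
split=> t; apply/cvgrPdist_lt => e e0; have := H t e e0; apply: filterS => s.
  by rewrite normcB -creN -creD; apply: le_lt_trans; exact: Re_le_normc.
by rewrite normcB -cimN -cimD; apply: le_lt_trans; exact: Im_le_normc.
Unshelve. all: by end_near. Qed.

Let cont_on_cc (h : R -> R) a b : continuous h -> cont_on a b h.
Proof. by move=> ch x _; exact: ch. Qed.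

Lemma ccont_integrable f : ccont f ->
  (@lebesgue_measure R).-integrable `[0, 2 * pi] (EFin \o (fun t => complex.Re (f t))) /\
  (@lebesgue_measure R).-integrable `[0, 2 * pi] (EFin \o (fun t => complex.Im (f t))).
Proof. by move=> [fr fi]; split; apply: cont_on_integrable; apply: cont_on_cc. Qed.

Lemma circ_intD f g : ccont f -> ccont g ->
  circ_int (fun t => f t + g t) = circ_int f + circ_int g.
Proof.
move=> /ccont_integrable[fr fi] /ccont_integrable[gr gi]; rewrite /circ_int.
apply: ReIm_eq => /=; rewrite /itv_int -RintegralD//.
  by apply: eq_Rintegral => x _; rewrite creD.
by apply: eq_Rintegral => x _; rewrite cimD.
Qed.

Lemma circ_intZ k f : ccont f -> circ_int (fun t => k * f t) = k * circ_int f.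
Proof.
move=> cf; have [fr fi] := ccont_integrable cf.
have iZ (x : R) (h : R -> R) :
    (@lebesgue_measure R).-integrable `[0, 2 * pi] (EFin \o h) ->
    (@lebesgue_measure R).-integrable `[0, 2 * pi] (EFin \o (fun t => x * h t)).
  by move=> ih; apply: (integrableZl _ x ih).
apply: ReIm_eq => /=.
  rewrite creM/= /itv_int -!RintegralZl// -RintegralB; [|by []|exact: iZ..].
  by apply: eq_Rintegral => x _; rewrite creM.
rewrite cimM/= /itv_int -!RintegralZl// -RintegralD; [|by []|exact: iZ..].
by apply: eq_Rintegral => x _; rewrite cimM.
Qed.

Lemma circ_int_cst k : circ_int (fun=> k) = (2 * pi)%:C * k.
Proof.
have pi0 : 0 <= 2 * pi :> R by rewrite mulr_ge0// pi_ge0.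
by rewrite /circ_int !itv_int_cst//; apply: ReIm_eq; rewrite ?(creM, cimM)/=; ring.
Qed.

Lemma circ_intB f g : ccont f -> ccont g ->
  circ_int (fun t => f t - g t) = circ_int f - circ_int g.
Proof.
move=> cf cg; rewrite circ_intD//; last exact: ccontN.
rewrite -[in RHS]mulN1r -circ_intZ//; congr (_ + circ_int _).
by apply/funext => t; rewrite mulN1r.
Qed.

Lemma circ_int_sum (I : Type) (s : seq I) (f : I -> R -> C) :
  (forall i, ccont (f i)) ->
  circ_int (fun t => \sum_(i <- s) f i t) = \sum_(i <- s) circ_int (f i).
Proof.
move=> cf; elim: s => [|i s IH].
  rewrite big_nil -[RHS](mulr0 (2 * pi)%:C) -circ_int_cst.
  by congr circ_int; apply/funext => t; rewrite big_nil.
rewrite big_cons -IH -circ_intD//; last exact: ccont_sum.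
by congr circ_int; apply/funext => t; rewrite big_cons.
Qed.

Lemma circ_int_conj f : ccont f ->
  circ_int (fun t => conjc (f t)) = conjc (circ_int f).
Proof.
move=> [fr fi]; apply: ReIm_eq => /=.
  by apply: eq_Rintegral => x _; case: (f x).
rewrite -itv_intN; last exact: cont_on_cc.
by apply: eq_Rintegral => x _; case: (f x).
Qed.

(** The constant is twice the sharp one, because the real and the imaginary part are estimated
    separately. *)
Lemma circ_int_bound f (M : R) : ccont f ->
  (forall t, normc (f t) <= M) -> normc (circ_int f) <= 4 * pi * M.
Proof.
move=> [fr fi] fM; have pi0 : 0 <= 2 * pi :> R by rewrite mulr_ge0// pi_ge0.
apply: (le_trans (normc_le_ReIm _)) => /=.
have bnd h : continuous h -> (forall t, `|h t| <= M) ->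
    `|itv_int 0 (2 * pi) h| <= M * (2 * pi).
  move=> ch hM; have := @itv_int_near _ _ _ h 0 M pi0 (cont_on_cc ch).
  by rewrite mul0r !subr0; apply => x _; rewrite subr0.
have Ar := bnd _ fr (fun t => le_trans (Re_le_normc (f t)) (fM t)).
have Ai := bnd _ fi (fun t => le_trans (Im_le_normc (f t)) (fM t)).
apply: (le_trans (lerD Ar Ai)); lra.
Qed.

Lemma cis_conj t : cis t * conjc (cis t) = 1.
Proof.
by apply: ReIm_eq; rewrite ?(creM, cimM)/=; [rewrite mulrN opprK -!expr2 cos2Dsin2|ring].
Qed.

Lemma cis_neq0 t : cis t != 0.
Proof. by rewrite -normc_gt0 normc_cis ltr01. Qed.

Lemma cisV t : (cis t)^-1 = conjc (cis t).
Proof. by rewrite -[RHS]mul1r -(mulVf (cis_neq0 t)) -mulrA cis_conj mulr1. Qed.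

(** Since the radius does not matter, the circle may shrink to the centre, where continuity replaces
    [F] by [F 0] up to any error. *)
Lemma circ_int_mean_real F (rho r : R) :
  (forall z, normc z < rho -> cdiff F z) -> 0 < r < rho ->
  circ_int (fun t => F (r%:C * cis t)) = (2 * pi)%:C * F 0.
Proof.
move=> dF /andP[r0 rrho].
have rho0 : 0 < rho by exact: lt_trans rrho.
have cont s : 0 < s < rho -> ccont (fun t => F (s%:C * cis t)).
  move=> /andP[s0 sr]; apply: ccont_comp.
    by apply: ccontM; [exact: ccont_cst|exact: ccont_cis].
  move=> t; apply/cdiff_ccont_at/dF.
  by rewrite normcM normc_cis mulr1 normc_real gtr0_norm.
apply/eqP; rewrite -subr_eq0; apply/eqP/eq0_normc.
apply/eqP; rewrite eq_le normc_ge0 andbT.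
apply/ler_addgt0Pr => e e0; rewrite add0r.
have pi0 : 0 < 4 * pi :> R by rewrite mulr_gt0// pi_gt0.
have d0r : normc (0 : C) < rho by rewrite normc0.
have [d d0 Hd] := cdiff_ccont_at (dF 0 d0r) (divr_gt0 e0 pi0).
pose s := Num.min (d / 2) (rho / 2).
have s0 : 0 < s by rewrite lt_min !divr_gt0.
have sd : s < d by rewrite gt_min ltr_pdivrMr// ltr_pMr// ltr1n.
have srho : s < rho by rewrite gt_min orbC ltr_pdivrMr// ltr_pMr// ltr1n.
rewrite (@circ_int_const _ F rho r s); last 3 first.
- by move=> z /andP[_ zr]; exact: dF.
- by rewrite r0.
- by rewrite s0.
rewrite -circ_int_cst -circ_intB; [|by apply: cont; rewrite s0|exact: ccont_cst].
apply: (@le_trans _ _ (4 * pi * (e / (4 * pi)))).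
  apply: circ_int_bound.
    by apply: ccontD; [apply: cont; rewrite s0|apply: ccontN; exact: ccont_cst].
  move=> t; apply/ltW/Hd.
  by rewrite subr0 normcM normc_cis mulr1 normc_real gtr0_norm.
by rewrite mulrC divfK// gt_eqF.
Qed.

Definition disc_diff F : Prop := forall z, normc z < 1 -> cdiff F z.

Lemma disc_diff_scale F z (rho : R) : disc_diff F -> normc z * rho <= 1 -> 0 < rho ->
  forall w, normc w < rho -> cdiff (fun w => F (z * w)) w.
Proof.
move=> dF zr r0 w wr; apply: cdiff_comp_scale; apply: dF; rewrite normcM.
have [->|z0] := eqVneq z 0; first by rewrite normc0 mul0r.
by apply: lt_le_trans zr; rewrite ltr_pM2l// normc_gt0.
Qed.

(** Room beyond the unit circle: [w |-> F (z * w)] is differentiable on a disc of radius [rho > 1],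
    so circles of radius 1 are allowed. *)
Lemma disc_radius z : normc z < 1 -> exists2 rho : R, 1 < rho & normc z * rho <= 1.
Proof.
move=> z1; have z0 := normc_ge0 z; exists (2 / (1 + normc z)).
  by rewrite ltr_pdivlMr; lra.
by rewrite mulrA ler_pdivrMr; lra.
Qed.

(* For j > 0 the integrand is a holomorphic function
   vanishing at 0. *)
Lemma circ_int_mean F j z : disc_diff F -> normc z < 1 ->
  circ_int (fun t => cis t ^+ j * F (z * cis t)) =
  if j is 0%N then (2 * pi)%:C * F 0 else 0.
Proof.
move=> dF /disc_radius[rho rho1 zrho].
have rho0 : 0 < rho by exact: lt_trans rho1.
have := @circ_int_mean_real (fun w => w ^+ j * F (z * w)) rho 1.
have -> : (fun t => (1%:C * cis t) ^+ j * F (z * (1%:C * cis t))) =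
  (fun t => cis t ^+ j * F (z * cis t)).
  by apply/funext => t; rewrite mul1r.
rewrite ltr01 rho1 mulr0 => -> //.
  by case: j => [|j]; rewrite ?expr0 ?mul1r// exprS !mul0r mulr0.
move=> w wr; apply: cdiffM; first exact: cdiffX.
exact: disc_diff_scale wr.
Qed.

Lemma ccont_disc F z : disc_diff F -> normc z < 1 -> ccont (fun t => F (z * cis t)).
Proof.
move=> dF z1; apply: ccont_comp.
  by apply: ccontM; [exact: ccont_cst|exact: ccont_cis].
by move=> t; apply/cdiff_ccont_at/dF; rewrite normcM normc_cis mulr1.
Qed.

End CircleIntegral.

(** * Rotation invariance of plane Lebesgue measure *)

Section PlaneMeasure.
Context {R : realType}.
Local Notation mu := (@lebesgue_measure R).
Local Notation T := (measurableTypeR R).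


Lemma shift_measurable (c : R) : measurable_fun [set: T] (fun x : T => x + c : T).
Proof. by apply: measurable_funD => //; exact: measurable_cst. Qed.

Lemma lebesgue_measure_shift (c : R) (A : set T) : measurable A ->
  pushforward mu (fun x : T => x + c : T) A = mu A.
Proof.
move=> mA; apply/esym/lebesgue_measure_unique => //=.
  exact: shift_measurable.
move=> mm.
move=> _ [[a b]] _ <-.
have -> : pushforward mu (fun x : T => x + c : T) `]a, b] = mu `]a - c, b - c].
  congr (mu _); apply/seteqP; split => x /=; rewrite !in_itv/=;
  by rewrite ltrBlDr lerBrDr.
by rewrite !lebesgue_measure_itv/= !lte_fin ltrD2r -!EFinB; congr (if _ then _%:E else _); ring.
Qed.

Local Notation mu2 := (mu \x mu)%E.

Lemma mu2_xsection (A : set (T * T)) : mu2 A = (\int[mu]_x mu (xsection A x))%E.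
Proof. by []. Qed.

(** The product measure is computed through x-sections; its uniqueness identifies it with the one
    computed through y-sections. *)
Lemma mu2_ysection (A : set (T * T)) : measurable A ->
  mu2 A = (\int[mu]_y mu (ysection A y))%E.
Proof.
move=> mA; transitivity ((mu \x^ mu)%E A); last by [].
apply: product_measure_unique => // B C mB mC.
by rewrite /= product_measure2E.
Qed.

Definition preserves_mu2 (phi : T * T -> T * T) : Prop :=
  measurable_fun [set: T * T] phi /\
  forall A, measurable A -> pushforward mu2 phi A = mu2 A.

Lemma preserves_mu2_comp phi psi : preserves_mu2 phi -> preserves_mu2 psi ->
  preserves_mu2 (phi \o psi).
Proof.
move=> [mphi pphi] [mpsi ppsi]; split; first exact: measurableT_comp.
move=> A mA; rewrite -pphi// /pushforward comp_preimage -[RHS]ppsi//.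
by rewrite -[X in measurable X]setTI; exact: mphi.
Qed.

(** On each vertical section the shear is a translation. *)
Lemma yshear_preserves (t : R) : preserves_mu2 (fun p => (p.1, p.2 + t * p.1)).
Proof.
have m : measurable_fun [set: T * T] (fun p : T * T => (p.1, p.2 + t * p.1) : T * T).
  apply: measurable_fun_pair => //=.
  apply: measurable_funD => //.
  exact: measurable_funM.
split=> // A mA; rewrite /pushforward !mu2_xsection.
apply: eq_integral => x _.
rewrite -(@lebesgue_measure_shift (t * x) (xsection A x)); last exact: measurable_xsection.
by congr (mu _); apply/seteqP; split => y; rewrite /xsection/= !inE.
Qed.

Lemma xshear_preserves (t : R) : preserves_mu2 (fun p => (p.1 + t * p.2, p.2)).
Proof.
have m : measurable_fun [set: T * T] (fun p : T * T => (p.1 + t * p.2, p.2) : T * T).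
  apply: measurable_fun_pair => //=.
  apply: measurable_funD => //.
  exact: measurable_funM.
split=> // A mA; rewrite /pushforward !mu2_ysection//; last first.
  by rewrite -[X in measurable X]setTI; exact: m.
apply: eq_integral => y _.
rewrite -(@lebesgue_measure_shift (t * y) (ysection A y)); last exact: measurable_ysection.
by congr (mu _); apply/seteqP; split => x; rewrite /ysection/= !inE.
Qed.

Lemma conj_preserves : preserves_mu2 (fun p => (p.1, - p.2)).
Proof.
have m : measurable_fun [set: T * T] (fun p : T * T => (p.1, - p.2) : T * T).
  apply: measurable_fun_pair => //=.
  exact: measurable_funN.
split=> // A mA; rewrite /pushforward !mu2_xsection.
apply: eq_integral => x _.
rewrite -(@lebesgue_measureN _ (xsection A x)); last exact: measurable_xsection.
by congr (mu _); apply/seteqP; split => y; rewrite /xsection/= !inE.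
Qed.

(* A rotation with s <> 0 is a product of three shears. *)
Lemma rotation_preserves (c s : R) : c ^+ 2 + s ^+ 2 = 1 ->
  preserves_mu2 (fun p => (c * p.1 - s * p.2, s * p.1 + c * p.2)).
Proof.
have gen (u v : R) : v != 0 -> u ^+ 2 + v ^+ 2 = 1 ->
    preserves_mu2 (fun p => (u * p.1 - v * p.2, v * p.1 + u * p.2)).
  move=> v0 uv; have -> : (fun p : T * T => (u * p.1 - v * p.2, v * p.1 + u * p.2)) =
      (fun p : T * T => (p.1 + (u - 1) / v * p.2, p.2)) \o
      ((fun p : T * T => (p.1, p.2 + v * p.1)) \o
       (fun p : T * T => (p.1 + (u - 1) / v * p.2, p.2))).
    apply/funext => -[x y] /=; set k := (u - 1) / v.
    have uE : u = 1 + k * v by rewrite divfK// addrC subrK.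
    have kE : v + k * (2 + k * v) = 0.
      by apply: (mulIf v0); rewrite mul0r -(subrr 1) -{2}uv uE; ring.
    congr pair; last by rewrite {1}uE; ring.
    apply/eqP; rewrite -subr_eq0; apply/eqP.
    by transitivity (- y * (v + k * (2 + k * v))); [rewrite {1}uE; ring|rewrite kE mulr0].
  by apply: preserves_mu2_comp; [|apply: preserves_mu2_comp];
    [exact: xshear_preserves|exact: yshear_preserves|exact: xshear_preserves].
have [->|s0] := eqVneq s 0; last exact: gen.
rewrite expr0n addr0 => /eqP; rewrite sqrf_eq1 => /orP[]/eqP ->.
  have := preserves_mu2_comp (xshear_preserves 0) (xshear_preserves 0).
  congr preserves_mu2; apply/funext => -[x y] /=.
  by rewrite !mul0r !addr0 subr0 !mul1r add0r.
(* The half turn has [s = 0], out of reach of the shears; it is the square of the quarter turn. *)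
have := preserves_mu2_comp (gen 0 1 (oner_neq0 _) _) (gen 0 1 (oner_neq0 _) _).
rewrite expr0n expr1n add0r => /(_ erefl erefl).
congr preserves_mu2; apply/funext => -[x y] /=.
by congr pair; ring.
Qed.

End PlaneMeasure.

(** * Taylor coefficients *)

Section Taylor.
Context {R : realType}.
Local Notation C := R[i].
Local Notation normc := Normc.normc.
Local Notation mu := (@lebesgue_measure R).
Local Notation T := (measurableTypeR R).
Implicit Types (z w : C) (a b t : R) (f g : R -> C) (F : C -> C).

Lemma itv_int_shift (h : R -> R) a b (c : R) : continuous h ->
  itv_int a b (fun t => h (t + c)) = itv_int (a + c) (b + c) h.
Proof.
move=> ch; rewrite /itv_int /Rintegral; congr fine.
have mh : measurable_fun [set: R] (EFin \o h).
  by apply/measurable_EFinP; exact: continuous_measurable_fun.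
have pre : (fun x : T => x + c : T) @^-1` `[a + c, b + c] = `[a, b]%classic.
  by apply/seteqP; split=> x /=; rewrite !in_itv/= !lerD2r.
have ms := @shift_measurable R c.
pose D : set T := `[a + c, b + c]%classic.
have mD : measurable D by exact: measurable_itv.
have int : mu.-integrable ((fun x : T => x + c : T) @^-1` D)
    ((EFin \o h) \o (fun x : T => x + c : T)); last first.
  have := integral_pushforward ms mh int mD; rewrite pre => <- //.
  apply: eq_measure_integral => //=.
  by move=> A mA _; exact: lebesgue_measure_shift.
rewrite pre.
apply: (@cont_on_integrable _ a b (h \o (fun x => x + c))) => x _.
apply: continuous_comp; last exact: ch.
by apply: cvgD; [exact: cvg_id|exact: cvg_cst].
Qed.

Lemma itv_int_period (h : R -> R) (l c : R) : 0 <= l -> continuous h ->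
  (forall t, h (t + l) = h t) -> itv_int 0 l (fun t => h (t + c)) = itv_int 0 l h.
Proof.
move=> l0; wlog c0 : h c / 0 <= c.
  move=> main ch hl; have [c0|c0] := leP 0 c; first exact: main.
  have := main (fun t => h (t + c)) (- c); rewrite oppr_ge0 (ltW c0) => <- //.
  - by congr itv_int; apply/funext => t; rewrite subrK.
  - move=> t; apply: continuous_comp; last exact: ch.
    by apply: cvgD; [exact: cvg_id|exact: cvg_cst].
  - by move=> t; rewrite addrAC hl.
move=> ch hl; rewrite itv_int_shift// add0r.
have cont a b : cont_on a b h by move=> x _; exact: ch.
have E1 : itv_int 0 (l + c) h = itv_int 0 l h + itv_int l (l + c) h.
  by apply: itv_int_split => //; rewrite l0 lerDl.
have E2 : itv_int 0 (l + c) h = itv_int 0 c h + itv_int c (l + c) h.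
  by apply: itv_int_split => //; rewrite c0 lerDr.
have E3 : itv_int l (l + c) h = itv_int 0 c h.
  have := itv_int_shift 0 c l ch; rewrite add0r [c + l]addrC => <-.
  by congr itv_int; apply/funext => t; rewrite hl.
by move: E1; rewrite E2 E3 addrC => /addIr.
Qed.

Lemma circ_int_rot f (c : R) : ccont f -> (forall t, f (t + 2 * pi) = f t) ->
  circ_int (fun t => f (t + c)) = circ_int f.
Proof.
have pi0 : 0 <= 2 * pi :> R by rewrite mulr_ge0// pi_ge0.
move=> [fr fi] fp; rewrite /circ_int; congr Complex.
  by apply: (itv_int_period c pi0 fr) => t; rewrite fp.
by apply: (itv_int_period c pi0 fi) => t; rewrite fp.
Qed.

Lemma cis_period t : cis (t + 2 * pi) = cis t.
Proof. by rewrite cisD cis2pi mulr1. Qed.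

Lemma polar z : exists b, z = (normc z)%:C * cis b.
Proof.
have [->|z0] := eqVneq z 0; first by exists 0; rewrite normc0 mul0r.
have nz : 0 < normc z by rewrite normc_gt0.
pose x := complex.Re z / normc z; pose y := complex.Im z / normc z.
have xy : x ^+ 2 + y ^+ 2 = 1.
  by rewrite !expr_div_n -mulrDl -sqr_normc_ReIm divff// expf_neq0// gt_eqF.
have x1 : -1 <= x <= 1.
  by rewrite -ler_norml le_sqr_normr// expr1n -xy lerDl sqr_ge0.
suff [b [cb sb]] : exists b, cos b = x /\ sin b = y.
  exists b; apply: ReIm_eq; rewrite ?(creM, cimM)/= cb sb /x /y; field; by rewrite gt_eqF.
have xitv : x \in `[-1, 1] by rewrite in_itv.
have sx : sin (acos x) = `|y|.
  by rewrite sin_acos// -xy addrC addKr sqrtr_sqr.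
have [y0|y0] := leP 0 y.
  by exists (acos x); rewrite acosK// sx ger0_norm.
by exists (- acos x); rewrite cosN sinN acosK// sx ltr0_norm// opprK.
Qed.

(** For a power series [F] with coefficients c_k this is 2 pi c_k z^k. *)
Definition taylor_int F k z : C :=
  circ_int (fun t => conjc (cis t) ^+ k * F (z * cis t)).

(** [H] is differentiable on a punctured disc of radius [(normc z)^-1], so its integrals over the
    circles of radius [r] and 1 agree; the powers of [r] come from its denominator. *)
Lemma taylor_int_homog F k z (r : R) : disc_diff F -> 0 < r -> normc z < 1 ->
  r * normc z < 1 -> z != 0 ->
  taylor_int F k (r%:C * z) = r%:C ^+ k * taylor_int F k z.
Proof.
move=> dF r0 z1 rz1 z0; have nz : 0 < normc z by rewrite normc_gt0.
pose H w := (w ^+ k)^-1 * F (z * w).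
have := @circ_int_const _ H (normc z)^-1 r 1.
have r1 : 0 < r < (normc z)^-1 by rewrite r0/= -[_^-1]mul1r ltr_pdivlMr.
have o1 : 0 < (1 : R) < (normc z)^-1 by apply/andP; split=> //; rewrite invf_gt1.
move=> /(_ _ r1 o1) E.
have rk0 : r%:C ^+ k != 0 :> C.
  by rewrite expf_neq0// -normc_gt0 normc_real normr_gt0 gt_eqF.
have E1 : (fun t => H (r%:C * cis t)) = (fun t => (r%:C ^+ k)^-1 *
    (conjc (cis t) ^+ k * F (r%:C * z * cis t))).
  apply/funext => t; rewrite /H exprMn invfM -[(cis t ^+ k)^-1]exprVn cisV.
  have -> : z * (r%:C * cis t) = r%:C * z * cis t by ring.
  by rewrite mulrA.
have E2 : (fun t => H (1%:C * cis t)) = (fun t => conjc (cis t) ^+ k * F (z * cis t)).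
  by apply/funext => t; rewrite /H mul1r -exprVn cisV.
move: E; rewrite E1 E2 circ_intZ; last first.
  apply: ccontM; first exact/ccontX/ccont_conj/ccont_cis.
  apply: ccont_disc => //.
  by rewrite normcM normc_real gtr0_norm.
rewrite -/(taylor_int F k (r%:C * z)) -/(taylor_int F k z) => <-.
  by rewrite mulrA divff// mul1r.
move=> w /andP[w0 wz]; apply: cdiffM; last first.
  apply: (@disc_diff_scale _ F z (normc z)^-1) => //; last by rewrite invr_gt0.
  by rewrite divff// gt_eqF.
have w0' : w != 0 by rewrite -normc_gt0.
have -> : (fun w : C => (w ^+ k)^-1) = (fun w : C => (w^-1) ^+ k).
  by apply/funext => v; rewrite exprVn.
elim: (k) => [|m IH]; first exact: cdiff_cst.
have -> : (fun w : C => (w^-1) ^+ m.+1) = (fun w : C => w^-1 * (w^-1) ^+ m).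
  by apply/funext => v; rewrite exprS.
by apply: cdiffM => //; exact: cdiffV.
Qed.

(** The shift of [t] by [c] preserves the integral of a periodic function, and the power of
    [conjc (cis c)] that it produces cancels against [cis c ^+ k]. *)
Lemma taylor_int_rot F k z (c : R) : disc_diff F -> normc z < 1 ->
  taylor_int F k (z * cis c) = cis c ^+ k * taylor_int F k z.
Proof.
move=> dF z1; rewrite /taylor_int -circ_intZ; last first.
  apply: ccontM; first exact/ccontX/ccont_conj/ccont_cis.
  exact: ccont_disc.
pose f t := cis c ^+ k * (conjc (cis t) ^+ k * F (z * cis t)).
rewrite -[RHS](@circ_int_rot f c); last first.
- by move=> t; rewrite /f cis_period.
- apply: ccontM; first exact: ccont_cst.
  apply: ccontM; first exact/ccontX/ccont_conj/ccont_cis.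
  exact: ccont_disc.
congr circ_int; apply/funext => t; rewrite /f cisD rmorphM exprMn.
have -> : z * cis c * cis t = z * (cis t * cis c) by ring.
set u := F _; transitivity ((cis c * conjc (cis c)) ^+ k * (conjc (cis t) ^+ k * u)).
  by rewrite cis_conj expr1n mul1r.
by rewrite exprMn; ring.
Qed.

Lemma circ_int_cis_pow k : (0 < k)%N -> circ_int (fun t => cis t ^+ k) = 0 :> C.
Proof.
move=> k0; have := @circ_int_mean R (fun=> 1) k 0.
rewrite normc0 ltr01; case: k k0 => // k _ <- //.
- by congr circ_int; apply/funext => t; rewrite mulr1.
- by move=> z _; exact: cdiff_cst.
Qed.

(** A nonzero [z] is a rotated positive multiple of 1/2, so the behaviour under scalings and
    rotations determines the integral from its value at that single point. *)
Lemma taylor_coef F k : disc_diff F ->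
  exists c : C, forall z, normc z < 1 -> taylor_int F k z = c * z ^+ k.
Proof.
move=> dF; have [->|k0] := posnP k.
  exists ((2 * pi)%:C * F 0) => z z1.
  by have := circ_int_mean 0 dF z1; rewrite expr0 mulr1.
pose h : R := 2^-1.
have h0 : 0 < h by rewrite invr_gt0.
have nh : normc h%:C = h by rewrite normc_real gtr0_norm.
have h1 : normc h%:C < 1 by rewrite nh invf_lt1// ltr1n.
exists (taylor_int F k h%:C / h%:C ^+ k) => z z1.
(* Scaling cannot reach 0; there the integrand is [F 0] times the conjugate of a positive power of
   [cis t], with integral 0. *)
have [->|z0] := eqVneq z 0.
  rewrite expr0n gtn_eqF// mulr0 /taylor_int.
  have -> : (fun t => conjc (cis t) ^+ k * F (0 * cis t)) =
      (fun t => F 0 * conjc (cis t ^+ k)).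
    by apply/funext => t; rewrite mul0r rmorphXn mulrC.
  rewrite circ_intZ; last exact/ccont_conj/ccontX/ccont_cis.
  by rewrite circ_int_conj ?circ_int_cis_pow ?conjc0 ?mulr0//; exact/ccontX/ccont_cis.
have nz : 0 < normc z by rewrite normc_gt0.
have [b zb] := polar z.
have hn0 : h%:C != 0 :> C by rewrite -normc_gt0 nh.
have nzh : (normc z)%:C = (normc z / h)%:C * h%:C :> C.
  by rewrite -rmorphM/= divfK// gt_eqF.
rewrite {1}zb taylor_int_rot//; last by rewrite normc_real gtr0_norm.
rewrite nzh taylor_int_homog//; last first.
- by rewrite nh divfK// gt_eqF.
- by rewrite divr_gt0.
rewrite {2}zb nzh !exprMn.
by field; rewrite expf_neq0.
Qed.
End Taylor.

Arguments cis : simpl never.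

(** * Fourier coefficients on circles and uniqueness *)

Section FourierUniqueness.
Context {R : realType}.
Local Notation C := R[i].

Lemma creZ (a : R) (z : C) : complex.Re (a%:C * z) = a * complex.Re z.
Proof. by case: z => x y /=; rewrite mul0r subr0. Qed.
Lemma cimZ (a : R) (z : C) : complex.Im (a%:C * z) = a * complex.Im z.
Proof. by case: z => x y /=; rewrite mul0r addr0. Qed.
Lemma conjcM (x y : C) : conjc (x * y) = conjc x * conjc y.
Proof. exact: rmorphM. Qed.
Lemma conjcD (x y : C) : conjc (x + y) = conjc x + conjc y.
Proof. exact: rmorphD. Qed.
Lemma conjcB (x y : C) : conjc (x - y) = conjc x - conjc y.
Proof. exact: rmorphB. Qed.
Lemma conjcX (x : C) n : conjc (x ^+ n) = conjc x ^+ n.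
Proof. exact: rmorphXn. Qed.
Lemma conjcV (x : C) : conjc x^-1 = (conjc x)^-1.
Proof. exact: conjc_inv. Qed.

Local Notation normc := Normc.normc.
Implicit Types (z w : C) (t : R) (f g p : R -> C) (F : C -> C).

Lemma circ_int_orth k l :
  circ_int (fun t => cis t ^+ k * conjc (cis t) ^+ l) =
  (if k == l then (2 * pi)%:C else 0) :> C.
Proof.
have E t m n : (cis t : C) ^+ (m + n) * conjc (cis t) ^+ n = cis t ^+ m.
  by rewrite exprD -mulrA -exprMn cis_conj expr1n mulr1.
have [->|kl] := eqVneq k l.
  have -> : (fun t => cis t ^+ l * conjc (cis t) ^+ l) = (fun=> 1 : C).
    by apply/funext => t; rewrite -exprMn cis_conj expr1n.
  by rewrite circ_int_cst mulr1.
have [ltkl|ltlk|eqkl] := ltngtP k l; last by rewrite eqkl eqxx in kl.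
- have -> : (fun t => cis t ^+ k * conjc (cis t) ^+ l) =
      (fun t => conjc ((cis t : C) ^+ (l - k))).
    apply/funext => t; rewrite -(E t (l - k)%N k) subnK ?(ltnW ltkl)//.
    by rewrite conjcM !conjcX conjcK mulrC.
  rewrite circ_int_conj ?circ_int_cis_pow ?subn_gt0 ?conjc0//.
  exact/ccontX/ccont_cis.
- have -> : (fun t => cis t ^+ k * conjc (cis t) ^+ l) = (fun t => (cis t : C) ^+ (k - l)).
    by apply/funext => t; rewrite -(E t (k - l)%N l) subnK ?(ltnW ltlk).
  by rewrite circ_int_cis_pow// subn_gt0.
Qed.

(* Bessel's inequality for a function whose Fourier coefficients of positive
   index are all equal. *)
Lemma circ_int_bessel p (m : C) : ccont p ->
  (forall k, circ_int (fun t => cis t ^+ k * p t) = m) -> m = 0.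
Proof.
move=> cp pm; pose pi2 : R := 2 * pi.
have pi20 : 0 < pi2 by rewrite mulr_gt0// pi_gt0.
have cis_c k : ccont (fun t => (cis t : C) ^+ k) by exact/ccontX/ccont_cis.
have cpp : ccont (fun t => p t * conjc (p t)) by apply: ccontM => //; exact: ccont_conj.
pose A := circ_int (fun t => p t * conjc (p t)).
have main N : N%:R * normc m ^+ 2 / pi2 <= complex.Re A.
  pose S t : C := \sum_(k <- iota 0 N) cis t ^+ k.
  have cS : ccont S by exact: ccont_sum.
  have cSc : ccont (fun t => conjc (S t)) by exact: ccont_conj.
  have pS : circ_int (fun t => p t * S t) = N%:R * m.
    have -> : (fun t => p t * S t) = (fun t => \sum_(k <- iota 0 N) cis t ^+ k * p t).
      by apply/funext => t; rewrite /S mulrC mulr_suml.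
    rewrite circ_int_sum; last by move=> k; exact: ccontM.
    rewrite (eq_bigr (fun=> m)); last by move=> k _; exact: pm.
    by rewrite big_const_seq count_predT size_iota iter_addr addr0 mulr_natl.
  have SS : circ_int (fun t => S t * conjc (S t)) = N%:R * pi2%:C.
    have -> : (fun t => S t * conjc (S t)) = (fun t => \sum_(k <- iota 0 N)
        \sum_(l <- iota 0 N) (cis t ^+ k * conjc (cis t) ^+ l)).
      apply/funext => t; rewrite /S mulr_suml; apply: eq_bigr => k _.
      by rewrite rmorph_sum/= mulr_sumr; apply: eq_bigr => l _; rewrite conjcX.
    have cc k l : ccont (fun t => (cis t : C) ^+ k * conjc (cis t) ^+ l).
      by apply: ccontM => //; exact/ccontX/ccont_conj/ccont_cis.
    rewrite circ_int_sum; last by move=> k; exact: ccont_sum.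
    rewrite -[in RHS](size_iota 0 N) mulr_natl -iter_addr_0 -count_predT -big_const_seq.
    apply: eq_big_seq => k kN; rewrite circ_int_sum//.
    under eq_bigr do rewrite circ_int_orth.
    rewrite (bigD1_seq k)//= ?iota_uniq// eqxx big1 ?addr0// => l.
    by rewrite eq_sym => /negbTE ->.
  pose c : C := m / pi2%:C.
  (* [q] is [p] minus its projection on the span of the [conjc (cis t) ^+ k] with [k < N]; its
     squared norm being nonnegative is the inequality. *)
  pose q t := p t - c * conjc (S t).
  have cq : ccont q by apply: ccontD => //; apply: ccontN; apply: ccontM => //; exact: ccont_cst.
  have Q0 : 0 <= complex.Re (circ_int (fun t => q t * conjc (q t))).
    apply: Rintegral_ge0 => t _; case: (q t) => x y /=.
    by rewrite mulrN opprK addr_ge0// -expr2 sqr_ge0.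
  have -> : normc m ^+ 2 = complex.Re (m * conjc m).
    by case: (m) => x y; rewrite sqr_normc_ReIm/= mulrN opprK !expr2.
  suff E : circ_int (fun t => q t * conjc (q t)) =
      A - (N%:R / pi2)%:C * (m * conjc m).
    move: Q0; rewrite E creD creN creZ subr_ge0.
    by rewrite mulrAC.
  have -> : (fun t => q t * conjc (q t)) = (fun t =>
      (p t * conjc (p t) + c * conjc c * (S t * conjc (S t))) -
      (conjc c * (p t * S t) + c * conjc (p t * S t))).
    apply/funext => t; rewrite /q conjcB !conjcM !conjcK; ring.
  have cpS : ccont (fun t => p t * S t) by exact: ccontM.
  have cSS : ccont (fun t => S t * conjc (S t)) by exact: ccontM.
  have cZ (a : C) h : ccont h -> ccont (fun t => a * h t).
    by move=> ch; apply: ccontM => //; exact: ccont_cst.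
  rewrite circ_intB; last 2 first.
  - by apply: ccontD => //; exact: cZ.
  - by apply: ccontD; apply: cZ => //; exact: ccont_conj.
  rewrite [X in X - _]circ_intD; [|by []|exact: cZ].
  rewrite [X in _ - X]circ_intD; [|exact: cZ|by apply/cZ/ccont_conj].
  rewrite (circ_intZ (c * conjc c) cSS) (circ_intZ (conjc c) cpS).
  rewrite (circ_intZ c (ccont_conj cpS)).
  rewrite circ_int_conj// pS SS -/A /c !conjcM conjcV conjc_real conjc_nat.
  have pC : pi2%:C != 0 :> C by rewrite -normc_gt0 normc_real normr_gt0 gt_eqF.
  have -> : (N%:R / pi2)%:C = N%:R / pi2%:C :> C by rewrite fmorph_div rmorph_nat.
  by field.
apply/eq0_normc/eqP; rewrite -sqrf_eq0 eq_le sqr_ge0 andbT leNgt.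
apply/negP => m0.
have mp : 0 < normc m ^+ 2 / pi2 by rewrite divr_gt0.
have := main (Num.truncn (complex.Re A / (normc m ^+ 2 / pi2))).+1.
rewrite -mulrA -ler_pdivlMr// leNgt => /negP; apply.
exact: truncnS_gt.
Qed.

(** On the circle through [z], [F (z * cis t) - F z = z * (cis t - 1) * q t] with [q] continuous.
    Multiplying by [cis t - 1] takes differences of consecutive Fourier coefficients, so those of
    [z * q] are constant on either side of the frequency where [F z] appears. Bessel makes both
    constants 0, and the jump between them is a multiple of [F z]. *)
Lemma taylor_int_eq0 F z : disc_diff F -> normc z < 1 ->
  (forall k, taylor_int F k z = 0) -> F z = 0.
Proof.
move=> dF z1 F0; have [L HL] := dF z z1.
(* The value [L] at [z] makes the difference quotient continuous there. *)
pose D w := if w == z then L else (F w - F z) / (w - z).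
have Dz : ccont_at D z.
  move=> e e0; have e20 : 0 < e / 2 by rewrite divr_gt0.
  have [d d0 Hd] := HL _ e20; exists d => // w wd.
  rewrite /D eqxx; case: eqVneq => [_|wz]; first by rewrite subrr normc0.
  have nwz : 0 < normc (w - z) by rewrite normc_gt0 subr_eq0.
  have := Hd (w - z) wd; rewrite [z + _]addrC subrK => le1.
  have -> : (F w - F z) / (w - z) - L = (F w - F z - L * (w - z)) / (w - z).
    by field; rewrite subr_eq0.
  rewrite normcM normcV ltr_pdivrMr//; apply: (le_lt_trans le1).
  by rewrite ltr_pM2r// ltr_pdivrMr// ltr_pMr// ltr1n.
have Dc w : normc w < 1 -> ccont_at D w.
  move=> w1; have [->//|wz] := eqVneq w z.
  apply: cdiff_ccont_at.
  have nwz : 0 < normc (w - z) by rewrite normc_gt0 subr_eq0.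
  apply: (@cdiff_near _ (fun v => (F v - F z) * (v - z)^-1) D w (normc (w - z))) => //.
    move=> v vw; rewrite /D; case: eqVneq => // vz.
    by move: vw; rewrite vz normcB ltxx.
  have dsub k G : cdiff G w -> cdiff (fun v : C => G v - k) w.
    move=> [K HK]; exists K => e /HK[d d0 Hd]; exists d => // v /Hd.
    by congr (normc _ <= _); ring.
  apply: cdiffM; first exact/dsub/dF.
  have [K HK] := @cdiffV R (w - z) ltac:(by rewrite subr_eq0).
  exists K => e /HK[d d0 Hd]; exists d => // v /Hd.
  by congr (normc (_^-1 - _ - _) <= _); ring.
pose q t := D (z * cis t).
have cq : ccont q.
  apply: ccont_comp.
    by apply: ccontM; [exact: ccont_cst|exact: ccont_cis].
  by move=> t; apply: Dc; rewrite normcM normc_cis mulr1.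
have qE t : F (z * cis t) - F z = z * (cis t - 1) * q t.
  rewrite /q /D; case: eqVneq => [E|ne].
    rewrite E subrr mulrBr mulr1 E subrr mul0r//.
  by rewrite mulrBr mulr1 [RHS]mulrC divfK// subr_eq0.
have cisX k : ccont (fun t => (cis t : C) ^+ k) by exact/ccontX/ccont_cis.
have conX k : ccont (fun t => conjc (cis t : C) ^+ k).
  exact/ccontX/ccont_conj/ccont_cis.
have cF : ccont (fun t => F (z * cis t)) by exact: ccont_disc.
have cst k : ccont (fun=> k : C) by exact: ccont_cst.
pose d k := circ_int (fun t => conjc (cis t) ^+ k * (z * q t)).
pose e k := circ_int (fun t => cis t ^+ k * (z * q t)).
have cd h : ccont h -> ccont (fun t => h t * (z * q t)).
  by move=> ch; apply: ccontM => //; exact: ccontM.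
(* The difference is a Taylor integral of index [k.+1], zero by hypothesis, minus a multiple of the
   integral of a nontrivial power of [conjc (cis t)]. *)
have dS k : d k.+1 = d k.
  apply/eqP; rewrite eq_sym -subr_eq0 -circ_intB; [|exact: cd..].
  have -> : (fun t => conjc (cis t) ^+ k * (z * q t) - conjc (cis t) ^+ k.+1 * (z * q t))
    = (fun t => conjc (cis t) ^+ k.+1 * F (z * cis t) - F z * conjc (cis t ^+ k.+1)).
    apply/funext => t; rewrite conjcX [F z * _]mulrC -mulrBr qE.
    move: (cis_conj t); move: (conjc (cis t)) (cis t) (q t) => c u v uc.
    by rewrite exprS -[X in X * _ - _]mul1r -{1}uc; ring.
  rewrite circ_intB; [|exact: ccontM|by apply: ccontM => //; exact: ccont_conj].
  rewrite -/(taylor_int F k.+1 z) F0 circ_intZ; last exact: ccont_conj.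
  by rewrite circ_int_conj// circ_int_cis_pow// conjc0 mulr0 subrr.
(* On this side the Fourier integrals of [F] vanish by [circ_int_mean], whatever its Taylor
   integrals are. *)
have eS k : e k.+2 = e k.+1.
  apply/eqP; rewrite -subr_eq0 -circ_intB; [|exact: cd..].
  have -> : (fun t => cis t ^+ k.+2 * (z * q t) - cis t ^+ k.+1 * (z * q t))
    = (fun t => cis t ^+ k.+1 * F (z * cis t) - F z * cis t ^+ k.+1).
    apply/funext => t; rewrite [F z * _]mulrC -mulrBr qE [cis t ^+ k.+2]exprS.
    by move: (cis t) (q t) => u v; ring.
  rewrite circ_intB; [|exact: ccontM|exact: ccontM].
  by rewrite circ_int_mean// circ_intZ// circ_int_cis_pow// mulr0 subrr.
(* The exceptional frequency: here the constant [F z] survives integration. *)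
have E0 : e 1%N - d 0%N = - ((2 * pi)%:C * F z).
  rewrite -circ_intB; [|exact: cd..].
  have -> : (fun t => cis t ^+ 1 * (z * q t) - conjc (cis t) ^+ 0 * (z * q t))
    = (fun t => conjc (cis t) ^+ 0 * F (z * cis t) - F z).
    apply/funext => t; rewrite expr0 expr1 !mul1r qE.
    by move: (cis t) (q t) => u v; ring.
  rewrite circ_intB; [|exact: ccontM|by []].
  by rewrite -/(taylor_int F 0 z) F0 circ_int_cst sub0r.
have e1 : e 1%N = 0.
  apply: (@circ_int_bessel (fun t => cis t * (z * q t))).
    by apply: cd; exact: ccont_cis.
  move=> k.
  have ek : e k.+1 = e 1%N.
    elim: k => [|k IH].
      reflexivity.
    rewrite eS. exact IH.
  rewrite -ek.
  rewrite /e; apply: congr1; apply/funext => t; rewrite mulrA -exprSr; reflexivity.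
have d0 : conjc (d 0%N) = 0.
  apply: (@circ_int_bessel (fun t => conjc (z * q t))).
    exact/ccont_conj/ccontM.
  move=> k.
  have dk : d k = d 0%N.
    elim: k => [|k IH].
      reflexivity.
    rewrite dS. exact IH.
  rewrite -dk.
  rewrite /d. rewrite -circ_int_conj; last exact: cd.
  apply: congr1; apply/funext => t; rewrite [RHS]conjcM conjcX conjcK; reflexivity.
move: E0; rewrite e1 -(conjcK (d 0%N)) d0 conjc0 subrr => /esym/eqP.
rewrite oppr_eq0 mulf_eq0 => /orP[|/eqP//].
move=> /eqP E; have : normc (2 * pi)%:C = 0 :> R by rewrite E normc0.
by rewrite normc_real => /eqP; rewrite normr_eq0 mulf_eq0 pnatr_eq0/= gt_eqF ?pi_gt0.
Qed.

End FourierUniqueness.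

(** * Integration against the weight *)

Section PowerSlice.
Context {R : realType}.
Local Notation mu := (@lebesgue_measure R).
Variables (alpha c : R).
Hypothesis alpha1 : -1 < alpha.
Hypothesis c1 : c <= 1.

(** The density along the horizontal chord at height y, with c = 1 - y^2; [F] is an antiderivative
    of [2 * x * f x]. *)
Let f (x : R) := (c - x ^+ 2) `^ alpha.
Let F (x : R) := - (alpha + 1)^-1 * (c - x ^+ 2) `^ (alpha + 1).

Lemma is_derive_powR_quadratic (b x : R) : 0 < c - x ^+ 2 ->
  is_derive x 1 (fun x => (c - x ^+ 2) `^ b) (b * (c - x ^+ 2) `^ (b - 1) * (- (2 * x))).
Proof.
move=> cx; have h1 : is_derive x 1 (fun x : R => c - x ^+ 2) (- (2 * x)).
  have hX := is_deriveX 2 (is_derive_id x (1 : R)).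
  have := @is_deriveB R R R (cst c) ((@id R) ^+ 2) x 1 _ _ (is_derive_cst c x 1) hX.
  rewrite sub0r expr1 /GRing.scale/= mulr1.
  by have -> : cst c - (@id R) ^+ 2 = (fun x : R => c - x ^+ 2) by apply/funext.
exact: (@is_derive1_comp R (@powR R ^~ b) (fun x => c - x ^+ 2) x _ _ (is_derive1_powR b cx) h1).
Qed.

(** For [x >= 1/2] the integrand is at most [2 * x * f x], which integrates exactly. The bound
    depends neither on [c] nor on [s], although [f] may blow up at the end of the chord. *)
Lemma powR_slice_le (s : R) : s ^+ 2 < c -> 0 <= s ->
  (\int[mu]_(x in `[(2^-1)%R, s]) (f x)%:E <= ((alpha + 1)^-1)%:E)%E.
Proof.
move=> sc s0; have a0 : 0 < alpha + 1 by rewrite -(subrK 1 0) sub0r ltrD2r.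
have ai0 : 0 < (alpha + 1)^-1 by rewrite invr_gt0.
(* In this case the slice has at most one point and its integral is 0. *)
have [s2|s2] := leP s 2^-1.
  have sub : `[2^-1, s]%classic `<=` [set 2^-1 : R].
    move=> x /=; rewrite in_itv/= => /andP[x1 x2]; apply/eqP.
    by rewrite eq_le x1 (le_trans x2).
  apply: (@le_trans _ _ 0%E); last by rewrite lee_fin ltW.
  rewrite -(@integral_set1 R (EFin \o f) 2^-1).
  apply: ge0_subset_integral => //.
    by apply: measurable_fun_set1.
  by move=> x _; rewrite lee_fin powR_ge0.
have pos x : 2^-1 <= x <= s -> 0 < c - x ^+ 2.
  move=> /andP[x2 xs]; rewrite subr_gt0; apply: le_lt_trans sc.
  rewrite ler_sqr// nnegrE; by apply: le_trans x2; rewrite invr_ge0.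
pose g x := 2 * x * f x.
have dF x : 2^-1 <= x <= s -> is_derive x 1 F (g x).
  move=> /pos cx; have := is_derive_powR_quadratic (alpha + 1) cx.
  move=> /(is_deriveZ (- (alpha + 1)^-1)); rewrite /GRing.scale/= => hZ.
  suff <- : - (alpha + 1)^-1 * ((alpha + 1) * (c - x ^+ 2) `^ (alpha + 1 - 1) *
    (- (2 * x))) = g x by exact: hZ.
  rewrite /g /f addrK.
  by field; rewrite gt_eqF.
have cF x : 2^-1 <= x <= s -> {for x, continuous F}.
  by move=> /dF[dx _]; apply/differentiable_continuous/derivable1_diffP.
have cg x : 2^-1 <= x <= s -> {for x, continuous g}.
  move=> xs; apply: cvgM.
    by apply: cvgM; [exact: cvg_cst|exact: cvg_id].
  have [dx _] := is_derive_powR_quadratic alpha (pos _ xs).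
  exact/differentiable_continuous/derivable1_diffP.
have fg x : 2^-1 <= x -> f x <= g x.
  move=> x2; rewrite /g -[leLHS]mul1r ler_wpM2r ?powR_ge0//.
  by rewrite -ler_pdivrMl// mulr1.
have wg : {within `[2^-1, s], continuous g}.
  by apply: continuous_in_subspaceT => x /set_mem /=; rewrite in_itv/= => /cg.
have FTC : (\int[mu]_(x in `[(2^-1)%R, s]) (g x)%:E = (F s)%:E - (F 2^-1)%:E)%E.
  apply: continuous_FTC2 => //.
    split.
    - move=> x; rewrite in_itv/= => /andP[x1 x2].
      by have [] : is_derive x 1 F (g x) by apply: dF; rewrite (ltW x1) ltW.
    - by apply: cvg_at_right_filter; apply: cF; rewrite lexx ltW.
    - by apply: cvg_at_left_filter; apply: cF; rewrite lexx ltW.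
  move=> x; rewrite in_itv/= => /andP[x1 x2].
  have xs : 2^-1 <= x <= s by rewrite (ltW x1) ltW.
  by rewrite derive1E; apply: derive_val; exact: dF.
have mg : measurable_fun `[2^-1, s] g.
  by apply: subspace_continuous_measurable_fun.
have mf : measurable_fun `[2^-1, s] f.
  apply: subspace_continuous_measurable_fun => //.
  apply: continuous_in_subspaceT => x /set_mem /=; rewrite in_itv/= => /pos cx.
  have [dx _] := is_derive_powR_quadratic alpha cx.
  exact/differentiable_continuous/derivable1_diffP.
apply: (@le_trans _ _ (\int[mu]_(x in `[(2^-1)%R, s]) (g x)%:E)%E).
  apply: ge0_le_integral => //.
  - by move=> x _; rewrite lee_fin powR_ge0.
  - exact/measurable_EFinP.
  - exact/measurable_EFinP.
  - by move=> x /=; rewrite in_itv/= => /andP[x2 _]; rewrite lee_fin fg.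
rewrite FTC -EFinB lee_fin /F !mulNr opprK addrC.
apply: (@le_trans _ _ ((alpha + 1)^-1 * (c - 2^-1 ^+ 2) `^ (alpha + 1))).
  by rewrite gerBl mulr_ge0 ?powR_ge0// ltW.
rewrite -[leRHS]mulr1 ler_pM2l// -[leRHS](congr1 (fun h => h (alpha + 1)) (powR1 R)).
have p2 : 0 < c - 2^-1 ^+ 2 by apply: pos; rewrite lexx ltW.
apply: ge0_ler_powR; rewrite ?nnegrE ?(ltW p2) ?(ltW a0)//.
by rewrite (le_trans _ c1)// gerBl sqr_ge0.
Qed.

End PowerSlice.

(** * Finiteness of the weighted area of the disc *)

Section FiniteMass.
Context {R : realType}.
Local Notation mu := (@lebesgue_measure R).
Local Notation T := (measurableTypeR R).
Local Notation mu2 := (mu \x mu)%E.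
Local Notation C := R[i].

Definition sqnorm (p : T * T) : R := p.1 ^+ 2 + p.2 ^+ 2.

Lemma sqr_normc_toC (p : T * T) : Normc.normc (toC p) ^+ 2 = sqnorm p.
Proof. by rewrite sqr_normc_ReIm. Qed.

Lemma planar_discE (p : T * T) : planar_disc p <-> sqnorm p < 1.
Proof.
rewrite /planar_disc /unit_disc/=; rewrite (_ : 1 = 1%:C)// lt_normC.
by rewrite -sqr_normc_toC -[X in _ ^+ 2 < X](expr1n _ 2) ltr_sqr ?nnegrE ?normc_ge0.
Qed.

Lemma measurable_sqnorm : measurable_fun [set: T * T] sqnorm.
Proof. by apply: measurable_funD; apply: measurable_funX. Qed.

Lemma measurable_sqnorm_lt (r : R) : measurable [set p : T * T | sqnorm p < r].
Proof.
rewrite -[X in measurable X]setTI.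
have -> : [set p : T * T | sqnorm p < r] = sqnorm @^-1` `]-oo, r[.
  by apply/seteqP; split=> p /=; rewrite in_itv.
by apply: measurable_sqnorm => //; exact: measurable_itv.
Qed.

Lemma planar_disc_set : @planar_disc R = [set p : T * T | sqnorm p < 1].
Proof. by apply/seteqP; split=> p /planar_discE. Qed.

Lemma measurable_disc : measurable (@planar_disc R : set (T * T)).
Proof. by rewrite planar_disc_set; exact: measurable_sqnorm_lt. Qed.

Lemma ge0_preserves_integral (phi : T * T -> T * T) (A : set (T * T))
    (f : T * T -> \bar R) : preserves_mu2 phi -> measurable A ->
  measurable_fun A f -> (forall p, A p -> 0 <= f p)%E ->
  (\int[mu2]_(p in phi @^-1` A) f (phi p) = \int[mu2]_(p in A) f p)%E.
Proof.
move=> [mphi pphi] mA mf f0.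
have := ge0_integral_pushforward mphi mu2 mA mf.
move=> <-; last by move=> p /set_mem; exact: f0.
by apply: eq_measure_integral => //= B mB _; exact: pphi.
Qed.

Lemma ge0_integral_setU_le (A B : set (T * T)) (f : T * T -> \bar R) :
  measurable A -> measurable B -> measurable_fun [set: T * T] f ->
  (forall p, 0 <= f p)%E ->
  (\int[mu2]_(p in A `|` B) f p <= \int[mu2]_(p in A) f p + \int[mu2]_(p in B) f p)%E.
Proof.
move=> mA mB mf f0; rewrite -[A `|` B](setDUK (@subsetUl _ A B)).
have mD : measurable ((A `|` B) `\` A) by apply: measurableD => //; exact: measurableU.
rewrite ge0_integral_setU//; last 2 first.
- exact: measurable_funTS.
- by rewrite disj_set2E setDIK.
rewrite leeD2l//; apply: ge0_subset_integral => //; first exact: measurable_funTS.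
by move=> p [[]].
Qed.

Variable alpha : R.
Hypothesis alpha1 : -1 < alpha.

Definition radial (p : T * T) : R := (1 - sqnorm p) `^ alpha.

Lemma measurable_radial : measurable_fun [set: T * T] radial.
Proof.
apply: (measurableT_comp (measurable_powR alpha)).
by apply: measurable_funB => //; exact: measurable_sqnorm.
Qed.

Let mradialE : measurable_fun [set: T * T] (EFin \o radial).
Proof. by apply/measurable_EFinP; exact: measurable_radial. Qed.

Let radial_ge0 p : (0 <= (radial p)%:E)%E.
Proof. by rewrite lee_fin powR_ge0. Qed.

Let K : R := (alpha + 1)^-1.

Let K0 : 0 < K.
Proof. by rewrite invr_gt0; move: alpha1; lra. Qed.

Let part (r : R) : set (T * T) := [set p | 2^-1 <= p.1] `&` [set p | sqnorm p < r].

(** Away from the unit circle each chord ends strictly before the singularity, as [powR_slice_le]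
    demands; the caps increase to [part 1]. *)
Let cap n : set (T * T) :=
  [set p | 2^-1 <= p.1] `&` [set p | sqnorm p <= 1 - n.+1%:R^-1].

Let measurable_right : measurable [set p : T * T | 2^-1 <= p.1].
Proof.
have -> : [set p : T * T | 2^-1 <= p.1] = fst @^-1` `[2^-1, +oo[.
  by apply/seteqP; split=> p /=; rewrite in_itv/= andbT.
rewrite -[X in measurable X]setTI.
by apply: measurable_fst => //; exact: measurable_itv.
Qed.

Let measurable_cap n : measurable (cap n).
Proof.
apply: measurableI => //.
have -> : [set p : T * T | sqnorm p <= 1 - n.+1%:R^-1] = sqnorm @^-1` `]-oo, 1 - n.+1%:R^-1].
  by apply/seteqP; split=> p /=; rewrite in_itv.
rewrite -[X in measurable X]setTI.
by apply: measurable_sqnorm => //; exact: measurable_itv.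
Qed.

(** Tonelli over the heights: every slice contributes at most [K], and the factor 2 is the length of
    the interval of heights. *)
Lemma cap_integral_le n :
  (\int[mu2]_(p in cap n) (radial p)%:E <= (K * 2)%:E)%E.
Proof.
pose h := (EFin \o radial) \_ (cap n).
have mh : measurable_fun [set: T * T] h.
  by apply/(measurable_restrictT _ (measurable_cap n)); exact: measurable_funTS.
have h0 p : (0 <= h p)%E by apply: erestrict_ge0 => q _; exact: radial_ge0.
rewrite integral_mkcond -/h fubini_tonelli2//.
have n0 : 0 < n.+1%:R^-1 :> R by rewrite invr_gt0.
have slice (y : R) : (fubini_G mu h y <= (K%:E * (\1_(`[(-1)%R, 1%R]) y)%:E))%E.
  rewrite /fubini_G.
  (* At heights beyond this bound the slice is empty. *)
  have [y1|y1] := leP (y ^+ 2 + n.+1%:R^-1) 1; last first.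
    rewrite integral0_eq; first by rewrite mule_ge0 ?lee_fin// ltW.
    move=> x _; rewrite /h patchE; case: ifPn => // /set_mem [_ /=].
    rewrite /sqnorm/= => H; exfalso.
    have arith (a b e : R) : a + b <= 1 - e -> 1 < b + e -> 0 <= a -> False by lra.
    exact: arith H y1 (sqr_ge0 (x : R)).
  have -> : (\1_(`[(-1)%R, 1%R]) y = 1 :> R).
    rewrite indicE mem_set//= in_itv/= -ler_norml.
    by apply: le_sqr_normr => //; rewrite expr1n (le_trans _ y1)// lerDl ltW.
  rewrite mule1; pose c := 1 - y ^+ 2; pose s := Num.sqrt (c - n.+1%:R^-1).
  have cn : 0 <= c - n.+1%:R^-1 by rewrite /c subr_ge0 lerBrDl.
  have sE : s ^+ 2 = c - n.+1%:R^-1 by rewrite sqr_sqrtr.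
  have c1 : c <= 1 by rewrite gerBl sqr_ge0.
  have := @powR_slice_le R alpha c alpha1 c1 s.
  rewrite sE sqrtr_ge0 => /(_ _ isT) H; apply: le_trans (H _); last by rewrite gtrBl.
  rewrite [leRHS]integral_mkcond le_eqVlt; apply/orP; left; apply/eqP.
  apply: eq_integral => x _; rewrite /h !patchE.
  have -> : ((x, y) \in cap n) = (x \in `[2^-1, s]%classic).
    apply/idP/idP => /set_mem.
      move=> [/= x2]; rewrite /sqnorm/= => xy; apply/mem_set; rewrite /= in_itv/= x2/=.
      rewrite -ler_sqr ?nnegrE ?sqrtr_ge0//; last by apply: le_trans x2; rewrite invr_ge0.
      by rewrite sE /c addrAC lerBrDr.
    rewrite /= in_itv/= => /andP[x2 xs]; apply/mem_set; split => //=.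
    have : x ^+ 2 <= s ^+ 2.
      by rewrite ler_sqr ?nnegrE ?sqrtr_ge0//; apply: le_trans x2; rewrite invr_ge0.
    by rewrite sE /c /sqnorm/= addrAC lerBrDr.
  case: ifP => // _; rewrite /radial /sqnorm/= /c; congr ((_ `^ _)%:E); ring.
apply: (@le_trans _ _ (\int[mu]_y (K%:E * (\1_(`[(-1)%R, 1%R]) y)%:E))%E).
  apply: ge0_le_integral => //.
  - by move=> y _; apply: integral_ge0.
  - exact: measurable_fun_fubini_tonelli_G.
  - by apply: measurable_funeM; apply/measurable_EFinP.
have K0e : (0 <= K%:E)%E by rewrite lee_fin ltW.
rewrite ge0_integralZl//; last by apply/measurable_EFinP.
rewrite integral_indic// setIT.
have := lebesgue_measure_itv `[(-1 : R), 1]; rewrite /= lte_fin => ->.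
have -> : -1 < 1 :> R by lra.
by rewrite -EFinM lee_fin ler_pM2l//; lra.
Qed.

Lemma right_integral_le :
  (\int[mu2]_(p in part 1%R) (radial p)%:E <= (K * 2)%:E)%E.
Proof.
have -> : part 1 = \bigcup_n cap n.
  apply/seteqP; split=> [p [p1 /= p2]|p [n _ [p1 /= p2]]]; last first.
    split => //=; apply: le_lt_trans p2 _.
    by rewrite gtrBl invr_gt0.
  have q0 : 0 < 1 - sqnorm p by rewrite subr_gt0.
  exists (Num.truncn (1 - sqnorm p)^-1) => //; split => //=.
  rewrite lerBrDr -lerBrDl invf_ple ?posrE//; exact/ltW/truncnS_gt.
have ndcap : nondecreasing_seq cap.
  move=> m n mn; rewrite subsetEset => p [p1 /= p2]; split => //=.
  apply: (le_trans p2); rewrite lerB// lef_pV2 ?posrE ?ltr0n// ler_nat.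
  by rewrite ltnS.
have cv := @ge0_nondecreasing_set_cvg_integral _ _ R cap (EFin \o radial) mu2
  ndcap measurable_cap (fun i => measurable_funTS mradialE) (fun i p _ => radial_ge0 p).
rewrite -(cvg_lim _ cv)//; apply: lime_le; first by apply/cvg_ex; eexists; exact: cv.
by near=> n; exact: cap_integral_le.
Unshelve. all: by end_near. Qed.

Let quarter (p : T * T) : T * T := (- p.2, p.1).

Let preserves_quarter : preserves_mu2 quarter.
Proof.
have := @rotation_preserves R 0 1; rewrite expr0n expr1n add0r => /(_ erefl).
by congr preserves_mu2; apply/funext => p; rewrite !mul0r !mul1r sub0r addr0.
Qed.

Let sqnorm_quarter p : sqnorm (quarter p) = sqnorm p.
Proof. by rewrite /sqnorm /quarter/= sqrrN addrC. Qed.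

(** A point with both coordinates below 1/2 in absolute value has [sqnorm] below 1/2, where [radial]
    is at most 2. The rest of the disc is covered by the right-hand part and its images under
    quarter turns, which all have the same integral. *)
Lemma radial_disc_finite : (\int[mu2]_(p in @planar_disc R) (radial p)%:E < +oo)%E.
Proof.
pose A := part 1; pose f p := (radial p)%:E.
have mA : measurable A.
  by apply: measurableI => //; exact: measurable_sqnorm_lt.
have mpre (B : set (T * T)) : measurable B -> measurable (quarter @^-1` B).
  by move=> mB; rewrite -[X in measurable X]setTI; apply: (preserves_quarter.1).
have rot (B : set (T * T)) : measurable B ->
    (\int[mu2]_(p in quarter @^-1` B) f p = \int[mu2]_(p in B) f p)%E.
  move=> mB; have mfB : measurable_fun B f by exact: measurable_funTS.
  rewrite -(ge0_preserves_integral preserves_quarter mB mfB (fun p _ => radial_ge0 p)).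
  by apply: eq_integral => p _; rewrite /f /radial sqnorm_quarter.
pose B := quarter @^-1` A; pose B2 := quarter @^-1` B; pose B3 := quarter @^-1` B2.
have mB : measurable B by exact: mpre.
have mB2 : measurable B2 by exact: mpre.
have mB3 : measurable B3 by exact: mpre.
pose Q : set (T * T) := `[(-1 : R), 1]%classic `*` `[(-1 : R), 1]%classic `&`
  [set p | sqnorm p < 2^-1].
have mQ : measurable Q.
  by apply: measurableI; [apply: measurableX|exact: measurable_sqnorm_lt].
have sub : @planar_disc R `<=` Q `|` (A `|` (B `|` (B2 `|` B3))).
  move=> p; rewrite planar_discE => p1.
  have [hx|hx] := leP 2^-1 p.1; first by right; left; split.
  have [hx'|hx'] := leP 2^-1 (- p.1).
    right; right; right; left; split => //=.
    by rewrite !sqnorm_quarter.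
  have [hy|hy] := leP 2^-1 p.2.
    right; right; right; right; split => //=; first by rewrite opprK.
    by rewrite !sqnorm_quarter.
  have [hy'|hy'] := leP 2^-1 (- p.2).
    right; right; left; split => //=.
    by rewrite !sqnorm_quarter.
  left; split; first by split => /=; rewrite in_itv/=; apply/andP; split; lra.
  rewrite /= /sqnorm; nra.
have fQ : (\int[mu2]_(p in Q) f p <= 2%:E * 4%:E)%E.
  apply: (@le_trans _ _ (\int[mu2]_(p in Q) (cst 2%:E) p)%E).
    apply: ge0_le_integral => //.
    - by move=> p _; exact: radial_ge0.
    - exact: measurable_funTS.
    - move=> p [_ /= p2]; rewrite lee_fin /radial.
      have h1 : 0 < 1 - sqnorm p <= 1.
        have : 0 <= sqnorm p by rewrite addr_ge0 ?sqr_ge0.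
        by move: p2; lra.
      (* The base is at most 1 and [alpha > -1], so the power grows when the exponent is lowered to
         -1. *)
      apply: (@le_trans _ _ ((1 - sqnorm p) `^ (-1))).
        by apply: (ger_powR h1); exact/ltW.
      rewrite powR_inv1; last by case/andP: h1 => /ltW.
      by rewrite invf_ple ?posrE; [move: p2; lra|by case/andP: h1|].
  rewrite integral_cst// lee_wpmul2l ?lee_fin//.
  apply: (@le_trans _ _ (mu2 (`[(-1 : R), 1]%classic `*` `[(-1 : R), 1]%classic))).
    by apply: le_measure; rewrite ?inE//; [exact: measurableX|move=> p []].
  rewrite product_measure1E//.
  have := lebesgue_measure_itv `[(-1 : R), 1]; rewrite /= lte_fin => ->.
  have -> : -1 < 1 :> R by lra.
  by rewrite -EFinB opprK -EFinM lee_fin; lra.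
have fA : (\int[mu2]_(p in A) f p < +oo)%E.
  by apply: le_lt_trans right_integral_le _; rewrite ltry.
have fB : (\int[mu2]_(p in B) f p < +oo)%E by rewrite rot.
have fB2 : (\int[mu2]_(p in B2) f p < +oo)%E by rewrite rot.
have fB3 : (\int[mu2]_(p in B3) f p < +oo)%E by rewrite rot.
have mU (X Y : set (T * T)) : measurable X -> measurable Y ->
  (\int[mu2]_(p in X) f p < +oo)%E -> (\int[mu2]_(p in Y) f p < +oo)%E ->
  (\int[mu2]_(p in X `|` Y) f p < +oo)%E.
  move=> mX mY fX fY; apply: (le_lt_trans (ge0_integral_setU_le mX mY mradialE radial_ge0)).
  by rewrite lte_add_pinfty.
have mU3 := measurableU _ _ mB2 mB3.
have mU2 := measurableU _ _ mB mU3.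
have mU1 := measurableU _ _ mA mU2.
apply: (@le_lt_trans _ _ (\int[mu2]_(p in Q `|` (A `|` (B `|` (B2 `|` B3)))) f p)%E).
  apply: ge0_subset_integral => //.
  - exact: measurable_disc.
  - exact: measurableU.
  - exact: measurable_funTS.
apply: (mU _ _ mQ mU1).
  by apply: (le_lt_trans fQ); rewrite -EFinM ltry.
apply: (mU _ _ mA mU2) => //; apply: (mU _ _ mB mU3) => //; exact: (mU _ _ mB2 mB3).
Qed.

End FiniteMass.

(** * Integrals and inner products over the disc *)

Section DiscIntegral.
Context {R : realType}.
Local Notation mu := (@lebesgue_measure R).
Local Notation T := (measurableTypeR R).
Local Notation mu2 := (mu \x mu)%E.
Local Notation C := R[i].
Local Notation normc := Normc.normc.
Local Notation D := (@planar_disc R : set (T * T)).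
Variable alpha : R.
Hypothesis alpha1 : -1 < alpha.
Implicit Types (h k : T * T -> R) (f g u v : C -> C).

Definition wgt (p : T * T) : R := weight alpha (toC p).

Lemma wgtE p : wgt p = (1 + alpha) / pi * radial alpha p.
Proof. by rewrite /wgt /weight sqr_normc_toC /radial mulrAC. Qed.

Lemma wgt_ge0 p : 0 <= wgt p.
Proof.
by rewrite wgtE mulr_ge0 ?powR_ge0// divr_ge0 ?pi_ge0//; move: alpha1; lra.
Qed.

Lemma measurable_wgt : measurable_fun [set: T * T] wgt.
Proof.
have -> : wgt = (fun p => (1 + alpha) / pi * radial alpha p).
  by apply/funext => p; exact: wgtE.
by apply: measurable_funM => //; exact: measurable_radial.
Qed.

Let mD : measurable D. Proof. exact: measurable_disc. Qed.

Definition dint_able h : Prop := mu2.-integrable D (fun p => (h p * wgt p)%:E).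

Definition dint h : R := Rintegral mu2 D (fun p => h p * wgt p).

Lemma dint_able_cst c : dint_able (fun=> c).
Proof.
apply/integrableP; split.
  by apply/measurable_EFinP/measurable_funTS/measurable_funM => //; exact: measurable_wgt.
pose c' : R := `|c| * ((1 + alpha) / pi).
have c'0 : 0 <= c'.
  by rewrite mulr_ge0// divr_ge0 ?pi_ge0//; move: alpha1; lra.
rewrite (eq_integral (fun p => c'%:E * (radial alpha p)%:E)%E); last first.
  move=> p _; rewrite /= normrM (ger0_norm (wgt_ge0 p)) wgtE -EFinM /c'.
  by rewrite mulrA.
rewrite ge0_integralZl//.
- by rewrite lte_mul_pinfty// radial_disc_finite.
- by apply/measurable_EFinP/measurable_funTS; exact: measurable_radial.
- by move=> p _; rewrite lee_fin powR_ge0.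
Qed.

Lemma dint_able_meas h : measurable_fun D h ->
  measurable_fun D (fun p => (h p * wgt p)%:E).
Proof.
move=> mh; apply/measurable_EFinP/measurable_funM => //.
by apply: measurable_funTS; exact: measurable_wgt.
Qed.

Lemma dint_able_dom h k : measurable_fun D h -> dint_able k ->
  (forall p, D p -> `|h p| <= k p) -> dint_able h.
Proof.
move=> mh ik hk; apply: le_integrable ik => //; first exact: dint_able_meas.
move=> p Dp; rewrite lee_fin !normrM ler_wpM2r//.
by apply: (le_trans (hk p Dp)); exact: ler_norm.
Qed.

Lemma dint_ableD h k : dint_able h -> dint_able k -> dint_able (fun p => h p + k p).
Proof.
move=> ih ik; have := integrableD mD ih ik.
by apply: eq_integrable => // p _; rewrite /= -EFinD mulrDl.
Qed.

Lemma dint_ableZ c h : dint_able h -> dint_able (fun p => c * h p).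
Proof.
move=> ih; have := integrableZl mD c ih.
by apply: eq_integrable => // p _; rewrite /= -EFinM mulrA.
Qed.

Lemma eq_dint_able h k : (forall p, D p -> h p = k p) -> dint_able h -> dint_able k.
Proof.
by move=> hk; apply: eq_integrable => // p /set_mem Dp; rewrite hk.
Qed.

Lemma eq_dint h k : (forall p, D p -> h p = k p) -> dint h = dint k.
Proof. by move=> hk; apply: eq_Rintegral => p /set_mem Dp; rewrite hk. Qed.

Lemma dintD h k : dint_able h -> dint_able k ->
  dint (fun p => h p + k p) = dint h + dint k.
Proof.
by move=> ih ik; rewrite -RintegralD//; apply: eq_Rintegral => p _; rewrite mulrDl.
Qed.

Lemma dintZ c h : dint_able h -> dint (fun p => c * h p) = c * dint h.
Proof.
by move=> ih; rewrite -RintegralZl//; apply: eq_Rintegral => p _; rewrite mulrA.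
Qed.

Lemma dint_ge0 h : (forall p, D p -> 0 <= h p) -> 0 <= dint h.
Proof.
by move=> h0; apply: Rintegral_ge0 => p Dp; rewrite mulr_ge0 ?wgt_ge0// h0.
Qed.

Definition dmeas f : Prop :=
  measurable_fun D (fun p => complex.Re (f (toC p))) /\
  measurable_fun D (fun p => complex.Im (f (toC p))).

Definition cdint_able f : Prop :=
  dint_able (fun p => complex.Re (f (toC p))) /\
  dint_able (fun p => complex.Im (f (toC p))).

Lemma Cintegral_dint f : Cintegral_dA alpha f =
  dint (fun p => complex.Re (f (toC p))) +i* dint (fun p => complex.Im (f (toC p))).
Proof. by []. Qed.

Lemma cdint_able_dom f k : dmeas f -> dint_able k ->
  (forall p, D p -> normc (f (toC p)) <= k p) -> cdint_able f.
Proof.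
move=> [mr mi] ik fk; split; apply: (dint_able_dom _ ik) => // p Dp.
  by apply: le_trans (fk p Dp); exact: Re_le_normc.
by apply: le_trans (fk p Dp); exact: Im_le_normc.
Qed.

Lemma eq_Cintegral f g : (forall z, normc z < 1 -> f z = g z) ->
  Cintegral_dA alpha f = Cintegral_dA alpha g.
Proof.
move=> fg; rewrite !Cintegral_dint; congr Complex; apply: eq_dint => p;
by rewrite /planar_disc/= /unit_disc/= (_ : 1 = 1%:C)// lt_normC => /fg ->.
Qed.

Lemma CintegralD f g : cdint_able f -> cdint_able g ->
  Cintegral_dA alpha (fun z => f z + g z) = Cintegral_dA alpha f + Cintegral_dA alpha g.
Proof.
move=> [fr fi] [gr gi]; apply: ReIm_eq; rewrite !Cintegral_dint/= -dintD//.
  by apply: eq_dint => p _; rewrite creD.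
by apply: eq_dint => p _; rewrite cimD.
Qed.

Lemma CintegralZ c f : cdint_able f ->
  Cintegral_dA alpha (fun z => c * f z) = c * Cintegral_dA alpha f.
Proof.
move=> [fr fi]; apply: ReIm_eq.
  rewrite creM !Cintegral_dint/= -!dintZ// -[X in _ + X]mulN1r -dintZ; last exact: dint_ableZ.
  rewrite -dintD; [|exact: dint_ableZ|by do 2 apply: dint_ableZ].
  by apply: eq_dint => p _; rewrite creM mulN1r.
rewrite cimM !Cintegral_dint/= -!dintZ// -dintD; [|exact: dint_ableZ..].
by apply: eq_dint => p _; rewrite cimM.
Qed.

Lemma cdint_ableZ c f : cdint_able f -> cdint_able (fun z => c * f z).
Proof.
move=> [fr fi]; split.
  apply: eq_dint_able (dint_ableD (dint_ableZ (complex.Re c) fr)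
    (dint_ableZ (- complex.Im c) fi)) => p _.
  by rewrite creM mulNr.
apply: eq_dint_able (dint_ableD (dint_ableZ (complex.Re c) fi)
  (dint_ableZ (complex.Im c) fr)) => p _.
by rewrite cimM.
Qed.

Lemma Cintegral_conj f : cdint_able f ->
  Cintegral_dA alpha (fun z => conjc (f z)) = conjc (Cintegral_dA alpha f).
Proof.
move=> [fr fi]; rewrite !Cintegral_dint /=; congr Complex.
  by apply: eq_dint => p _; case: (f _).
rewrite -mulN1r -dintZ//.
by apply: eq_dint => p _; rewrite mulN1r; case: (f _).
Qed.

Lemma dmeasD f g : dmeas f -> dmeas g -> dmeas (fun z => f z + g z).
Proof.
move=> [fr fi] [gr gi]; split.
  by under eq_fun do rewrite creD; exact: measurable_funD.
by under eq_fun do rewrite cimD; exact: measurable_funD.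
Qed.

Lemma dmeasM f g : dmeas f -> dmeas g -> dmeas (fun z => f z * g z).
Proof.
move=> [fr fi] [gr gi]; split.
  by under eq_fun do rewrite creM; apply: measurable_funB; exact: measurable_funM.
by under eq_fun do rewrite cimM; apply: measurable_funD; exact: measurable_funM.
Qed.

Lemma dmeas_cst (c : C) : dmeas (fun=> c).
Proof. by split; exact: measurable_cst. Qed.

Lemma dmeas_id : dmeas id.
Proof.
split; apply: measurable_funTS.
  exact: (@measurable_fst _ _ T T).
exact: (@measurable_snd _ _ T T).
Qed.

Lemma dmeas_conj f : dmeas f -> dmeas (fun z => conjc (f z)).
Proof.
move=> [fr fi]; split.
  by apply: eq_measurable_fun fr => p _; case: (f _).
apply: eq_measurable_fun (measurable_funN fi) => p _ /=; by case: (f _).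
Qed.

Lemma dmeasX f n : dmeas f -> dmeas (fun z => f z ^+ n).
Proof.
move=> mf; elim: n => [|n IH]; first exact: dmeas_cst.
by under [fun z => _]eq_fun do rewrite exprS; exact: dmeasM.
Qed.

Lemma eq_dmeas f g : (forall z, normc z < 1 -> f z = g z) -> dmeas f -> dmeas g.
Proof.
move=> fg [fr fi]; split; [apply: eq_measurable_fun fr|apply: eq_measurable_fun fi] => p;
by rewrite inE /planar_disc/= /unit_disc/= (_ : 1 = 1%:C)// lt_normC => /fg ->.
Qed.

Lemma dmeas_sqnormc f : dmeas f -> measurable_fun D (fun p => normc (f (toC p)) ^+ 2).
Proof.
move=> [fr fi]; under eq_fun do rewrite sqr_normc_ReIm.
by apply: measurable_funD; apply: measurable_funX.
Qed.

Lemma L2P f : L2 alpha f <->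
  dmeas f /\ dint_able (fun p => normc (f (toC p)) ^+ 2).
Proof.
split=> [[mr mi fin]|[[mr mi] /integrableP[_ fin]]].
  split=> //; apply/integrableP; split.
    by apply: (@dint_able_meas (fun p => normc (f (toC p)) ^+ 2)); exact: dmeas_sqnormc.
  move: fin; congr (_ < _)%E; apply: eq_integral => p _.
  by rewrite /= ger0_norm// mulr_ge0 ?wgt_ge0 ?sqr_ge0.
split=> //; move: fin; congr (_ < _)%E; apply: eq_integral => p _.
by rewrite gee0_abs// lee_fin mulr_ge0 ?wgt_ge0 ?sqr_ge0.
Qed.

Lemma L2_cdint_able f g : L2 alpha f -> L2 alpha g ->
  cdint_able (fun z => f z * conjc (g z)).
Proof.
move=> /L2P[mf f2] /L2P[mg g2].
apply: (@cdint_able_dom _ (fun p => normc (f (toC p)) ^+ 2 + normc (g (toC p)) ^+ 2)).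
- by apply: dmeasM => //; exact: dmeas_conj.
- exact: dint_ableD.
- move=> p _; rewrite normcM normc_conj.
  move: (normc _) (normc _) => a b; nra.
Qed.

Lemma L2_dom f (g : C -> R) : dmeas f -> dint_able (fun p => g (toC p)) ->
  (forall z, normc z < 1 -> normc (f z) ^+ 2 <= g z) -> L2 alpha f.
Proof.
move=> mf ig fg; apply/L2P; split=> //; apply: dint_able_dom ig _ => //.
  exact: dmeas_sqnormc.
move=> p; rewrite /planar_disc/= /unit_disc/= (_ : 1 = 1%:C)// lt_normC => /fg.
by rewrite ger0_norm// sqr_ge0.
Qed.

Lemma L2_lin (c : C) f g : L2 alpha f -> L2 alpha g -> L2 alpha (fun z => c * f z + g z).
Proof.
move=> /L2P[mf f2] /L2P[mg g2].
apply: (@L2_dom _ (fun z => 2 * normc c ^+ 2 * normc (f z) ^+ 2 + 2 * normc (g z) ^+ 2)).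
- by apply: dmeasD => //; apply: dmeasM => //; exact: dmeas_cst.
- by apply: dint_ableD; exact: dint_ableZ.
- move=> z _; have := le_normcD (c * f z) (g z); rewrite normcM.
  have := normc_ge0 (c * f z + g z); rewrite -mulrA -exprMn.
  move: (normc (_ + _)) (_ * normc _) (normc (g z)) => a b d a0 abd.
  have : a ^+ 2 <= (b + d) ^+ 2 by rewrite lerXn2r ?nnegrE// (le_trans a0).
  have := sqr_ge0 (b - d); rewrite sqrrB sqrrD; lra.
Qed.

Lemma L2_mul_bounded f g (M : R) : dmeas g -> (forall z, normc z < 1 -> normc (g z) <= M) ->
  L2 alpha f -> L2 alpha (fun z => g z * f z).
Proof.
move=> mg gM /L2P[mf f2].
apply: (@L2_dom _ (fun z => M ^+ 2 * normc (f z) ^+ 2)).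
- exact: dmeasM.
- exact: dint_ableZ.
- move=> z z1; rewrite normcM exprMn ler_wpM2r ?sqr_ge0//.
  by rewrite lerXn2r ?nnegrE ?normc_ge0 ?(le_trans (normc_ge0 (g z)))// gM.
Qed.

Lemma L2_bounded g (M : R) : dmeas g -> (forall z, normc z < 1 -> normc (g z) <= M) ->
  L2 alpha g.
Proof.
move=> mg gM; apply: (@L2_dom _ (fun=> M ^+ 2)) => //; first exact: dint_able_cst.
move=> z z1; rewrite lerXn2r ?nnegrE ?normc_ge0 ?(le_trans (normc_ge0 (g z)))// gM//.
Qed.

Lemma inner_lin (c : C) f g v : L2 alpha f -> L2 alpha g -> L2 alpha v ->
  inner alpha (fun z => c * f z + g z) v = c * inner alpha f v + inner alpha g v.
Proof.
move=> Lf Lg Lv; rewrite /inner -CintegralZ; last exact: L2_cdint_able.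
rewrite -CintegralD; [|exact/cdint_ableZ/L2_cdint_able|exact: L2_cdint_able].
by congr (Cintegral_dA _ _); apply/funext => z; rewrite mulrDl mulrA.
Qed.

Lemma inner_sym f g : L2 alpha f -> L2 alpha g ->
  inner alpha g f = conjc (inner alpha f g).
Proof.
move=> Lf Lg; rewrite /inner -Cintegral_conj; last exact: L2_cdint_able.
by congr (Cintegral_dA _ _); apply/funext => z; rewrite conjcM conjcK mulrC.
Qed.

End DiscIntegral.

Section SigmaFinitePlane.
Context {R : realType}.
Local Notation mu := (@lebesgue_measure R).
Local Notation T := (measurableTypeR R).

(* The product measure has no sigma-finite instance of its own; this alias carries
   the one that Fubini's theorem requires. *)
Definition plane_measure : set (T * T) -> \bar R := (mu \x mu)%E.

HB.instance Definition _ := Measure.on plane_measure.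

Let plane_measure_sigma_finite : sigma_finite setT plane_measure.
Proof.
pose I (n : nat) : set T := `[(- n%:R : R), n%:R]%classic.
exists (fun n => I n `*` I n).
  apply/seteqP; split=> // -[x y] _.
  pose m := Num.max `|x : R| `|y : R|.
  exists (Num.truncn m).+1 => //.
  have mlt : m <= (Num.truncn m).+1%:R by exact/ltW/truncnS_gt.
  by split; rewrite /I/= in_itv/= -ler_norml (le_trans _ mlt)// le_max lexx ?orbT.
move=> n; have mI : measurable (I n) by exact: measurable_itv.
split; first exact: measurableX.
rewrite /plane_measure product_measure1E//.
have muI : (mu (I n) < +oo)%E.
  have := lebesgue_measure_itv `[(- n%:R : R), n%:R]; rewrite /= => ->.
  by case: ifP => _; rewrite ?ltry// -EFinB ltry.
by apply: lte_mul_pinfty => //; rewrite ge0_fin_numE.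
Qed.

HB.instance Definition _ := Measure_isSigmaFinite.Build _ _ _ plane_measure
  plane_measure_sigma_finite.

End SigmaFinitePlane.

(** * Reduction of disc integrals to circle integrals *)

Section Invariance.
Context {R : realType}.
Local Notation mu := (@lebesgue_measure R).
Local Notation T := (measurableTypeR R).
Local Notation mu2 := (mu \x mu)%E.
Local Notation C := R[i].
Local Notation normc := Normc.normc.
Local Notation D := (@planar_disc R : set (T * T)).
Variable alpha : R.
Hypothesis alpha1 : -1 < alpha.
Implicit Types (h k : T * T -> R) (f g u v : C -> C).

Let mD : measurable D. Proof. exact: measurable_disc. Qed.

(** The integrand extended by 0 to the whole plane, so that measure-preserving maps act without a
    change of domain. *)
Definition dext h (p : T * T) : \bar R := ((fun p => (h p * wgt alpha p)%:E) \_ D) p.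

Lemma dint_able_dext h : dint_able alpha h <-> mu2.-integrable [set: T * T] (dext h).
Proof. exact: (integrable_mkcond _ mD). Qed.

Section Preserving.
Variable phi : T * T -> T * T.
Hypothesis phiP : preserves_mu2 phi.
Hypothesis sqphi : forall p, sqnorm (phi p) = sqnorm p.

Lemma dext_preserve h p : dext h (phi p) = dext (h \o phi) p.
Proof.
rewrite /dext !patchE.
have -> : (phi p \in D) = (p \in D).
  by apply/idP/idP => /set_mem/planar_discE E; apply/mem_set/planar_discE;
    move: E; rewrite sqphi.
by case: ifP => [_|//]; rewrite wgtE [in RHS]wgtE /radial sqphi.
Qed.

Lemma integrable_preserve (H : T * T -> \bar R) : mu2.-integrable [set: T * T] H ->
  mu2.-integrable [set: T * T] (H \o phi) /\
  (\int[mu2]_p H (phi p) = \int[mu2]_p H p)%E.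
Proof.
move=> iH; have mH := measurable_int _ iH.
have iHphi : mu2.-integrable [set: T * T] (H \o phi).
  apply/integrableP; split; first exact: measurableT_comp mH phiP.1.
  have := @ge0_preserves_integral _ phi setT (fun p => `|H p|%E) phiP measurableT.
  rewrite preimage_setT => -> //; first by have /integrableP[] := iH.
  exact: measurableT_comp.
split=> //; have := integral_pushforward phiP.1 mH iHphi measurableT.
rewrite preimage_setT => <-.
by have [mphi pphi] := phiP; apply: eq_measure_integral => //= B mB _; exact: pphi.
Qed.

Lemma dint_preserve h : dint_able alpha h ->
  dint_able alpha (h \o phi) /\ dint alpha (h \o phi) = dint alpha h.
Proof.
move=> /dint_able_dext /integrable_preserve[i1 i2].
have E : dext h \o phi = dext (h \o phi).
  by apply/funext => p; exact: dext_preserve.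
split; first by apply/dint_able_dext; rewrite -E.
rewrite /dint /Rintegral !(integral_mkcond D); congr fine.
by rewrite -[LHS]/(\int[mu2]_p dext (h \o phi) p)%E -E.
Qed.

End Preserving.

Definition rot (t : R) (p : T * T) : T * T :=
  (cos t * p.1 - sin t * p.2, sin t * p.1 + cos t * p.2).

Lemma preserves_rot t : preserves_mu2 (rot t).
Proof. by apply: rotation_preserves; exact: cos2Dsin2. Qed.

Lemma sqnorm_rot t p : sqnorm (rot t p) = sqnorm p.
Proof.
rewrite /sqnorm /rot/= -[RHS]mul1r -(cos2Dsin2 t).
by move: (cos t) (sin t) => a b; ring.
Qed.

Lemma toC_rot t p : toC (rot t p) = toC p * cis t.
Proof. by apply: ReIm_eq; rewrite ?(creM, cimM) /rot /toC/=; ring. Qed.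

Lemma measurable_rot : measurable_fun [set: (T * T) * T] (fun q => rot q.2 q.1).
Proof.
have m11 : measurable_fun [set: (T * T) * T] (fun q => q.1.1).
  exact: (measurableT_comp measurable_fst measurable_fst).
have m12 : measurable_fun [set: (T * T) * T] (fun q => q.1.2).
  exact: (measurableT_comp measurable_snd measurable_fst).
have mc : measurable_fun [set: (T * T) * T] (fun q => cos (q.2 : R)).
  apply: (measurableT_comp _ measurable_snd).
  by apply: continuous_measurable_fun; exact: continuous_cos.
have ms : measurable_fun [set: (T * T) * T] (fun q => sin (q.2 : R)).
  apply: (measurableT_comp _ measurable_snd).
  by apply: continuous_measurable_fun; exact: continuous_sin.
apply: measurable_fun_pair.
- by apply: measurable_funB; exact: measurable_funM.
- by apply: measurable_funD; exact: measurable_funM.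
Qed.

(** Fubini for [h (rot t p)]: integrating first in [p] gives the integral of [h] for every [t], by
    rotation invariance; integrating first in [t] gives the circle integrals. *)
Lemma dint_circle h : dint_able alpha h ->
  (forall p, D p -> cont_on 0 (2 * pi) (fun t => h (rot t p))) ->
  dint_able alpha (fun p => itv_int 0 (2 * pi) (fun t => h (rot t p))) /\
  dint alpha (fun p => itv_int 0 (2 * pi) (fun t => h (rot t p))) = 2 * pi * dint alpha h.
Proof.
move=> /dint_able_dext iH ch; pose H := dext h.
have mH : measurable_fun [set: T * T] H := measurable_int _ iH.
pose I : set T := `[0, 2 * pi]%classic.
have pi0 : 0 <= 2 * pi :> R by rewrite mulr_ge0// pi_ge0.
have mI : measurable I by exact: measurable_itv.
have muI : mu I = (2 * pi)%:E.
  have := lebesgue_measure_itv `[(0 : R), 2 * pi]; rewrite /= lte_fin => ->.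
  by rewrite mulr_gt0 ?pi_gt0// -EFinB subr0.
have intI : (\int[mu]_t (\1_I t)%:E = (2 * pi)%:E)%E.
  by rewrite integral_indic// setIT; exact: muI.
pose G (q : (T * T) * T) : \bar R := (H (rot q.2 q.1) * (\1_I q.2)%:E)%E.
have mG : measurable_fun [set: (T * T) * T] G.
  apply: emeasurable_funM; first exact: measurableT_comp mH measurable_rot.
  apply/measurable_EFinP; apply: (measurableT_comp _ measurable_snd).
  exact: measurable_indic.
have intE (K : T * T -> \bar R) t : mu2.-integrable [set: T * T] K ->
    (\int[mu2]_p (K (rot t p) * (\1_I t)%:E) = (\int[mu2]_p K p) * (\1_I t)%:E)%E.
  move=> iK; have [i1 i2] := integrable_preserve (preserves_rot t) iK.
  by rewrite -i2 -integralZr.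
have iG : (\int[mu]_t \int[mu2]_p `|G (p, t)| < +oo)%E.
  rewrite (eq_integral (fun t => (\int[mu2]_p `|H p|) * (\1_I t)%:E)%E); last first.
    move=> t _; rewrite -(intE _ t (integrable_abse iH)).
    by apply: eq_integral => p _; rewrite /G abseM/= [`|(\1_I t)%R|]ger0_norm.
  have /integrableP[_ Hfin] := iH.
  rewrite ge0_integralZl//; last 2 first.
  - by apply/measurable_EFinP; exact: measurable_indic.
  - by apply: integral_ge0 => p _; exact: abse_ge0.
  have H0 : (0 <= \int[mu2]_p `|H p|)%E by apply: integral_ge0 => p _; exact: abse_ge0.
  rewrite intI; apply: lte_mul_pinfty => //; first by rewrite ge0_fin_numE.
  by rewrite ltry.
have {}iG := proj2 (@integrable21ltyP _ _ _ _ R plane_measure mu G mG) iG.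
pose m p := itv_int 0 (2 * pi) (fun t => h (rot t p)).
have FE p : fubini_F mu G p = dext m p.
  rewrite /fubini_F.
  have -> : (\int[mu]_t G (p, t) = \int[mu]_(t in I) H (rot t p))%E.
    rewrite [RHS]integral_mkcond; apply: eq_integral => t _.
    rewrite /G/= patchE indicE; case: ifP => _; first by rewrite mule1.
    by rewrite mule0.
  have [Dp|Dp] := pselect (D p); last first.
    rewrite [dext m p]/dext patchE ifF; last by apply/negbTE/negP => /set_mem.
    apply: integral0_eq => t _; rewrite /H dext_preserve; last exact: sqnorm_rot.
    by rewrite /dext patchE ifF//; apply/negbTE/negP => /set_mem.
  rewrite [dext m p]/dext patchE mem_set// mulrC EFinM.
  (* Continuity along the circle through [p] makes the inner integral finite, so nothing is lost
     under [fine]. *)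
  have ih := cont_on_integrable (ch p Dp).
  have -> : ((m p)%:E = \int[mu]_(t in I) (h (rot t p))%:E)%E.
    by rewrite /m /itv_int /Rintegral fineK//; exact: integrable_fin_num.
  rewrite -integralZl//; apply: eq_integral => t _.
  rewrite /H dext_preserve; last exact: sqnorm_rot.
  by rewrite /dext patchE mem_set//= EFinM muleC.
have FE' : fubini_F mu G = dext m by apply/funext => p; exact: FE.
have im : dint_able alpha m.
  by apply/dint_able_dext; rewrite -FE'; exact: (integrable_fubini_F iG).
split=> //.
have := Fubini iG.
rewrite -[X in X = _ -> _]/(\int[mu2]_p fubini_F mu G p)%E FE'.
rewrite (eq_integral (fun t => (\int[mu2]_p H p) * (\1_I t)%:E)%E); last first.
  by move=> t _; rewrite -(intE _ t iH).
have Hfin : (\int[mu2]_p H p \is a fin_num)%E by exact: integrable_fin_num.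
rewrite -(fineK Hfin) integralZl//; last first.
  apply/integrableP; split; first by apply/measurable_EFinP; exact: measurable_indic.
  rewrite (eq_integral (fun t => (\1_I t)%:E)); last first.
    by move=> t _; rewrite /= ger0_norm.
  by rewrite intI ltry.
rewrite intI => E.
rewrite /dint /Rintegral !(integral_mkcond D).
rewrite -[X in fine X = _]/(\int[mu2]_p dext m p)%E E -EFinM/= mulrC.
by [].
Qed.

Lemma Cintegral_circle f : cdint_able alpha f ->
  (forall z, normc z < 1 -> ccont (fun t => f (z * cis t))) ->
  cdint_able alpha (fun z => circ_int (fun t => f (z * cis t))) /\
  Cintegral_dA alpha (fun z => circ_int (fun t => f (z * cis t))) =
  (2 * pi)%:C * Cintegral_dA alpha f.
Proof.
move=> [fr fi] cf.
have cr p : D p -> cont_on 0 (2 * pi) (fun t => complex.Re (f (toC (rot t p)))).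
  rewrite /planar_disc/= /unit_disc/= (_ : 1 = 1%:C)// lt_normC => /cf[c1 _] t _.
  have -> : (fun t => complex.Re (f (toC (rot t p)))) =
      (fun t => complex.Re (f (toC p * cis t))) by apply/funext => s; rewrite toC_rot.
  exact: c1.
have ci p : D p -> cont_on 0 (2 * pi) (fun t => complex.Im (f (toC (rot t p)))).
  rewrite /planar_disc/= /unit_disc/= (_ : 1 = 1%:C)// lt_normC => /cf[_ c1] t _.
  have -> : (fun t => complex.Im (f (toC (rot t p)))) =
      (fun t => complex.Im (f (toC p * cis t))) by apply/funext => s; rewrite toC_rot.
  exact: c1.
have [ir er] := dint_circle fr cr; have [ii ei] := dint_circle fi ci.
have Er p : itv_int 0 (2 * pi) (fun t => complex.Re (f (toC (rot t p)))) =
    complex.Re (circ_int (fun t => f (toC p * cis t))).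
  by congr itv_int; apply/funext => t; rewrite toC_rot.
have Ei p : itv_int 0 (2 * pi) (fun t => complex.Im (f (toC (rot t p)))) =
    complex.Im (circ_int (fun t => f (toC p * cis t))).
  by congr itv_int; apply/funext => t; rewrite toC_rot.
split; first split.
- by apply: eq_dint_able ir => p _; exact: Er.
- by apply: eq_dint_able ii => p _; exact: Ei.
apply: ReIm_eq; rewrite ?(creZ, cimZ) !Cintegral_dint /=.
- by rewrite -er; apply: eq_dint => p _; rewrite Er.
- by rewrite -ei; apply: eq_dint => p _; rewrite Ei.
Qed.

End Invariance.

(** * The Bergman space *)

Section GammaFunction.
Context {R : realType}.
Local Notation mu := (@lebesgue_measure R).

(** Raise [t <= c * expR (t / c)] to the power [s]; the choice [c = 2 * (s + 1)] gives
    [s / c <= 1/2]. *)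
Lemma powR_le_expR (s t : R) : 0 <= s -> 0 < t ->
  t `^ s <= (2 * (s + 1)) `^ s * expR (t / 2).
Proof.
move=> s0 t0; pose c := 2 * (s + 1).
have c0 : 0 < c by rewrite mulr_gt0// ltr_pwDr.
have tc : t <= c * expR (t / c).
  rewrite mulrC -ler_pdivrMr//; apply: (le_trans _ (expR_ge1Dx _)).
  by rewrite lerDr.
apply: (@le_trans _ _ ((c * expR (t / c)) `^ s)).
  apply: ge0_ler_powR => //; rewrite nnegrE; first exact: ltW.
  by rewrite mulr_ge0 ?expR_ge0 ?(ltW c0).
rewrite powRM ?expR_ge0 ?(ltW c0)// -expRM ler_wpM2l ?powR_ge0// ler_expR.
rewrite mulrAC ler_pdivrMr// /c mulrA divfK ?pnatr_eq0//.
by rewrite ler_wpM2l ?(ltW t0)// lerDl.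
Qed.

Definition gamma_density (x t : R) : R := t `^ (x - 1) * expR (- t).

Lemma measurable_gamma_density x : measurable_fun [set: R] (gamma_density x).
Proof.
apply: measurable_funM => //.
apply: continuous_measurable_fun => t.
by apply: continuous_comp; [exact: opp_continuous|exact: continuous_expR].
Qed.

Lemma integrable_gamma_density x : 1 <= x ->
  mu.-integrable `]0, +oo[ (EFin \o gamma_density x).
Proof.
move=> x1; pose s := x - 1; have s0 : 0 <= s by rewrite subr_ge0.
(* The last factor 2 cancels the rate 1/2 in front of the dominating exponential density. *)
pose K : R := (2 * (s + 1)) `^ s * 2.
have h0 : 0 < 2^-1 :> R by rewrite invr_gt0.
have ig := integrable_exponential_pdf h0.
have ig0 : mu.-integrable `]0, +oo[ (EFin \o exponential_pdf (2^-1 : R)).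
  by apply: integrableS ig.
have iKg : mu.-integrable `]0, +oo[ (fun t => K%:E * (EFin \o exponential_pdf (2^-1 : R)) t)%E.
  exact: integrableZl.
apply: le_integrable iKg => //.
  by apply/measurable_EFinP/measurable_funTS; exact: measurable_gamma_density.
move=> t /=; rewrite in_itv/= andbT => t0.
change (`|gamma_density x t|%:E <= `|K * exponential_pdf 2^-1 t|%:E)%E; rewrite lee_fin.
rewrite exponential_pdfE ?(ltW t0)//.
have g0 : 0 <= gamma_density x t by rewrite mulr_ge0 ?powR_ge0 ?expR_ge0.
rewrite ger0_norm// (le_trans _ (ler_norm _))//.
have E : expR (- t) = expR (- 2^-1 * t) * expR (- (t / 2)).
  by rewrite -expRD; congr expR; field.
have := powR_le_expR s0 t0; rewrite -/s => le1.
rewrite /gamma_density -/s E /K.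
apply: (@le_trans _ _ ((2 * (s + 1)) `^ s * expR (t / 2) *
    (expR (- 2^-1 * t) * expR (- (t / 2))))).
  by rewrite ler_wpM2r// mulr_ge0 ?expR_ge0.
rewrite le_eqVlt; apply/orP; left; apply/eqP.
rewrite expRN; have := expR_gt0 (t / 2); move: (expR (t / 2)) => u u0.
by field; rewrite gt_eqF.
Qed.

(** On [[1, 2]] the density is at least [expR (- 2)]. Integrability matters too, since [fine] sends
    an infinite integral to 0. *)
Lemma Gamma_gt0 (x : R) : 1 <= x -> 0 < Gamma x.
Proof.
move=> x1; have ig := integrable_gamma_density x1.
apply: (@lt_le_trans _ _ (expR (- 2))); first exact: expR_gt0.
have sub : `[1, 2]%classic `<=` (`]0, +oo[%classic : set R).
  move=> t /=; rewrite !in_itv/= andbT => /andP[t1 _]; exact: lt_le_trans t1.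
have gd (t : R) : 0 <= gamma_density x t by rewrite mulr_ge0 ?powR_ge0 ?expR_ge0.
have mg := measurable_gamma_density x.
have H : ((expR (-2))%:E <= \int[mu]_(t in `]0%R, +oo[) (gamma_density x t)%:E)%E.
  apply: (@le_trans _ _ (\int[mu]_(t in `[1%R, 2%R]) (gamma_density x t)%:E)%E); last first.
    apply: ge0_subset_integral => //.
    - by apply/measurable_EFinP/measurable_funTS.
    - by move=> t _; rewrite lee_fin.
  apply: (@le_trans _ _ (\int[mu]_(t in `[1%R, 2%R]) (cst (expR (- 2))%:E) t)%E).
    rewrite integral_cst//.
    have := lebesgue_measure_itv `[(1 : R), 2]; rewrite /= lte_fin => ->.
    by rewrite ltr1n -EFinB -EFinM lee_fin; have := expR_ge0 (-2 : R); lra.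
  apply: ge0_le_integral => //.
  - by move=> t _; rewrite lee_fin expR_ge0.
  - by apply/measurable_EFinP/measurable_funTS.
  - move=> t /=; rewrite in_itv/= => /andP[t1 t2]; rewrite lee_fin.
    rewrite -[leLHS]mul1r; apply: ler_pM => //; rewrite ?expR_ge0//.
      rewrite -[leLHS](powRr0 t); apply: ler_powR => //.
      by rewrite subr_ge0.
    by rewrite ler_expR lerN2.
rewrite -lee_fin /Gamma /Rintegral fineK//.
exact: integrable_fin_num ig.
Qed.

Lemma gamma__gt0 (alpha : R) p : -1 < alpha -> 0 < gamma_ alpha p.
Proof.
move=> a1; rewrite /gamma_ sqrtr_gt0 divr_gt0 ?mulr_gt0//; apply: Gamma_gt0.
- by rewrite lerDr.
- by move: a1; lra.
- have : 0 <= p%:R :> R by []. by move: a1; lra.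
Qed.

End GammaFunction.

Section ComplexDifferentiability.
Context {R : realType}.
Local Notation C := R[i].
Local Notation normc := Normc.normc.
Implicit Types (z w : C) (F G : C -> C).

Lemma cdiff_derivable F z : cdiff F z -> derivable (F : C^o -> C^o) z 1.
Proof.
move=> [L HL]; apply/cvg_ex; exists L; apply/cvgrPdist_le => /= e' /posC[e e0 ->].
have [d d0 Hd] := HL e e0.
have d0' : 0 < d%:C :> C by rewrite ltcR.
apply/nbhs_ballP; exists d%:C => //= w; rewrite /ball/= sub0r normrN lt_normC => wd w0.
have nw : 0 < normc w by rewrite normc_gt0.
rewrite le_normC [_ *: 1]mulr1 [w + z]addrC.
have -> : L - w^-1 *: (F (z + w) - F z) = - (w^-1 * (F (z + w) - F z - L * w)).
  rewrite /GRing.scale/=; move: (F (z + w)) (F z) => a b.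
  by field.
by rewrite normcN normcM normcV mulrC ler_pdivrMr// Hd.
Qed.

Lemma cdiffD F G z : cdiff F z -> cdiff G z -> cdiff (fun w => F w + G w) z.
Proof.
move=> [L HL] [M HM]; exists (L + M) => e e0.
have e20 : 0 < e / 2 by rewrite divr_gt0.
have [d d0 Hd] := HL _ e20; have [d' d'0 Hd'] := HM _ e20.
exists (Num.min d d'); first by rewrite lt_min d0.
move=> w; rewrite lt_min => /andP[/Hd h1 /Hd' h2].
have -> : F (z + w) + G (z + w) - (F z + G z) - (L + M) * w =
  (F (z + w) - F z - L * w) + (G (z + w) - G z - M * w) by ring.
apply: (le_trans (le_normcD _ _)); apply: (le_trans (lerD h1 h2)).
by rewrite -mulrDl -splitr.
Qed.

(** The conjugate of a flipped analytic function is again analytic; this feeds the mean value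
    property for analytic symbols. *)
Lemma cdiff_reflect F z : cdiff F (conjc z) -> cdiff (fun w => conjc (F (conjc w))) z.
Proof.
move=> [L HL]; exists (conjc L) => e /HL[d d0 Hd]; exists d => // w wd.
have -> : conjc (F (conjc (z + w))) - conjc (F (conjc z)) - conjc L * w =
    conjc (F (conjc z + conjc w) - F (conjc z) - L * conjc w).
  by rewrite !conjcB conjcM conjcK conjcD.
by rewrite normc_conj -(normc_conj w); apply: Hd; rewrite normc_conj.
Qed.

Lemma unit_discP z : unit_disc z <-> normc z < 1.
Proof. by rewrite /unit_disc/= (_ : 1 = 1%:C)// lt_normC. Qed.

Lemma analytic_disc_diff F : analytic_on_disc F <-> disc_diff F.
Proof.
split=> dF z /unit_discP z1; last exact/cdiff_derivable/dF.
exact/derivable_cdiff/dF.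
Qed.

Lemma on_discE F z : normc z < 1 -> on_disc F z = F z.
Proof. by move=> z1; rewrite /on_disc (_ : 1 = 1%:C)// lt_normC z1. Qed.

Lemma on_disc_out F z : ~ unit_disc z -> on_disc F z = 0.
Proof. by rewrite /unit_disc /on_disc/=; case: ifP. Qed.

Lemma disc_diff_on_disc F : disc_diff F -> disc_diff (on_disc F).
Proof.
move=> dF z z1; apply: (@cdiff_near _ F _ _ (1 - normc z)); last exact: dF.
  by rewrite subr_gt0.
move=> w wz; rewrite on_discE//.
have -> : w = (w - z) + z by rewrite subrK.
by apply: (le_lt_trans (le_normcD _ _)); rewrite -ltrBrDr.
Qed.

End ComplexDifferentiability.

(** * Moments, completeness and the projection *)

Section Bergman.
Context {R : realType}.
Local Notation mu := (@lebesgue_measure R).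
Local Notation T := (measurableTypeR R).
Local Notation mu2 := (mu \x mu)%E.
Local Notation C := R[i].
Local Notation normc := Normc.normc.
Local Notation D := (@planar_disc R : set (T * T)).
Variable alpha : R.
Hypothesis alpha1 : -1 < alpha.
Implicit Types (f g h u v : C -> C) (z : C) (n j k : nat).

Lemma bergman_disc_diff v : bergman alpha v -> disc_diff v.
Proof. by move=> [_ /analytic_disc_diff]. Qed.

Lemma bergman_L2 v : bergman alpha v -> L2 alpha v.
Proof. by case. Qed.

Lemma bergman_lin (c : C) f g : bergman alpha f -> bergman alpha g ->
  bergman alpha (fun z => c * f z + g z).
Proof.
move=> [f0 /analytic_disc_diff df Lf] [g0 /analytic_disc_diff dg Lg]; split.
- by move=> z z1; rewrite f0// g0// mulr0 addr0.
- apply/analytic_disc_diff => z z1; apply: cdiffD; last exact: dg.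
  by apply: cdiffZ; exact: df.
- exact: L2_lin.
Qed.

Lemma L2_eq f g : (forall z, normc z < 1 -> f z = g z) -> L2 alpha f -> L2 alpha g.
Proof.
move=> fg /(L2P alpha1)[mf f2]; apply/(L2P alpha1); split; first exact: eq_dmeas mf.
by apply: eq_dint_able f2 => p /unit_discP /fg ->.
Qed.

Lemma dmeas_conj_id : dmeas (@conjc R).
Proof. by apply: dmeas_conj; exact: dmeas_id. Qed.

Lemma L2_monomial n j : L2 alpha (fun z => conjc z ^+ n * z ^+ j).
Proof.
apply: (@L2_bounded _ _ alpha1 _ 1).
  by apply: dmeasM; apply: dmeasX; [exact: dmeas_conj_id|exact: dmeas_id].
move=> z z1; rewrite normcM !normcX normc_conj.
by rewrite mulr_ile1 ?exprn_ge0 ?exprn_ile1 ?normc_ge0// ltW.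
Qed.

Lemma disc_diff_poly (c : nat -> C) n : disc_diff (fun z => \sum_(i < n) c i * z ^+ i).
Proof.
move=> z _; elim: n => [|n IH].
  have -> : (fun z : C => \sum_(i < 0) c i * z ^+ i) = (fun=> 0).
    by apply/funext => w; rewrite big_ord0.
  exact: cdiff_cst.
have -> : (fun z : C => \sum_(i < n.+1) c i * z ^+ i) =
    (fun w => \sum_(i < n) c i * w ^+ i + c n * w ^+ n).
  by apply/funext => w; rewrite big_ord_recr.
by apply: cdiffD => //; apply: cdiffZ; exact: cdiffX.
Qed.

Lemma bergman_monomial n : bergman alpha (on_disc (fun z => z ^+ n)).
Proof.
split; first by move=> z; exact: on_disc_out.
- by apply/analytic_disc_diff/disc_diff_on_disc => z _; exact: cdiffX.
- apply: L2_eq (L2_monomial 0 n) => z z1.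
  by rewrite on_discE// expr0 mul1r.
Qed.

Lemma basis_eE n : basis_e alpha n =
  (fun z => (gamma_ alpha n)%:C^-1 * on_disc (fun z => z ^+ n) z).
Proof.
apply/funext => z; rewrite /basis_e /on_disc.
by case: ifP => _; rewrite ?mulr0// mulrC.
Qed.

Lemma bergman0 : bergman alpha (fun=> 0).
Proof.
split=> [//||].
  by apply/analytic_disc_diff => z _; exact: cdiff_cst.
by apply: (@L2_bounded _ _ alpha1 _ 0) => [|z _]; [exact: dmeas_cst|rewrite normc0].
Qed.

Lemma bergmanZ (c : C) f : bergman alpha f -> bergman alpha (fun z => c * f z).
Proof.
move=> bf; have := bergman_lin c bf bergman0.
by congr (bergman _ _); apply/funext => z; rewrite addr0.
Qed.

Lemma bergman_basis n : bergman alpha (basis_e alpha n).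
Proof. by rewrite basis_eE; apply: bergmanZ; exact: bergman_monomial. Qed.

Lemma L2_flip f : L2 alpha f -> L2 alpha (flip f).
Proof.
move=> /(L2P alpha1)[[mr mi] f2]; apply/(L2P alpha1).
have sq (p : T * T) : sqnorm (p.1, - p.2 : T) = sqnorm p.
  by rewrite /sqnorm/= sqrrN.
have mphi := (@conj_preserves R).1.
have sub : (fun p : T * T => (p.1, - p.2) : T * T) @` D `<=` D.
  by move=> _ [p /planar_discE Dp <-]; apply/planar_discE; rewrite sq.
have mD := @measurable_disc R.
split; last by have [] := dint_preserve conj_preserves sq f2.
split.
- exact: (measurable_comp mD sub mr (measurable_funTS mphi)).
- exact: (measurable_comp mD sub mi (measurable_funTS mphi)).
Qed.

(** The squared norm of the n-th monomial, kept as an integral. *)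
Definition mass n : R := dint alpha (fun p => sqnorm p ^+ n).

(** The integrand is bounded below on the square [[1/4, 1/2] x [1/4, 1/2]], of area 1/16, where
    [sqnorm] lies between 1/8 and 1/2. *)
Lemma mass_gt0 n : 0 < mass n.
Proof.
pose Q : set (T * T) := `[(4^-1 : R), 2^-1]%classic `*` `[(4^-1 : R), 2^-1]%classic.
have mQ : measurable Q by exact: measurableX.
have Qb p : Q p -> 8^-1 <= sqnorm p <= 2^-1.
  move=> [/=]; rewrite !in_itv/= => /andP[x1 x2] /andP[y1 y2].
  rewrite /sqnorm; move: (p.1 : R) (p.2 : R) x1 x2 y1 y2 => x y *.
  by apply/andP; split; nra.
have QD : Q `<=` D.
  move=> p /Qb /andP[_ p2]; apply/planar_discE; apply: (le_lt_trans p2).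
  by rewrite invf_lt1// ltr1n.
(* A base in []0, 1]] has a smaller power at the larger exponent [b], and with [b >= 0] the power is
   monotone in the base; so both signs of [alpha] are treated together. *)
pose b := Num.max alpha 0.
pose c : R := 8^-1 ^+ n * ((1 + alpha) / pi * 2^-1 `^ b).
have c0 : 0 < c.
  rewrite !mulr_gt0 ?exprn_gt0 ?invr_gt0 ?pi_gt0 ?powR_gt0//; move: alpha1; lra.
have ib : dint_able alpha (fun p => sqnorm p ^+ n).
  apply: dint_able_dom (dint_able_cst alpha1 1) _.
    by apply: measurable_funTS; apply: measurable_funX; exact: measurable_sqnorm.
  move=> p /planar_discE p1; have p0 : 0 <= sqnorm p by rewrite addr_ge0 ?sqr_ge0.
  by rewrite ger0_norm ?exprn_ge0// exprn_ile1// ltW.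
have s0 (p : T * T) : 0 <= sqnorm p by rewrite addr_ge0 ?sqr_ge0.
have H : (c%:E * (16^-1)%:E <= \int[mu2]_(p in D) (sqnorm p ^+ n * wgt alpha p)%:E)%E.
  apply: (@le_trans _ _ (\int[mu2]_(p in Q) (sqnorm p ^+ n * wgt alpha p)%:E)%E); last first.
    apply: ge0_subset_integral => //.
    - exact: measurable_disc.
    - exact: (measurable_int _ ib).
    - by move=> p _; rewrite lee_fin mulr_ge0 ?exprn_ge0 ?s0 ?(wgt_ge0 alpha1).
  apply: (@le_trans _ _ (\int[mu2]_(p in Q) (cst c%:E) p)%E).
    rewrite integral_cst//; apply: lee_wpmul2l; first by rewrite lee_fin ltW.
    rewrite [leRHS]product_measure1E//.
    have := lebesgue_measure_itv `[(4^-1 : R), 2^-1]; rewrite /= lte_fin => ->.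
    have -> : 4^-1 < 2^-1 :> R by lra.
    by rewrite -EFinB -EFinM lee_fin; lra.
  apply: ge0_le_integral => //.
  - by move=> p _; rewrite lee_fin ltW.
  - by apply: measurable_funS QD (measurable_int _ ib); exact: measurable_disc.
  - move=> p Qp; have /andP[p1 p2] := Qb p Qp; rewrite lee_fin wgtE.
    apply: ler_pM.
    + by rewrite exprn_ge0// invr_ge0.
    + rewrite mulr_ge0 ?powR_ge0// divr_ge0 ?pi_ge0//; move: alpha1; lra.
    + by rewrite lerXn2r ?nnegrE ?s0 ?invr_ge0.
    rewrite ler_wpM2l//.
      by rewrite divr_ge0 ?pi_ge0//; move: alpha1; lra.
    have h1 : 0 < 1 - sqnorm p <= 1 by have := s0 p; move: p2; lra.
    apply: (@le_trans _ _ ((1 - sqnorm p) `^ b)); last first.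
      by apply: (ger_powR h1); rewrite le_max lexx.
    apply: ge0_ler_powR; rewrite ?nnegrE ?le_max ?lexx ?orbT ?invr_ge0//.
    + by case/andP: h1 => /ltW.
    + by move: p2; lra.
rewrite -lte_fin /mass /dint /Rintegral fineK; last first.
  exact: (integrable_fin_num (@measurable_disc R) ib).
by apply: lt_le_trans H; rewrite -EFinM lte_fin mulr_gt0// invr_gt0.
Qed.

Lemma monomial_mass n :
  Cintegral_dA alpha (fun z => conjc z ^+ n * z ^+ n) = (mass n)%:C.
Proof.
have E p : conjc (toC p) ^+ n * toC p ^+ n = (sqnorm p ^+ n : R)%:C :> C.
  rewrite -exprMn rmorphXn/=; congr (_ ^+ _).
  by apply: ReIm_eq; rewrite ?(creM, cimM) /sqnorm/=; ring.
rewrite Cintegral_dint; apply: ReIm_eq => /=.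
  by apply: eq_dint => p _; rewrite E.
transitivity (dint alpha (fun=> 0 * 0)).
  by apply: eq_dint => p _; rewrite E /= mul0r.
by rewrite dintZ ?mul0r//; exact: dint_able_cst.
Qed.

Lemma cdint_able_monomial n j v : L2 alpha v ->
  cdint_able alpha (fun z => conjc z ^+ n * z ^+ j * v z).
Proof.
move=> Lv.
have Lw : L2 alpha (fun z => conjc z ^+ j * z ^+ n) by exact: L2_monomial.
have := L2_cdint_able alpha1 Lv Lw; congr cdint_able; apply/funext => z.
by rewrite conjcM !conjcX conjcK mulrC [z ^+ j * _]mulrC.
Qed.

(** Averaging over rotations leaves, under the disc integral, a Fourier coefficient of [v] on each
    circle. *)
Lemma Cintegral_circle_monomial n j v : disc_diff v -> L2 alpha v ->
  (2 * pi)%:C * Cintegral_dA alpha (fun z => conjc z ^+ n * z ^+ j * v z) =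
  Cintegral_dA alpha (fun z => conjc z ^+ n * z ^+ j *
    circ_int (fun t => conjc (cis t) ^+ n * cis t ^+ j * v (z * cis t))).
Proof.
move=> dv Lv; have ccis : ccont (@cis R) := ccont_cis.
have cvz z : normc z < 1 ->
    ccont (fun t => conjc (cis t) ^+ n * cis t ^+ j * v (z * cis t)).
  move=> z1; apply: ccontM; last exact: ccont_disc.
  by apply: ccontM; apply: ccontX => //; exact: ccont_conj.
have E z t : conjc (z * cis t) ^+ n * (z * cis t) ^+ j * v (z * cis t) =
    conjc z ^+ n * z ^+ j * (conjc (cis t) ^+ n * cis t ^+ j * v (z * cis t)).
  rewrite conjcM !exprMn; move: (v (z * cis t)) (conjc (cis t)) (conjc z) (cis t) => a b c d.
  by ring.
have [] := Cintegral_circle (cdint_able_monomial n j Lv).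
  move=> z z1; under [fun t => _]eq_fun do rewrite E.
  by apply: ccontM; [exact: ccont_cst|exact: cvz].
move=> _ <-; apply: eq_Cintegral => z z1.
by rewrite -circ_intZ; [congr circ_int; apply/funext => t; exact: E|exact: cvz].
Qed.

(** On each circle the monomial has the positive frequency [j - n], against which an analytic
    function has mean 0. *)
Lemma monomial_moment_lt n j v : (n < j)%N -> disc_diff v -> L2 alpha v ->
  Cintegral_dA alpha (fun z => conjc z ^+ n * z ^+ j * v z) = 0.
Proof.
move=> nj dv Lv; have := Cintegral_circle_monomial n j dv Lv.
(* The zero integrand is written [0 * 0] so that [CintegralZ] can extract a factor 0. *)
rewrite [X in _ = X -> _](@eq_Cintegral _ _ _ (fun=> 0 * 0)); last first.
  move=> z z1; suff -> : circ_int (fun t => conjc (cis t) ^+ n * cis t ^+ j *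
      v (z * cis t)) = 0 by rewrite mulr0 mul0r.
  have := circ_int_mean (j - n) dv z1; rewrite -subn_gt0 in nj.
  have -> : (fun t => conjc (cis t) ^+ n * cis t ^+ j * v (z * cis t)) =
     (fun t => cis t ^+ (j - n) * v (z * cis t)).
    apply/funext => t; congr (_ * _); rewrite -(subnK (ltnW _ : n <= j)%N); last first.
      by rewrite -subn_gt0.
    rewrite addnK exprD mulrCA -exprMn [conjc _ * _]mulrC cis_conj expr1n mulr1//.
  by move=> ->; case: (j - n)%N nj.
rewrite (@CintegralZ _ _ 0 (fun=> 0)); last first.
  by split; exact: dint_able_cst.
rewrite mul0r => /eqP; rewrite mulf_eq0 => /orP[|/eqP//].
move=> /eqP E; have : normc (2 * pi)%:C = 0 :> R by rewrite E normc0.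
by rewrite normc_real => /eqP; rewrite normr_eq0 mulf_eq0 pnatr_eq0/= gt_eqF ?pi_gt0.
Qed.

(** Here the frequency is [- k]: the circle integral is [c * z ^+ k], and the powers left over
    combine to [sqnorm ^+ (k + j)]. *)
Lemma monomial_moment_taylor k j v (c : C) : disc_diff v -> L2 alpha v ->
  (forall z, normc z < 1 -> taylor_int v k z = c * z ^+ k) ->
  (2 * pi)%:C * Cintegral_dA alpha (fun z => conjc z ^+ (k + j) * z ^+ j * v z) =
  c * (mass (k + j))%:C.
Proof.
move=> dv Lv cv; rewrite Cintegral_circle_monomial// -monomial_mass -CintegralZ//; last first.
  have L := L2_monomial (k + j) 0; have L' := L2_monomial (k + j) 0.
  have := L2_cdint_able alpha1 L L'; congr cdint_able; apply/funext => z.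
  by rewrite !expr0 !mulr1 conjcX conjcK.
apply: eq_Cintegral => z z1.
have -> : (fun t => conjc (cis t) ^+ (k + j) * cis t ^+ j * v (z * cis t)) =
    (fun t => conjc (cis t) ^+ k * v (z * cis t)).
  apply/funext => t; congr (_ * _).
  by rewrite exprD -mulrA -exprMn [conjc _ * _]mulrC cis_conj expr1n mulr1.
rewrite -/(taylor_int v k z) cv// [z ^+ (k + j)]exprD.
by move: (conjc z ^+ (k + j)) => y; ring.
Qed.

Lemma inner_monomial n v : disc_diff v -> L2 alpha v ->
  inner alpha v (on_disc (fun z => z ^+ n)) =
  Cintegral_dA alpha (fun z => conjc z ^+ n * z ^+ 0 * v z).
Proof.
move=> dv Lv; apply: eq_Cintegral => z z1.
by rewrite on_discE// conjcX expr0 mulr1 mulrC.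
Qed.

Lemma L2_on_monomial n : L2 alpha (on_disc (fun z => z ^+ n)).
Proof. exact/bergman_L2/bergman_monomial. Qed.

(** By [monomial_moment_taylor] with [j = 0], the moment against the k-th monomial is the k-th
    Taylor coefficient times a positive number. *)
Lemma bergman_orth_eq0 u : bergman alpha u ->
  (forall n, inner alpha u (on_disc (fun z => z ^+ n)) = 0) -> u = fun=> 0.
Proof.
move=> bu ou; have du := bergman_disc_diff bu; have Lu := bergman_L2 bu.
apply/funext => z; have [z1|z1] := pselect (unit_disc z); last by case: bu => + _ _; exact.
move/unit_discP : z1 => z1; apply: (taylor_int_eq0 du z1) => k.
have [c cE] := taylor_coef k du.
have := monomial_moment_taylor 0 du Lu cE.
rewrite addn0 -inner_monomial// ou mulr0 => /esym/eqP.
rewrite mulf_eq0 => /orP[/eqP c0|/eqP E]; first by rewrite cE// c0 mul0r.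
have : normc (mass k)%:C = 0 :> R by rewrite E normc0.
by rewrite normc_real => /eqP; rewrite normr_eq0 gt_eqF// mass_gt0.
Qed.

Lemma is_bergman_projP h u : L2 alpha h -> is_bergman_proj alpha h u <->
  bergman alpha u /\ forall v, bergman alpha v -> inner alpha h v = inner alpha u v.
Proof.
move=> Lh; have E v : bergman alpha u -> bergman alpha v ->
    inner alpha (fun z => h z - u z) v = inner alpha h v - inner alpha u v.
  move=> /bergman_L2 Lu /bergman_L2 Lv.
  have := inner_lin alpha1 (-1) Lu Lh Lv; rewrite mulN1r addrC => <-.
  by congr (inner _ _ v); apply/funext => z; rewrite mulN1r addrC.
split=> -[bu ou]; split=> // v bv; have := ou v bv; rewrite E//.
  by move/eqP; rewrite subr_eq0 => /eqP.
by move=> ->; rewrite subrr.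
Qed.

(** Two candidates have the same inner products with all monomials, so completeness identifies them;
    the value chosen by [xget] is therefore any explicit candidate. *)
Lemma bergman_projE h u : L2 alpha h -> is_bergman_proj alpha h u ->
  bergman_proj alpha h = u.
Proof.
move=> Lh Pu; rewrite /bergman_proj.
have : is_bergman_proj alpha h (xget (fun=> 0) [set u | is_bergman_proj alpha h u]).
  by apply: (@xgetPex _ (fun=> 0) [set u | is_bergman_proj alpha h u]); exists u.
move: (xget _ _) => w /(is_bergman_projP _ Lh)[bw ow].
have [bu ou] := (is_bergman_projP u Lh).1 Pu.
have bwu : bergman alpha (fun z => (-1) * u z + w z) by exact: bergman_lin.
have E : (fun z => (-1) * u z + w z) = fun=> 0.
  apply: bergman_orth_eq0 => // n; have bn := bergman_monomial n.
  rewrite (inner_lin alpha1 (-1) (bergman_L2 bu) (bergman_L2 bw) (bergman_L2 bn)).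
  by rewrite -ow// -ou// mulN1r addNr.
by apply/funext => z; have := congr1 (fun f => f z) E => /= /eqP;
  rewrite mulN1r addrC subr_eq0 => /eqP.
Qed.

Lemma is_bergman_proj_lin (c : C) h1 h2 u1 u2 : L2 alpha h1 -> L2 alpha h2 ->
  is_bergman_proj alpha h1 u1 -> is_bergman_proj alpha h2 u2 ->
  is_bergman_proj alpha (fun z => c * h1 z + h2 z) (fun z => c * u1 z + u2 z).
Proof.
move=> L1 L2' /(is_bergman_projP _ L1)[b1 o1] /(is_bergman_projP _ L2')[b2 o2].
apply/(is_bergman_projP _ (L2_lin alpha1 c L1 L2')).
split=> [|v bv]; first exact: bergman_lin.
have [Lu1 Lu2 Lv] := And3 (bergman_L2 b1) (bergman_L2 b2) (bergman_L2 bv).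
by rewrite (inner_lin alpha1 c L1 L2' Lv) (inner_lin alpha1 c Lu1 Lu2 Lv) o1// o2.
Qed.

Lemma eq_is_bergman_proj h1 h2 u : (forall z, normc z < 1 -> h1 z = h2 z) ->
  is_bergman_proj alpha h1 u -> is_bergman_proj alpha h2 u.
Proof.
move=> h12 [bu ou]; split=> // v bv; rewrite -[RHS](ou v bv).
by apply: eq_Cintegral => z z1; rewrite h12.
Qed.

(** Tested against [v], both sides are multiples of the Taylor coefficient of [v] of index [n - j],
    with weights [mass n] and [mass (n - j)]. For [n < j] the truncated exponent is 0 and the
    coefficient 0 kills the term. *)
Lemma bergman_proj_monomial n j :
  is_bergman_proj alpha (fun z => conjc z ^+ j * z ^+ n)
    (fun z => (if (j <= n)%N then mass n / mass (n - j) else 0)%:C *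
       on_disc (fun z => z ^+ (n - j)) z).
Proof.
have Lm := L2_monomial j n.
apply/(is_bergman_projP _ Lm); split=> [|v bv]; first exact/bergmanZ/bergman_monomial.
have dv := bergman_disc_diff bv; have Lv := bergman_L2 bv.
set r : R := if _ then _ else _.
have Lo := L2_on_monomial (n - j).
have -> : inner alpha (fun z => r%:C * on_disc (fun z => z ^+ (n - j)) z) v =
    r%:C * inner alpha (on_disc (fun z => z ^+ (n - j))) v.
  rewrite /inner -CintegralZ; last exact: (L2_cdint_able alpha1 Lo Lv).
  by congr Cintegral_dA; apply/funext => z; rewrite mulrA.
rewrite [in RHS]inner_sym// inner_monomial//.
have -> : inner alpha (fun z => conjc z ^+ j * z ^+ n) v =
    conjc (Cintegral_dA alpha (fun z => conjc z ^+ n * z ^+ j * v z)).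
  rewrite -Cintegral_conj; last exact: cdint_able_monomial.
  congr Cintegral_dA; apply/funext => z.
  by rewrite !conjcM !conjcX conjcK [z ^+ n * _]mulrC.
rewrite /r; case: leqP => jn; last by rewrite monomial_moment_lt// conjc0 mul0r.
have [c cE] := taylor_coef (n - j) dv.
have := monomial_moment_taylor j dv Lv cE; rewrite subnK// => E1.
have := monomial_moment_taylor 0 dv Lv cE; rewrite addn0 => E2.
have p0 : (2 * pi)%:C != 0 :> C.
  by rewrite -normc_gt0 normc_real normr_gt0 mulf_neq0 ?gt_eqF ?pi_gt0.
have m0 : (mass (n - j))%:C != 0 :> C.
  by rewrite -normc_gt0 normc_real normr_gt0 gt_eqF ?mass_gt0.
have -> : Cintegral_dA alpha (fun z => conjc z ^+ n * z ^+ j * v z) =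
    (mass n / mass (n - j))%:C *
    Cintegral_dA alpha (fun z => conjc z ^+ (n - j) * z ^+ 0 * v z).
  apply: (mulfI p0); rewrite E1 mulrCA E2 mulrCA -rmorphM/= divfK//.
  by rewrite gt_eqF// mass_gt0.
by rewrite conjcM conjc_real.
Qed.

End Bergman.

(** * The slant little Hankel operator *)

Section SlantHankel.
Context {R : realType}.
Local Notation C := R[i].
Local Notation normc := Normc.normc.
Variable alpha : R.
Hypothesis alpha1 : -1 < alpha.
Implicit Types (f g h u v : C -> C) (z : C) (n j : nat).

Definition monom n : C -> C := on_disc (fun z => z ^+ n).

Lemma bergman_monom n : bergman alpha (monom n).
Proof. exact: bergman_monomial. Qed.

Lemma gammaC_neq0 n : (gamma_ alpha n)%:C != 0 :> C.
Proof. by rewrite -normc_gt0 normc_real normr_gt0 gt_eqF// gamma__gt0. Qed.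

Lemma monomE n : monom n = (fun z => (gamma_ alpha n)%:C * basis_e alpha n z).
Proof.
by apply/funext => z; rewrite basis_eE mulrA divff ?mul1r// gammaC_neq0.
Qed.

Lemma innerZ (c : C) f v : L2 alpha f -> L2 alpha v ->
  inner alpha (fun z => c * f z) v = c * inner alpha f v.
Proof.
move=> Lf Lv; rewrite /inner -CintegralZ; last exact: L2_cdint_able.
by congr (Cintegral_dA _ _); apply/funext => z; rewrite mulrA.
Qed.

Lemma inner0l v : L2 alpha v -> inner alpha (fun=> 0) v = 0.
Proof.
move=> Lv; have E : (fun _ : C => 0 : C) = (fun z => 0 * v z).
  by apply/funext => z; rewrite mul0r.
by rewrite E innerZ// mul0r.
Qed.

(** Averaging over rotations replaces [v] by its mean on each circle, which is [v 0]. *)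
Lemma mean_value v : disc_diff v -> cdint_able alpha v ->
  Cintegral_dA alpha v = v 0 * (mass alpha 0)%:C.
Proof.
move=> dv iv; have cv z : normc z < 1 -> ccont (fun t => v (z * cis t)).
  by move=> z1; exact: ccont_disc.
have [_] := Cintegral_circle iv cv.
rewrite (@eq_Cintegral _ _ _ (fun z => ((2 * pi)%:C * v 0) *
    (conjc z ^+ 0 * z ^+ 0))); last first.
  move=> z z1; have := circ_int_mean 0 dv z1; rewrite !expr0 !mulr1 => <-.
  by congr circ_int; apply/funext => t; rewrite mul1r.
have i1 : cdint_able alpha (fun z : C => conjc z ^+ 0 * z ^+ 0).
  have := @cdint_able_monomial _ _ alpha1 0 0 _ (L2_monomial alpha1 0 0).
  by congr cdint_able; apply/funext => z; rewrite !expr0 !mulr1.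
rewrite CintegralZ// monomial_mass// => E.
have p0 : (2 * pi)%:C != 0 :> C.
  by rewrite -normc_gt0 normc_real normr_gt0 mulf_neq0 ?gt_eqF ?pi_gt0.
by apply: (mulfI p0); rewrite -E mulrA.
Qed.

Lemma inner_monom0 v : disc_diff v -> L2 alpha v ->
  inner alpha v (monom 0) = v 0 * (mass alpha 0)%:C.
Proof.
move=> dv Lv; rewrite -mean_value//.
  by apply: eq_Cintegral => z z1; rewrite /monom on_discE// expr0 conjc1 mulr1.
have := L2_cdint_able alpha1 Lv (L2_monomial alpha1 0 0).
by congr cdint_able; apply/funext => z; rewrite !expr0 mulr1 conjc1 mulr1.
Qed.

Lemma inner_monom_neq i l : i != l -> inner alpha (monom i) (monom l) = 0.
Proof.
have lt a b : (b < a)%N -> inner alpha (monom a) (monom b) = 0.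
  move=> ba; have bm := bergman_monom a.
  rewrite inner_monomial; [|exact: bergman_disc_diff bm|exact: bergman_L2 bm].
  have d1 : disc_diff (fun _ : C => 1 : C) by move=> z _; exact: cdiff_cst.
  have L1 : L2 alpha (fun _ : C => 1 : C).
    by apply: (L2_eq alpha1) (L2_monomial alpha1 0 0) => z _; rewrite !expr0 mulr1.
  rewrite -[RHS](monomial_moment_lt alpha1 ba d1 L1).
  by apply: eq_Cintegral => z z1; rewrite /monom on_discE// expr0 !mulr1.
move=> il; have [il'|il'|E] := ltngtP i l; [|exact: lt|by rewrite E eqxx in il].
rewrite inner_sym ?lt ?conjc0//; exact/bergman_L2/bergman_monom.
Qed.

Section FiniteSums.
Variables (I : Type) (c : I -> C).

Lemma linear_functional_sum (L : (C -> C) -> C) (F : I -> C -> C) (s : seq I) :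
  (forall (k : C) f g, bergman alpha f -> bergman alpha g ->
    L (fun z => k * f z + g z) = k * L f + L g) ->
  L (fun=> 0) = 0 -> (forall i, bergman alpha (F i)) ->
  bergman alpha (fun z => \sum_(i <- s) c i * F i z) /\
  L (fun z => \sum_(i <- s) c i * F i z) = \sum_(i <- s) c i * L (F i).
Proof.
move=> Llin L0 bF; elim: s => [|i s [bs IH]].
  have -> : (fun z => \sum_(i <- [::]) c i * F i z) = fun=> 0.
    by apply/funext => z; rewrite big_nil.
  by rewrite big_nil; split=> //; exact: bergman0.
have -> : (fun z => \sum_(i <- i :: s) c i * F i z) =
    (fun z => c i * F i z + \sum_(i <- s) c i * F i z).
  by apply/funext => z; rewrite big_cons.
by split; [exact: bergman_lin|rewrite Llin// IH big_cons].
Qed.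

Lemma is_bergman_proj_sum (H U : I -> C -> C) (s : seq I) :
  (forall i, L2 alpha (H i)) -> (forall i, is_bergman_proj alpha (H i) (U i)) ->
  L2 alpha (fun z => \sum_(i <- s) c i * H i z) /\
  is_bergman_proj alpha (fun z => \sum_(i <- s) c i * H i z)
    (fun z => \sum_(i <- s) c i * U i z).
Proof.
move=> LH PU; elim: s => [|i s [Ls Ps]].
  have E (G : I -> C -> C) : (fun z => \sum_(i <- [::]) c i * G i z) = fun=> 0.
    by apply/funext => z; rewrite big_nil.
  rewrite !E; have b0 := bergman0 alpha1; split; first exact: bergman_L2.
  by apply/(is_bergman_projP alpha1) => //; exact: bergman_L2.
have E (G : I -> C -> C) : (fun z => \sum_(i <- i :: s) c i * G i z) =
    (fun z => c i * G i z + \sum_(i <- s) c i * G i z).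
  by apply/funext => z; rewrite big_cons.
by rewrite !E; split; [exact: L2_lin|exact: is_bergman_proj_lin].
Qed.

End FiniteSums.

Definition proj_coef n j : R :=
  if (j <= n)%N then mass alpha n / mass alpha (n - j) else 0.

Section Symbol.
Variables (a : int -> C) (N m : nat).
Local Notation phi := (symbol_phi alpha a N m).

Definition hankel_coef n j : C :=
  conjc (a (- n%:Z)) / ((gamma_ alpha n)%:C * (gamma_ alpha j)%:C).

Definition toeplitz_coef n j : C :=
  a n%:Z / ((gamma_ alpha n)%:C * (gamma_ alpha j)%:C).

Lemma conjc_sum (I : Type) (s : seq I) (F : I -> C) :
  conjc (\sum_(i <- s) F i) = \sum_(i <- s) conjc (F i).
Proof. exact: rmorph_sum. Qed.

(** The flip makes the part from g analytic, with conjugated coefficients, while f and the basis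
    vector become polynomials in [conjc z]. The factor 1 matches the shape of
    [is_bergman_proj_lin]. *)
Lemma flip_symbol_basis j z : normc z < 1 ->
  flip (mult_by phi (basis_e alpha j)) z =
  1 * (\sum_(n <- index_iota 1 m.+1) hankel_coef n j * (conjc z ^+ j * z ^+ n)) +
  \sum_(n <- index_iota 0 N.+1) toeplitz_coef n j * (conjc z ^+ (n + j) * z ^+ 0).
Proof.
move=> z1; rewrite /flip /mult_by /symbol_phi /symbol_g /symbol_f conjc_sum mul1r.
have E (b p q x y : C) : b * (x / p) * (q^-1 * y) = b / (p * q) * (y * x).
  by rewrite invfM -!mulrA; congr (_ * _); rewrite mulrC -!mulrA.
rewrite basis_eE on_discE ?normc_conj// mulrDl !mulr_suml; congr (_ + _).
  by apply: eq_bigr => n _; rewrite !conjcM conjcX conjcV conjcK conjc_real; exact: E.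
apply: eq_bigr => n _; rewrite exprD expr0 mulr1 [X in _ = _ * X]mulrC; exact: E.
Qed.

(** In the second sum [proj_coef 0 (n + j)] vanishes unless [n = j = 0], so f contributes a constant
    at most. *)
Lemma little_hankel_basis j :
  little_hankel alpha phi (basis_e alpha j) = fun z =>
  1 * (\sum_(n <- index_iota 1 m.+1)
    hankel_coef n j * ((proj_coef n j)%:C * monom (n - j) z)) +
  \sum_(n <- index_iota 0 N.+1)
    toeplitz_coef n j * ((proj_coef 0 (n + j))%:C * monom (0 - (n + j)) z).
Proof.
have [L1 P1] := @is_bergman_proj_sum _ (hankel_coef ^~ j)
  (fun n z => conjc z ^+ j * z ^+ n) _ (index_iota 1 m.+1)
  (fun n => L2_monomial alpha1 j n) (fun n => bergman_proj_monomial alpha1 n j).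
have [L2' P2] := @is_bergman_proj_sum _ (toeplitz_coef ^~ j)
  (fun n z => conjc z ^+ (n + j) * z ^+ 0) _ (index_iota 0 N.+1)
  (fun n => L2_monomial alpha1 (n + j) 0)
  (fun n => bergman_proj_monomial alpha1 0 (n + j)).
have P := is_bergman_proj_lin alpha1 1 L1 L2' P1 P2.
apply: bergman_projE => //.
  apply: (L2_eq alpha1) (L2_lin alpha1 1 L1 L2') => z z1.
  by rewrite flip_symbol_basis.
by apply: eq_is_bergman_proj P => z z1; rewrite flip_symbol_basis.
Qed.

End Symbol.

Section SlantOperator.
Variables (k : nat) (W : (C -> C) -> C -> C).
Hypotheses (k2 : (2 <= k)%N) (hW : is_W alpha k W).

Lemma operator0 T : is_bounded_operator alpha T -> T (fun=> 0) = fun=> 0.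
Proof.
move=> [_ Tlin _]; have b0 := bergman0 alpha1.
have := Tlin 1 _ _ b0 b0.
have -> : (fun z : C => 1 * 0 + 0 : C) = fun=> 0 by apply/funext => z; rewrite mulr0 addr0.
move=> E; apply/funext => z; have := congr1 (fun f => f z) E.
by move/eqP; rewrite mul1r addrC -subr_eq subrr eq_sym => /eqP.
Qed.

Lemma operatorZ T (c : C) f : is_bounded_operator alpha T -> bergman alpha f ->
  T (fun z => c * f z) = fun z => c * T f z.
Proof.
move=> bT bf; have T0 := operator0 bT; have [_ Tlin _] := bT.
have := Tlin c _ _ bf (bergman0 alpha1); rewrite T0.
have E g : (fun z : C => c * g z + 0 : C) = fun z => c * g z.
  by apply/funext => z; rewrite addr0.
by rewrite !E.
Qed.

Lemma slant_monom n : W (monom n) =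
  if (k %| n)%N then fun z => ((gamma_ alpha n) / (gamma_ alpha (n %/ k)))%:C * monom (n %/ k) z
  else fun=> 0.
Proof.
have [bW We] := hW; rewrite monomE operatorZ//; last exact: bergman_basis.
rewrite We; case: ifP => _; last by apply/funext => z; rewrite mulr0.
apply/funext => z; rewrite monomE fmorph_div mulrA divfK//.
exact: gammaC_neq0.
Qed.

Lemma slant_monom0 : W (monom 0) = monom 0.
Proof.
rewrite slant_monom dvdn0 div0n; apply/funext => z.
by rewrite divff ?mul1r// gt_eqF// gamma__gt0.
Qed.

(** Because [k >= 2] and [M > 0], the degree [i %/ k] is strictly below [M], and distinct monomials
    are orthogonal. *)
Lemma inner_slant_monom i M : (0 < M)%N -> (i <= M)%N ->
  inner alpha (W (monom i)) (monom M) = 0.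
Proof.
move=> M0 iM; have LM := bergman_L2 (bergman_monom M).
rewrite slant_monom; case: ifP => _.
  rewrite innerZ//; last exact/bergman_L2/bergman_monom.
  rewrite inner_monom_neq ?mulr0// ltn_eqF// ltn_divLR; last exact: ltnW.
  by rewrite (leq_ltn_trans iM)// ltn_Pmulr.
exact: inner0l.
Qed.

End SlantOperator.

End SlantHankel.

(** * Normality forces the coefficients of g to vanish *)

Section NormalImplies.
Context {R : realType}.
Local Notation C := R[i].
Local Notation normc := Normc.normc.
Variable alpha : R.
Hypothesis alpha1 : -1 < alpha.
Variables (k : nat) (W : (C -> C) -> C -> C).
Hypotheses (k2 : (2 <= k)%N) (hW : is_W alpha k W).
Variables (a : int -> C) (N m M : nat).
Hypotheses (M1m : (1 <= M <= m)%N) (aM : forall n, (M < n <= m)%N -> a (- n%:Z) = 0).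
Local Notation phi := (symbol_phi alpha a N m).
Local Notation S := (slant_little_hankel alpha W phi).

Let M0 : (0 < M)%N. Proof. by case/andP: M1m. Qed.

Lemma hankel_coef_gt n j : (M < n <= m)%N -> hankel_coef alpha a n j = 0.
Proof. by move=> /aM E; rewrite /hankel_coef E conjc0 mul0r. Qed.

(** Terms with [n < M] die in the projection, those with [n > M] by the choice of [M], and those
    from f because [n + M > 0]; the constant left is fixed by [W]. *)
Lemma slant_top : S (basis_e alpha M) =
  fun z => hankel_coef alpha a M M * (proj_coef alpha M M)%:C * monom 0 z.
Proof.
rewrite /slant_little_hankel little_hankel_basis//.
pose c := hankel_coef alpha a M M * (proj_coef alpha M M)%:C.
have -> : (fun z => 1 * (\sum_(n <- index_iota 1 m.+1)
    hankel_coef alpha a n M * ((proj_coef alpha n M)%:C * monom (n - M) z)) +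
  \sum_(n <- index_iota 0 N.+1)
    toeplitz_coef alpha a n M * ((proj_coef alpha 0 (n + M))%:C * monom (0 - (n + M)) z)) =
  fun z => c * monom 0 z.
  apply/funext => z; rewrite [X in _ + X]big1 ?addr0 ?mul1r; last first.
    move=> n _; rewrite /proj_coef leqn0 addn_eq0 andbC -[M == 0]negbK -lt0n M0/=.
    by rewrite mul0r mulr0.
  rewrite (bigD1_seq M) ?iota_uniq ?mem_index_iota//= subnn.
  rewrite [X in _ + X]big_seq_cond [X in _ + X]big1; first by rewrite addr0; exact: mulrA.
  move=> n /andP[].
  rewrite mem_index_iota ltnS => /andP[_ nm] nM.
  have [nM'|nM'|/eqP] := ltngtP n M; last by rewrite (negbTE nM).
    by rewrite /proj_coef leqNgt nM'/= mul0r mulr0.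
  by rewrite hankel_coef_gt ?nM'// mul0r.
rewrite (operatorZ alpha1) ?(slant_monom0 alpha1 hW)//; first by case: hW.
exact: bergman_monom.
Qed.

Lemma inner_slant_top j : inner alpha (S (basis_e alpha j)) (monom M) = 0.
Proof.
have bM := bergman_monom alpha1 M; have LM := bergman_L2 bM.
have [bW _] := hW; have [Wb Wlin _] := bW.
(* [W] is linear on the Bergman space only, so the two sums are pushed through this functional term
   by term, with membership carried along. *)
pose L f := inner alpha (W f) (monom M).
have Llin (c : C) f g : bergman alpha f -> bergman alpha g ->
    L (fun z => c * f z + g z) = c * L f + L g.
  move=> bf bg; rewrite /L Wlin// inner_lin//; exact/bergman_L2/Wb.
have L0 : L (fun=> 0) = 0 by rewrite /L (operator0 alpha1 bW) inner0l.
have LF (r : C) i : (i <= M)%N -> L (fun z => r * monom i z) = 0.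
  move=> iM; have bi := bergman_monom alpha1 i.
  rewrite /L (operatorZ alpha1 r bW bi) innerZ//; last exact/bergman_L2/Wb.
  by rewrite (inner_slant_monom alpha1 k2 hW)// mulr0.
have bF (r : C) i : bergman alpha (fun z => r * monom i z).
  exact/bergmanZ/bergman_monom.
have [b1 E1] := linear_functional_sum alpha1 (hankel_coef alpha a ^~ j)
  (index_iota 1 m.+1) Llin L0 (fun n => bF (proj_coef alpha n j)%:C (n - j)%N).
have [b2 E2] := linear_functional_sum alpha1 (toeplitz_coef alpha a ^~ j)
  (index_iota 0 N.+1) Llin L0 (fun n => bF (proj_coef alpha 0 (n + j))%:C (0 - (n + j))%N).
rewrite /slant_little_hankel little_hankel_basis// -/(L _) Llin// E1 E2.
rewrite [X in _ + X]big1 ?addr0 => [|n _]; last by rewrite LF ?mulr0.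
rewrite big_seq_cond big1 ?mulr0// => n /andP[]; rewrite mem_index_iota ltnS => /andP[_ nm] _.
have [nM|nM] := leqP n M; last by rewrite hankel_coef_gt ?nM// mul0r.
by rewrite LF ?mulr0// (leq_trans _ nM)// leq_subr.
Qed.

Lemma normal_top_eq0 : normal_operator alpha S -> a (- M%:Z) = 0.
Proof.
move=> [bS [S' [[bS' adj] comm]]]; have [Sb Slin _] := bS; have [Sb' _ _] := bS'.
pose c := hankel_coef alpha a M M * (proj_coef alpha M M)%:C.
have be j := bergman_basis alpha1 j; have bm j := bergman_monom alpha1 j.
(* Completeness reduces this to inner products with monomials; the adjoint relation moves [S'] only
   from the right-hand argument, hence the repeated [inner_sym]. *)
have x0 : S' (basis_e alpha M) = fun=> 0.
  apply: (bergman_orth_eq0 alpha1); first exact: Sb'.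
  move=> j; rewrite (inner_sym alpha1 (bergman_L2 (bm j)) (bergman_L2 (Sb' _ (be M)))).
  rewrite -/(monom j) -adj//.
  have ME : basis_e alpha M = (fun z => (gamma_ alpha M)%:C^-1 * monom M z) by exact: basis_eE.
  have jE := monomE alpha1 j.
  rewrite jE (operatorZ alpha1 _ bS (be j)) innerZ//; last 2 first.
  - exact/bergman_L2/Sb.
  - exact: bergman_L2.
  rewrite (inner_sym alpha1 (bergman_L2 (be M)) (bergman_L2 (Sb _ (be j)))).
  rewrite ME innerZ//; last 2 first.
  - exact: bergman_L2.
  - exact/bergman_L2/Sb.
  rewrite (inner_sym alpha1 (bergman_L2 (Sb _ (be j))) (bergman_L2 (bm M))).
  by rewrite inner_slant_top !(conjc0, mulr0).
have bc : bergman alpha (fun z => c * monom 0 z) by exact: bergmanZ.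
have Sc : S' (fun z => c * monom 0 z) = fun=> 0.
  by rewrite -slant_top -comm// x0 (operator0 alpha1 bS).
have := adj _ _ (be M) bc; rewrite Sc slant_top -/c.
rewrite (inner_sym alpha1 (bergman_L2 (bergman0 alpha1)) (bergman_L2 (be M))).
rewrite inner0l ?conjc0//; last exact: bergman_L2.
rewrite (innerZ alpha1 c (bergman_L2 (bm 0%N)) (bergman_L2 bc)).
rewrite (inner_sym alpha1 (bergman_L2 bc) (bergman_L2 (bm 0%N))).
rewrite innerZ//; [|exact: bergman_L2..].
rewrite inner_monom0//; [|exact: bergman_disc_diff (bm 0%N)|exact: bergman_L2].
rewrite /monom on_discE ?normc0// expr0 mul1r conjcM conjc_real.
have mass0 i : (mass alpha i)%:C != 0 :> C.
  by rewrite -normc_gt0 normc_real normr_gt0 gt_eqF// mass_gt0.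
(* The other factors of [c] are two masses and [gamma_ alpha M], all nonzero. *)
have c0 : c == 0 -> a (- M%:Z) = 0.
  rewrite /c /proj_coef leqnn subnn rmorphM fmorphV/= /hankel_coef.
  have g0 := gammaC_neq0 alpha1 M.
  rewrite mulf_eq0 [X in _ || X]mulf_eq0 invr_eq0 !(negbTE (mass0 _)) !orbF.
  rewrite mulf_eq0 invr_eq0 mulf_eq0 (negbTE g0) !orbF.
  by rewrite conjc_eq0 => /eqP.
move: (c) c0 (mass alpha 0)%:C (mass0 0%N) => d d0 r r0 /eqP.
by rewrite mulf_eq0 mulf_eq0 (negbTE r0) orbF conjc_eq0 orbb.
Qed.

End NormalImplies.

(** * Analytic symbols give normal operators of rank at most one *)

Section AnalyticSymbol.
Context {R : realType}.
Local Notation C := R[i].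
Local Notation normc := Normc.normc.
Local Notation T := (measurableTypeR R).
Variable alpha : R.
Hypothesis alpha1 : -1 < alpha.
Implicit Types (f u v : C -> C) (c : C).

Lemma inner_self u : complex.Re (inner alpha u u) =
  dint alpha (fun p => normc (u (toC p)) ^+ 2).
Proof.
rewrite /inner Cintegral_dint /=; apply: eq_dint => p _.
by rewrite sqr_normc_ReIm creM; case: (u _) => x y /=; rewrite mulrN opprK -!expr2.
Qed.

Lemma norm2E u : norm2 alpha u = Num.sqrt (complex.Re (inner alpha u u)).
Proof. by rewrite inner_self. Qed.

Lemma inner_monom0l v : bergman alpha v ->
  inner alpha (monom 0) v = conjc (v 0) * (mass alpha 0)%:C.
Proof.
move=> bv; have Lv := bergman_L2 bv.
rewrite (inner_sym alpha1 Lv (bergman_L2 (bergman_monom alpha1 0))).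
by rewrite (inner_monom0 alpha1 (bergman_disc_diff bv) Lv) conjcM conjc_real.
Qed.

Lemma monom00 : monom 0 (0 : C) = 1.
Proof. by rewrite /monom on_discE ?normc0// expr0. Qed.

Lemma inner_monom0Z c v : bergman alpha v ->
  inner alpha (fun z => c * monom 0 z) v = c * conjc (v 0) * (mass alpha 0)%:C.
Proof.
move=> bv; rewrite innerZ ?inner_monom0l ?mulrA//; last exact: bergman_L2.
exact/bergman_L2/bergman_monom.
Qed.

(** Pythagoras: [w], which is [u] minus the constant [u 0], is orthogonal to the constants by the
    mean value property. *)
Lemma point_evaluation_le u : bergman alpha u ->
  normc (u 0) ^+ 2 * mass alpha 0 <= complex.Re (inner alpha u u).
Proof.
move=> bu; have bm := bergman_monom alpha1 0.
pose w z := - u 0 * monom 0 z + u z.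
have bw : bergman alpha w by exact: bergman_lin.
have w0 : w 0 = 0 by rewrite /w monom00 mulr1 addNr.
have [Lu Lw Lm] : [/\ L2 alpha u, L2 alpha w & L2 alpha (monom 0)].
  by split; exact: bergman_L2.
have : 0 <= complex.Re (inner alpha w w).
  by rewrite inner_self; apply: dint_ge0 => // p _; rewrite sqr_ge0.
rewrite {1}/w inner_lin// inner_monom0l// w0 conjc0 mul0r mulr0 add0r.
rewrite (inner_sym alpha1 Lw Lu) /w inner_lin// inner_monom0l//.
move: (inner alpha u u) (mass alpha 0) (u 0) => [x y] r [p q].
by rewrite sqr_normc_ReIm /=; lra.
Qed.

(** [c] times the orthogonal projection onto the constants, since that projection sends [u] to
    [u 0]. *)
Definition rank_one c u : C -> C := fun z => c * u 0 * monom 0 z.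

Lemma rank_one_bounded c : is_bounded_operator alpha (rank_one c).
Proof.
have bm := bergman_monom alpha1 0; split.
- by move=> u bu; exact: bergmanZ.
- move=> k u v _ _; apply/funext => z; rewrite /rank_one.
  by move: (u 0) (v 0) (monom 0 z) => x y t; ring.
exists (normc c) => u bu; rewrite !norm2E.
rewrite inner_monom0Z; last exact: bergmanZ.
have -> : complex.Re (c * u 0 * conjc (rank_one c u 0) * (mass alpha 0)%:C) =
    normc c ^+ 2 * (normc (u 0) ^+ 2 * mass alpha 0).
  rewrite /rank_one monom00 mulr1 mulrA -exprMn -normcM.
  by rewrite mulrC creZ creM mulrC sqr_normc_ReIm; case: (c * _) => x y /=; ring.
rewrite -{2}[normc c](ger0_norm (normc_ge0 c)) -sqrtr_sqr -sqrtrM ?sqr_ge0//.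
apply: ler_wsqrtr; rewrite ler_wpM2l ?sqr_ge0//.
exact: point_evaluation_le.
Qed.

Lemma rank_one_adjoint c : is_adjoint alpha (rank_one c) (rank_one (conjc c)).
Proof.
split=> [|u v bu bv]; first exact: rank_one_bounded.
have bm := bergman_monom alpha1 0.
have br : bergman alpha (rank_one (conjc c) v) by exact: bergmanZ.
rewrite (inner_sym alpha1 (bergman_L2 br) (bergman_L2 bu)) !inner_monom0Z//.
rewrite !conjcM !conjcK conjc_real.
by move: (conjc _) => x; rewrite [_ * x]mulrAC.
Qed.

Variables (k : nat) (W : (C -> C) -> C -> C).
Hypotheses (hW : is_W alpha k W).
Variables (a : int -> C) (N m : nat).
Hypothesis a0 : forall n, (1 <= n <= m)%N -> a (- n%:Z) = 0.
Local Notation phi := (symbol_phi alpha a N m).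
Local Notation S := (slant_little_hankel alpha W phi).

Lemma symbol_phi_analytic : phi = symbol_f alpha a N.
Proof.
apply/funext => z; rewrite /symbol_phi /symbol_g big_nat big1 ?conjc0 ?add0r// => n.
by rewrite ltnS => /a0 ->; rewrite mul0r.
Qed.

Lemma disc_diff_symbol_f : disc_diff (symbol_f alpha a N).
Proof.
have -> : symbol_f alpha a N =
    fun z => \sum_(i < N.+1) a i%:Z / (gamma_ alpha i)%:C * z ^+ i.
  apply/funext => z; rewrite /symbol_f big_mkord; apply: eq_bigr => i _.
  by rewrite [_ / _ in LHS]mulrC mulrA.
exact: (disc_diff_poly (fun i => a i%:Z / (gamma_ alpha i)%:C)).
Qed.

Lemma L2_symbol_f_mul u : L2 alpha u -> L2 alpha (fun z => symbol_f alpha a N z * u z).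
Proof.
move=> Lu; rewrite /symbol_f; elim: N.+1 => [|n IH].
  apply: (L2_eq alpha1) (bergman_L2 (bergman0 alpha1)) => z _.
  by rewrite big_geq// mul0r.
have Ln : L2 alpha (fun z => z ^+ n * u z).
  apply: (@L2_mul_bounded _ _ alpha1 _ _ 1) Lu; first exact/dmeasX/dmeas_id.
  by move=> z z1; rewrite normcX exprn_ile1 ?normc_ge0// ltW.
apply: (L2_eq alpha1) (L2_lin alpha1 (a n%:Z / (gamma_ alpha n)%:C) Ln IH) => z _.
rewrite big_nat_recr//= mulrDl addrC; congr (_ + _).
by rewrite -!mulrA; congr (_ * _); rewrite mulrCA.
Qed.

(** For [v] in the Bergman space, [v] times the conjugate of [h] is analytic, because [h] is a
    flipped analytic function. The mean value property then evaluates the inner product at 0, where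
    it agrees with that of the constant [h 0]. *)
Lemma little_hankel_analytic u : bergman alpha u ->
  little_hankel alpha phi u = rank_one (symbol_f alpha a N 0) u.
Proof.
move=> bu; rewrite symbol_phi_analytic; pose h := flip (mult_by (symbol_f alpha a N) u).
have Lh : L2 alpha h by apply: L2_flip => //; exact/L2_symbol_f_mul/bergman_L2.
apply: bergman_projE => //; apply/(is_bergman_projP alpha1 _ Lh); split=> [|v bv].
  exact/bergmanZ/bergman_monom.
have Lv := bergman_L2 bv; rewrite -/h inner_monom0Z//.
rewrite (inner_sym alpha1 Lv Lh).
have dG : disc_diff (fun z => v z * conjc (h z)).
  move=> z z1; apply: cdiffM; first exact: bergman_disc_diff bv z z1.
  apply: (@cdiff_reflect _ (mult_by (symbol_f alpha a N) u)).
  have z1' : normc (conjc z) < 1 by rewrite normc_conj.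
  apply: cdiffM; first exact: disc_diff_symbol_f.
  exact: (bergman_disc_diff bu).
rewrite /inner mean_value//; last exact: L2_cdint_able.
have -> : h 0 = symbol_f alpha a N 0 * u 0 by rewrite /h /flip /mult_by conjc0.
rewrite conjcM conjc_real [in LHS]conjcM conjcK.
by move: (conjc _) => x; rewrite [x * _]mulrC.
Qed.

Lemma slant_analytic u : bergman alpha u -> S u = rank_one (symbol_f alpha a N 0) u.
Proof.
move=> bu; rewrite /slant_little_hankel little_hankel_analytic//.
have bm := bergman_monom alpha1 0.
by rewrite (operatorZ alpha1 _ _ bm) ?(slant_monom0 alpha1 hW)//; case: hW.
Qed.

Lemma analytic_normal : normal_operator alpha S.
Proof.
pose c := symbol_f alpha a N 0.
have [Eb Elin [M EM]] := rank_one_bounded c; have [[Eb' _ _] _] := rank_one_adjoint c.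
split.
  split=> [u bu|d u v bu bv|]; first by rewrite slant_analytic//; exact: Eb.
    by rewrite !slant_analytic//; [exact: Elin|exact: bergman_lin].
  by exists M => u bu; rewrite slant_analytic//; exact: EM.
exists (rank_one (conjc c)); split.
  have [bE adj] := rank_one_adjoint c; split=> // u v bu bv.
  by rewrite slant_analytic//; exact: adj.
move=> u bu; rewrite !slant_analytic//; last exact: Eb'.
(* Both products multiply [u 0] by [c] and by [conjc c], in either order. *)
by apply/funext => z; rewrite /rank_one monom00 !mulr1 mulrCA !mulrA.
Qed.

End AnalyticSymbol.

Theorem theorem4p3 (R : realType) (alpha : R) (halpha : -1 < alpha)
    (k : nat) (hk : (2 <= k)%N)
    (W : (R[i] -> R[i]) -> R[i] -> R[i]) (hW : is_W alpha k W)
    (a : int -> R[i]) (N m : nat) :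
  normal_operator alpha
    (slant_little_hankel alpha W (symbol_phi alpha a N m)) <->
  (forall n : nat, (1 <= n <= m)%N -> a (- n%:Z) = 0).
Proof.
split=> [nS|a0]; last exact: (analytic_normal halpha hW N a0).
pose P := [pred n : nat | (1 <= n <= m)%N && (a (- n%:Z) != 0)].
suff Pn n : ~~ P n.
  by move=> n nm; have := Pn n; rewrite /= nm/= negbK => /eqP.
apply/negP => Pn; have exP : exists n, P n by exists n.
have bP i : P i -> (i <= m)%N by case/andP => /andP[].
have [M /andP[M1m aM] maxM] := ex_maxnP exP bP.
case/negP: aM; apply/eqP.
apply: (normal_top_eq0 halpha hk hW M1m _ nS) => i /andP[Mi im].
apply/eqP/negPn/negP => ai; have := maxM i; rewrite leqNgt Mi /= im ai.
by rewrite (leq_ltn_trans _ Mi)// => /(_ isT).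
Qed.
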